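(* Let $S\subseteq\mathbb{R}^k$ be a set of points in convex position. Consider arbitrary nonzero vectors $a_1,\ldots,a_n\in\mathbb{R}^k$, and let $\xi_1,\dots,\xi_n$ be independent Rademacher random variables. Then, as $k$ is fixed and $n$ tends to infinity, $$\mathbb{P}[\xi_1a_1+\ldots+\xi_na_n\in S]\le\left(2\sqrt{2/\pi}+o_k(1)\right)n^{-1/2}.$$
   Context: A Rademacher random variable takes the values $1$ and $-1$ with probability $1/2$ each. A (possibly infinite) set $S\subseteq\mathbb{R}^k$ is a set of points in convex position if no point of $S$ can be represented as a convex combination of other points of $S$. The term $o_k(1)$ denotes a quantity that tends to $0$ as $n\to\infty$ at a rate depending only on $k$ (uniformly over $S$ and $a_1,\dots,a_n$). *)

(* Defs.v *)
From HB Require Import structures.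
From mathcomp Require Export all_boot all_order all_algebra.
From mathcomp Require Export all_classical all_reals all_analysis.

Set Implicit Arguments.
Unset Strict Implicit.
Unset Printing Implicit Defensive.

Import Order.TTheory GRing.Theory Num.Theory.
Import numFieldNormedType.Exports.

Local Open Scope classical_set_scope.
Local Open Scope ring_scope.

(* [S] may be infinite; a convex combination has finitely many terms. The
   points [y i] need not be distinct: coinciding terms can be merged. *)
Definition convex_position (R : realType) (k : nat) (S : set 'rV[R]_k) : Prop :=
  forall (x : 'rV[R]_k) (m : nat) (y : 'I_m -> 'rV[R]_k) (c : 'I_m -> R),
    S x -> (forall i, S (y i) /\ y i != x) ->
    (forall i, 0 <= c i) -> \sum_(i < m) c i = 1 ->
    x != \sum_(i < m) c i *: y i.

(* Only the law of [X] is prescribed: [X] may take other values on a null set.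
   As a consequence, an event of the form "a function of such variables lies
   in an arbitrary set" can fail to be measurable (it is always measurable if
   the variables take no value other than 1 and -1), and the value of [P] is
   meaningful on measurable events only. *)
Definition rademacher d (T : measurableType d) (R : realType)
    (P : probability T R) (X : {RV P >-> R}) : Prop :=
  P [set w | X w = 1] = (2^-1)%:E /\ P [set w | X w = -1] = (2^-1)%:E.

Definition mutually_independent d (T : measurableType d) (R : realType)
    (P : probability T R) (I : finType) (X : I -> {RV P >-> R}) : Prop :=
  forall (J : {set I}) (B : I -> set R),
    (forall i, measurable (B i)) ->
    P [set w | forall i, i \in J -> B i (X i w)] =
      (\prod_(i in J) P (X i @^-1` B i))%E.

(* Main.v *)
(* Fix a small [eta] and identify sign patterns with subsets [X] of the
   index set, so that the sum is [p + \sum_(i in X) w i] with [w i = 2 a i].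
   If all but [eta n] of the [a i] lie on one line, condition on the others: a
   line meets [S] in at most two points, so after reorientation each fiber is a
   union of two antichains, and Sperner's theorem with the Wallis bound
   ['C(m, m/2) <= 2^m sqrt (2 / (pi m))] gives the constant [2 sqrt (2 / pi)].

   Otherwise the probability is at most [n^(-1/2)]. Every hit [x] is strictly
   exposed by some direction [u]. By an epsilon-net argument, directions fall
   into boundedly many cells, on each of which the sign of [u . a i] is constant
   for half of the indices [i]; so one may assume that the hits form an
   antichain. If no vector is repeated, up to sign, a positive fraction of the
   time, an antichain of positive density contains, within one level, a
   [(k+1)]-dimensional parallelepiped with nonzero edges: a random maximal chain
   leaves the down-set of the antichain at a time which changes by O(1) on
   average when boundedly many elements are exchanged, so a dense
   [(k+1)]-partite hypergraph of hits appears. Such a parallelepiped is never in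
   convex position in [R^k]. If two non-parallel vectors are each repeated
   linearly often, the hits form an antichain in a two-dimensional grid, in which
   a given short gap occurs at most twice by convexity; this forces the hits to
   be sparse. *)
Require Import Defs.
From mathcomp Require Import all_boot all_order all_algebra all_fingroup.
From mathcomp Require Import all_classical all_reals all_analysis.
From mathcomp Require Import ring lra zify.

Set Implicit Arguments.
Unset Strict Implicit.
Unset Printing Implicit Defensive.

Import Order.TTheory GRing.Theory Num.Theory.
Import numFieldNormedType.Exports.

Local Open Scope ring_scope.

(** * Random chains and antichains *)

(** Each hit has its own exposing direction, which is the main obstacle: the hits form an antichain
    only for steps on which all these directions agree in sign. Passing to half of the indices and
    conditioning on the rest costs a bounded factor. This is harmless away from a line, where the
    bounds can be made an arbitrarily small multiple of [2 ^ n / sqrt n], provided that the number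
    of cells depends on [k] only. The hyperplanes orthogonal to all steps cut out a number of cells
    that grows with [n]; those of a bounded sample of steps replace them. Near a line no factor may
    be lost, hence the separate treatment. The antichain is dense only relative to the middle
    binomial coefficient, and its members may be spread over many levels. A parallelepiped needs
    hits with a common prefix, hence at a common time; comparing each exit time with that of the
    bare prefix chain confines most hits to a bounded window of times. *)

Lemma perm_imset_trans (I : finType) (X Y : {set I}) :
  #|X| = #|Y| -> exists s : {perm I}, s @: X = Y.
Proof.
move=> eXY.
have eC : #|~: X| = #|~: Y| by apply/eqP; rewrite -(eqn_add2l #|X|) cardsC eXY cardsC.
pose sx := enum X ++ enum (~: X); pose sy := enum Y ++ enum (~: Y).
have mx x : x \in sx by rewrite mem_cat !mem_enum inE orbN.
have my x : x \in sy by rewrite mem_cat !mem_enum inE orbN.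
have uy : uniq sy.
  rewrite cat_uniq !enum_uniq andbT /=; apply/hasPn => x; rewrite !mem_enum inE.
  by [].
have ssz : size sx = size sy by rewrite !size_cat -!cardE eXY eC.
pose f x := nth x sy (index x sx).
have ix x : (index x sx < size sy)%N by rewrite -ssz index_mem.
have fi : injective f.
  move=> x y; rewrite /f (set_nth_default x y (ix y)) => /eqP.
  rewrite nth_uniq // => /eqP e.
  by rewrite -(nth_index x (mx x)) e nth_index.
exists (perm fi); apply/eqP; rewrite eqEcard card_imset; last exact: perm_inj.
rewrite eXY leqnn andbT; apply/fintype.subsetP => _ /finset.imsetP[x xX ->]; rewrite permE /f.
have xs : x \in enum X by rewrite mem_enum.
rewrite /sx index_cat xs /sy nth_cat.
have -> : (index x (enum X) < size (enum Y))%N.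
  by rewrite -cardE -eXY cardE index_mem.
rewrite -mem_enum mem_nth // -cardE -eXY cardE index_mem //.
Qed.

Lemma card_perms (I : finType) : #|{perm I}| = (#|I|)`!.
Proof.
rewrite -(cardsT I) -(card_perm [set: I]); apply: eq_card => s; rewrite !inE.
by apply/esym/fintype.subsetP => x _; rewrite inE.
Qed.

(** Double counting: composing with a permutation that carries [J] onto [X] shows that the number of
    permutations with [s @: J = X] is the same for every [X] of the size of [J]. Taking all sets for
    [F] identifies this number. *)
Lemma card_perm_imset (I : finType) (J : {set I}) (F : {set {set I}}) :
  (#|[set s : {perm I} | s @: J \in F]| * 'C(#|I|, #|J|) =
   (#|I|)`! * #|[set X in F | #|X| == #|J|]|)%N.
Proof.
have key (X : {set I}) : #|X| = #|J| ->
  #|[set s : {perm I} | s @: J == X]| = #|[set s : {perm I} | s @: J == J]|.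
  move=> eX; have [t tX] := perm_imset_trans eX.
  rewrite -(card_imset _ (mulIg t)); apply: eq_card => s; rewrite [RHS]inE.
  apply/finset.imsetP/eqP => [[s' + ->]|sJ].
    rewrite inE => /eqP s'X; rewrite -[RHS]tX -s'X -finset.imset_comp.
    by apply: eq_imset => x /=; rewrite permM.
  exists (s * t^-1)%g; rewrite ?mulgKV // inE; apply/eqP.
  apply: (finset.imset_inj (@perm_inj _ t)); rewrite tX -[RHS]sJ -finset.imset_comp.
  by apply: eq_imset => x /=; rewrite permM permKV.
set N := #|[set s : {perm I} | s @: J == J]| in key.
have main (G : {set {set I}}) :
    #|[set s : {perm I} | s @: J \in G]| =
    (#|[set X in G | #|X| == #|J|]| * N)%N.
  rewrite -[LHS]sum1dep_card.
  rewrite (partition_big (fun s : {perm I} => s @: J) (fun X => X \in [set X in G | #|X| == #|J|])).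
    rewrite -sum_nat_const; apply: eq_bigr => X; rewrite inE => /andP[XG /eqP eX].
    rewrite -(key _ eX) -[RHS]sum1dep_card; apply: eq_bigl => s.
    by case: eqP => [->|]; rewrite ?XG ?andbF.
  by move=> s sG; rewrite inE sG card_imset ?eqxx //; exact: perm_inj.
have fact : ((#|I|)`! = 'C(#|I|, #|J|) * N)%N.
  have := main [set: {set I}].
  have -> : [set s : {perm I} | s @: J \in [set: {set I}]] = [set: {perm I}].
    by apply/setP => s; rewrite !inE.
  rewrite cardsT card_perms.
  move=> ->; congr (_ * _)%N.
  by rewrite -card_draws; apply: eq_card => X; rewrite !inE.
by rewrite main fact mulnC mulnCA mulnC.
Qed.

Lemma sum_disjointU (V : zmodType) (I : finType) (A B : {set I}) (f : I -> V) :
  [disjoint A & B] ->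
  \sum_(i in A :|: B) f i = \sum_(i in A) f i + \sum_(i in B) f i.
Proof. by move=> dAB; rewrite -bigU //; apply: eq_bigl => i; rewrite !inE. Qed.

Lemma bin_le_succ (m j : nat) : (j.*2 < m)%N -> ('C(m, j) <= 'C(m, j.+1))%N.
Proof.
move=> jm; rewrite -(leq_pmul2l (ltn0Sn j)) mul_bin_left leq_mul2r; lia.
Qed.

Lemma bin_le_half (m j : nat) : ('C(m, j) <= 'C(m, m./2))%N.
Proof.
have low i : (i <= m./2)%N -> ('C(m, i) <= 'C(m, m./2))%N.
  move=> im; have [n en] : exists n, (m./2 = i + n)%N by exists (m./2 - i)%N; lia.
  elim: n i im en => [|n IH] i im en; first by rewrite en addn0.
  by apply: leq_trans (IH i.+1 _ _); [apply: bin_le_succ|..]; lia.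
have [jh|jh] := leqP j m./2; first exact: low.
have [jm|jm] := leqP j m; last by rewrite bin_small.
by rewrite -bin_sub //; apply: low; lia.
Qed.

Section PermutationAverage.
Variables (R : realType) (I : finType).
Implicit Types (F : {set {set I}}) (J : {set I}).

Definition layer F j : nat := #|[set X in F | #|X| == j]|.

(** The chance that a uniform set of size [j] belongs to [F]; it is 0 for [j] above [#|I|], where
    the division is by zero. *)
Definition layer_density F j : R := (layer F j)%:R / 'C(#|I|, j)%:R.

(** A uniform permutation carries a fixed set to a uniform set of the same size; this turns averages
    over random chains into layer densities. *)
Lemma sum_perm_imset F J :
  \sum_(s : {perm I}) (s @: J \in F)%:R =
  ((#|I|)`!)%:R * layer_density F #|J| :> R.
Proof.
have C0 : ('C(#|I|, #|J|)%:R : R) != 0.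
  by rewrite pnatr_eq0 -lt0n bin_gt0 max_card.
apply: (mulIf C0); rewrite mulrA mulfVK // -[RHS]natrM -card_perm_imset natrM.
by congr (_ * _); rewrite -natr_sum; congr (_%:R); rewrite -[RHS]sum1dep_card [RHS]big_mkcond.
Qed.

Lemma card_layers F : #|F| = (\sum_(j < #|I|.+1) layer F j)%N.
Proof.
rewrite -sum1_card (partition_big (fun X : {set I} => inord #|X| : 'I_#|I|.+1) xpredT) //.
apply: eq_bigr => j _; rewrite /layer -[RHS]sum1dep_card; apply: eq_bigl => X.
by rewrite -val_eqE /= inordK ?ltnS ?max_card.
Qed.

Lemma layer_density_ge0 F j : 0 <= layer_density F j.
Proof. by rewrite divr_ge0. Qed.

Lemma layer_density_le1 F j : layer_density F j <= 1.
Proof.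
have [jI|jI] := leqP j #|I|; last by rewrite /layer_density bin_small // mulr0n invr0 mulr0.
rewrite ler_pdivrMr ?ltr0n ?bin_gt0 // mul1r ler_nat -card_draws.
by apply: subset_leq_card; apply/fintype.subsetP => X; rewrite !inE => /andP[].
Qed.

Lemma layer_le_density F j : (layer F j)%:R <= 'C(#|I|, #|I|./2)%:R * layer_density F j.
Proof.
have [jI|jI] := leqP j #|I|; last first.
  rewrite /layer_density (bin_small jI) mulr0n invr0 !mulr0 (_ : layer F j = 0%N) //.
  apply: eq_card0 => X; rewrite !inE; apply/negP => /andP[_ /eqP e].
  by have := max_card (mem X); rewrite e leqNgt jI.
have C0 : (0 : R) < 'C(#|I|, j)%:R by rewrite ltr0n bin_gt0.
rewrite -[leLHS](mulfVK (lt0r_neq0 C0)) mulrC ler_wpM2r ?layer_density_ge0 //.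
by rewrite ler_nat bin_le_half.
Qed.

Lemma card_initial j (jI : (j <= #|I|)%N) : #|[set x in take j (enum I)]| = j.
Proof.
by rewrite cardsE (card_uniqP _) ?take_uniq ?enum_uniq // size_takel // -cardE.
Qed.

Definition antichain F := forall X Y, X \in F -> Y \in F -> X \subset Y -> X = Y.

(** A permutation maps the initial segments of the enumeration to a maximal chain, which an
    antichain meets at most once; averaging over permutations gives the LYM inequality. *)
Lemma lubell F : antichain F -> \sum_(j < #|I|.+1) layer_density F j <= 1.
Proof.
move=> aF; have f0 : (0 : R) < ((#|I|)`!)%:R by rewrite ltr0n fact_gt0.
rewrite -(ler_pM2l f0) mulr1 mulr_sumr.
pose J j := [set x in take j (enum I)].
have cJ (j : 'I_#|I|.+1) : #|J j| = j by rewrite card_initial // -ltnS.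
under eq_bigr => j _ do rewrite -(cJ j) -sum_perm_imset.
rewrite exchange_big /=.
have -> : ((#|I|)`!)%:R = \sum_(s : {perm I}) 1 :> R.
  by rewrite sumr_const card_perms.
apply: ler_sum => s _.
rewrite -natr_sum lern1.
have -> : (\sum_(j < #|I|.+1) (s @: J j \in F) = #|[set j : 'I_#|I|.+1 | s @: J j \in F]|)%N.
  by rewrite -[RHS]sum1dep_card [RHS]big_mkcond; apply: eq_bigr => j _; case: ifP.
have JS (i j : 'I_#|I|.+1) : (i <= j)%N -> s @: J i \subset s @: J j.
  move=> ij; apply: imsetS; apply/fintype.subsetP => x; rewrite !inE.
  by rewrite -(subnKC ij) takeD mem_cat => ->.
apply/card_le1_eqP => i j; rewrite !inE => iF jF; apply: val_inj => /=.
have inj := card_imset _ (@perm_inj _ s).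
have [ij|/ltnW ji] := leqP i j.
  by have := congr1 (fun X : {set I} => #|X|) (aF _ _ iF jF (JS _ _ ij)); rewrite /= !inj !cJ.
by have := congr1 (fun X : {set I} => #|X|) (aF _ _ jF iF (JS _ _ ji)); rewrite /= !inj !cJ.
Qed.

Lemma sperner F : antichain F -> (#|F| <= 'C(#|I|, #|I|./2))%N.
Proof.
move=> aF; rewrite -(ler_nat R) card_layers natr_sum.
apply: le_trans (ler_sum _ (fun (j : 'I__) _ => layer_le_density F j)) _.
by rewrite -mulr_sumr ler_piMr // lubell.
Qed.

End PermutationAverage.

Lemma sum_indicator (R : realType) (T : finType) (P : pred T) :
  \sum_x (P x)%:R = #|[set x | P x]|%:R :> R.
Proof.
rewrite -natr_sum -[in RHS]sum1dep_card [in RHS]big_mkcond.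
by congr (_%:R); apply: eq_bigr => x _; case: (P x).
Qed.

(** * Complete subcubes in dense partite hypergraphs *)

Definition mix r (T : Type) (c0 c1 : r.-tuple T) (z : 'I_r -> bool) : r.-tuple T :=
  [tuple if z s then tnth c1 s else tnth c0 s | s < r].

(** Induction on [r], as in the theorem of Erdos on complete partite hypergraphs. Slice by the first
    coordinate: by convexity of the square, two distinct slices share a proportion [d ^+ 2 / 2] of
    the [r]-tuples, and the induction applies to their common part. *)
Lemma dense_subcube (R : realType) r (d : R) : 0 < d ->
  exists q0 : nat, forall q, (q0 <= q)%N -> forall H : {set r.-tuple 'I_q},
    d * q%:R ^+ r <= #|H|%:R ->
    exists c0 c1 : r.-tuple 'I_q,
      (forall s, tnth c0 s != tnth c1 s) /\ forall z, mix c0 c1 z \in H.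
Proof.
elim: r d => [|r IH] d d0.
  exists 0%N => q _ H; rewrite expr0 mulr1 => dH.
  have /card_gt0P[x xH] : (0 < #|H|)%N by rewrite -(ltr_nat R) (lt_le_trans d0).
  exists x, x; split=> [[//]|z]; rewrite (_ : mix x x z = x) //.
  by apply: eq_from_tnth => -[].
have d20 : 0 < d ^+ 2 / 2 by rewrite divr_gt0 // exprn_gt0.
have [q0 Hq0] := IH _ d20.
(* The bound [2 / d] makes [d q >= 2], so that removing the diagonal terms below costs at most half
   of the square. *)
exists (maxn q0.+1 (Num.truncn (2 / d)).+1) => q; rewrite geq_max => /andP[qq0 qd] H dH.
have q2 : 2 <= d * q%:R.
  rewrite mulrC -ler_pdivrMr // ltW //.
  apply: lt_le_trans (_ : (Num.truncn (2 / d)).+1%:R <= _); last by rewrite ler_nat.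
  by rewrite truncnS_gt.
have q1 : (1 : R) <= q%:R by rewrite ler1n; lia.
pose h y (c : r.-tuple 'I_q) : R := ([tuple of y :: c] \in H)%:R.
pose N : R := q%:R ^+ r.
have N0 : 0 < N by rewrite exprn_gt0 //; lra.
have sH : \sum_y \sum_c h y c = #|H|%:R.
  rewrite pair_big /= -[#|H|%:R](_ : \sum_(c : r.+1.-tuple 'I_q) (c \in H)%:R = _); last first.
    by rewrite sum_indicator; congr (_%:R); apply: eq_card => c; rewrite inE.
  rewrite (reindex (fun c : r.+1.-tuple 'I_q => (thead c, [tuple of behead c]))) /=.
    apply: eq_bigr => c _; rewrite /h; congr ((_ \in H)%:R).
    by rewrite [in RHS](tuple_eta c); apply: val_inj.
  exists (fun p : 'I_q * r.-tuple 'I_q => [tuple of p.1 :: p.2]) => [c _|[y c] _] /=.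
    by rewrite [in RHS](tuple_eta c); apply: val_inj.
  by congr (_, _); apply: val_inj.
pose S := #|H|%:R : R.
have cN : \sum_(c : r.-tuple 'I_q) (1 : R) = N.
  by rewrite sumr_const card_tuple card_ord /N -natrX.
(* The sizes of the intersections of distinct slices: Cauchy-Schwarz for the full double sum, minus
   the diagonal, which contributes [S]. *)
have sq : S ^+ 2 / N - S <= \sum_y \sum_(y' | y' != y) \sum_c h y c * h y' c.
  have -> : \sum_y \sum_(y' | y' != y) \sum_c h y c * h y' c =
      \sum_c (\sum_y h y c) ^+ 2 - S.
    rewrite /S -sH [X in _ = _ - X]exchange_big -sumrB /=.
    under eq_bigr => y _ do rewrite exchange_big.
    rewrite exchange_big; apply: eq_bigr => c _ /=.
    rewrite expr2 mulr_suml -sumrB; apply: eq_bigr => y _.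
    rewrite -mulr_sumr [X in _ = h y c * X - _](bigD1 y) //= mulrDr.
    suff -> : h y c * h y c = h y c by rewrite addrC addKr.
    by rewrite /h; case: (_ \in H); rewrite ?mulr1 ?mulr0.
  rewrite lerD2r -[leLHS](_ : \sum_c (2 * (S / N) * (\sum_y h y c) - (S / N) ^+ 2) = _).
    apply: ler_sum => c _; rewrite -subr_ge0.
    by rewrite (_ : _ - _ = (\sum_y h y c - S / N) ^+ 2) ?sqr_ge0 //; ring.
  have -> : \sum_(c : r.-tuple 'I_q) (2 * (S / N) * (\sum_y h y c) - (S / N) ^+ 2) =
      2 * (S / N) * S - (S / N) ^+ 2 * N.
    rewrite sumrB -mulr_sumr exchange_big sH -cN [in RHS]mulr_sumr.
    by congr (_ - _); apply: eq_bigr => c _; rewrite mulr1.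
  by field; rewrite lt0r_neq0.
have [|no] := pselect (exists y y', y' != y /\ d ^+ 2 / 2 * N <= \sum_c h y c * h y' c).
  case=> y [y' [yy' dyy']].
  have [||c0 [c1 [c01 cz]]] := Hq0 q _ [set c : r.-tuple 'I_q | ([tuple of y :: c] \in H) && ([tuple of y' :: c] \in H)].
  - lia.
  - apply: le_trans dyy' _; rewrite -sum_indicator; apply: ler_sum => c _.
    by rewrite /h; do 2! case: (_ \in H); rewrite ?mulr1 ?mulr0.
  exists [tuple of y :: c0], [tuple of y' :: c1]; split.
    move=> s; case: (unliftP ord0 s) => [j ->|->]; last by rewrite !tnth0 eq_sym.
    by rewrite !tnthS.
  move=> z; have := cz (fun s => z (lift ord0 s)); rewrite inE => /andP[Hy Hy'].
  have -> : mix [tuple of y :: c0] [tuple of y' :: c1] z =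
     [tuple of (if z ord0 then y' else y) :: mix c0 c1 (fun s => z (lift ord0 s))].
    apply: eq_from_tnth => s; rewrite tnth_mktuple.
    by case: (unliftP ord0 s) => [j ->|->]; rewrite ?tnth0 // !tnthS tnth_mktuple.
  by case: (z ord0).
exfalso.
have : \sum_y \sum_(y' | y' != y) \sum_c h y c * h y' c <= q%:R * (q%:R - 1) * (d ^+ 2 / 2 * N).
  apply: (@le_trans _ _ (\sum_(y < q) \sum_(y' < q | y' != y) d ^+ 2 / 2 * N)).
    apply: ler_sum => y _; apply: ler_sum => y' yy'; rewrite leNgt; apply/negP => lt.
    by apply: no; exists y, y'; split=> //; apply: ltW.
  rewrite (eq_bigr (fun => (q%:R - 1) * (d ^+ 2 / 2 * N))).
    by rewrite sumr_const card_ord -[leRHS]mulrA mulr_natl.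
  move=> y _; rewrite sumr_const -[LHS]mulr_natl; congr (_ * _).
  have := cardC1 y; rewrite card_ord => e.
  by rewrite [X in X%:R](_ : _ = q.-1) // -subn1 natrB //; lia.
apply/negP; rewrite -ltNge; apply: lt_le_trans sq.
have Sq : d * q%:R * N <= S by rewrite /S (le_trans _ dH) // exprS mulrA.
have e : S ^+ 2 / N - S = S * (S / N - 1) by field; rewrite lt0r_neq0.
have Sq' : d * q%:R <= S / N by rewrite ler_pdivlMr.
rewrite e; apply: (@lt_le_trans _ _ (d * q%:R * N * (d * q%:R - 1))).
  have dN : 0 < d * N by rewrite mulr_gt0.
  have -> : q%:R * (q%:R - 1) * (d ^+ 2 / 2 * N) = (d * N * q%:R) * (d / 2 * (q%:R - 1)) by field.
  have -> : d * q%:R * N * (d * q%:R - 1) = (d * N * q%:R) * (d * q%:R - 1) by ring.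
  rewrite ltr_pM2l; last by rewrite mulr_gt0 //; lra.
  have -> : d / 2 * (q%:R - 1) = d * q%:R / 2 - d / 2 by field.
  lra.
have dqN : 0 <= d * q%:R * N by rewrite mulr_ge0 ?ltW // mulr_gt0 //; lra.
by apply: ler_pM => //; lra.
Qed.

(** * Time shifts and collisions under random permutations *)

(** A shift by [r] is a succession of [r] unit shifts, and each of them telescopes to a difference
    of two values in the unit interval. *)
Lemma sum_shift_le (R : realType) (mu : nat -> R) (n r : nat) :
  (forall t, 0 <= mu t <= 1) -> \sum_(t < n) (mu t - mu (r + t)%N) <= r%:R.
Proof.
elim: r mu => [|r IH] mu mu01; first by rewrite big1 // => t _; rewrite add0n subrr.
have -> : \sum_(t < n) (mu t - mu (r.+1 + t)%N) =
    \sum_(t < n) (mu t - mu t.+1) + \sum_(t < n) (mu t.+1 - mu (r + t).+1).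
  by rewrite -big_split; apply: eq_bigr => t _ /=; rewrite addSn addrA subrK.
rewrite -natr1 addrC lerD //; first by apply: (IH (mu \o S)) => t /=.
rewrite -(big_mkord xpredT (fun t => mu t - mu t.+1)).
under eq_bigr => t _ do rewrite -opprB.
rewrite sumrN telescope_sumr // opprB.
by have /andP[_ ?] := mu01 0%N; have /andP[? _] := mu01 n; lra.
Qed.

Lemma sum_truth_le (R : realType) (T : finType) (P : pred T) (n : nat) :
  (#|P| <= n)%N -> \sum_x (P x)%:R <= n%:R :> R.
Proof. by move=> Pn; rewrite sum_indicator ler_nat cardsE. Qed.

Lemma sum_truth_le1 (R : realType) (T : finType) (P : pred T) :
  (forall x y, P x -> P y -> x = y) -> \sum_x (P x)%:R <= 1 :> R.
Proof.
move=> P1; apply: (sum_truth_le R (n := 1)); apply/card_le1_eqP => x y xP yP.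
exact: P1.
Qed.

Lemma perm_pair_sym (R : realType) (I : finType) (w : rel I) (a b b' : I) :
  b != a -> b' != a ->
  \sum_(s : {perm I}) (w (s a) (s b))%:R =
  \sum_(s : {perm I}) (w (s a) (s b'))%:R :> R.
Proof.
move=> ba b'a; rewrite (reindex_inj (mulgI (tperm b b'))); apply: eq_bigr => s _.
by rewrite !permM tpermL tpermD.
Qed.

(** By symmetry [b] may be replaced by an average over all elements other than [a]; for a fixed
    permutation at most [K #|I|] of them collide with [a]. The factor 2 absorbs
    [#|I| / (#|I| - 1)]. *)
Lemma perm_collision (R : realType) (I : finType) (V : eqType) (w : I -> V)
    (K : R) (a b : I) :
  a != b -> (forall v, #|[set i | w i == v]|%:R <= K * #|I|%:R) ->
  \sum_(s : {perm I}) (w (s a) == w (s b))%:R <= 2 * K * ((#|I|)`!)%:R.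
Proof.
move=> ab wK; rewrite eq_sym in ab.
have m2 : (1 < #|I|)%N.
  by have := max_card (mem [set a; b]); rewrite cards2 eq_sym ab.
set x := \sum_s _; have f0 : 0 <= ((#|I|)`!)%:R :> R by [].
have : (#|I|%:R - 1) * x <= K * #|I|%:R * ((#|I|)`!)%:R.
  have -> : (#|I|%:R - 1) * x = \sum_(b' | b' != a) \sum_(s : {perm I}) (w (s a) == w (s b'))%:R.
    rewrite (eq_bigr (fun=> x)) => [|b' b'a]; last first.
      exact: (perm_pair_sym R (fun i j => w i == w j) b'a ab).
    rewrite sumr_const -[RHS]mulr_natl; congr (_ * _).
    by rewrite [X in _ = X%:R](cardC1 a) -subn1 natrB //; lia.
  rewrite exchange_big /= -card_perms mulr_natr -sumr_const.
  apply: ler_sum => s _; apply: le_trans (wK (w (s a))).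
  rewrite -sum_indicator [leRHS](reindex_inj (@perm_inj _ s)) /=.
  rewrite big_mkcond; apply: ler_sum => b' _.
  by case: ifP => // _; rewrite eq_sym.
have m2R : (2 : R) <= #|I|%:R by rewrite ler_nat.
have K0 : 0 <= K.
  by rewrite -(pmulr_lge0 _ (_ : 0 < #|I|%:R)) ?(le_trans _ (wK (w a))) //; lra.
move=> H; rewrite -(ler_pM2l (_ : 0 < #|I|%:R - 1)); last by lra.
have := mulr_ge0 K0 f0; move: ((#|I|)`!%:R : R) H => f H Kf.
apply: le_trans H _; rewrite -subr_ge0.
have -> : (#|I|%:R - 1) * (2 * K * f) - K * #|I|%:R * f = (#|I|%:R - 2) * (K * f) by ring.
by rewrite mulr_ge0 //; lra.
Qed.

Lemma layer_le_bin (I : finType) (F : {set {set I}}) j : (layer F j <= 'C(#|I|, j))%N.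
Proof.
rewrite -card_draws.
by apply: subset_leq_card; apply/fintype.subsetP => X; rewrite !inE => /andP[].
Qed.

(** The ratio of consecutive binomial coefficients compares a level below [N] with its successor,
    itself at most the middle one; high levels follow by symmetry. *)
Lemma bin_outer (R : realType) (m N j : nat) :
  (N < m)%N -> (j < N)%N || (m < N + j)%N ->
  'C(m, j)%:R <= N%:R / (m - N)%:R * 'C(m, m./2)%:R :> R.
Proof.
move=> Nm; have low i : (i < N)%N -> 'C(m, i)%:R <= N%:R / (m - N)%:R * 'C(m, m./2)%:R :> R.
  move=> iN; have p : (0 : R) < (m - N)%:R by rewrite ltr0n subn_gt0.
  rewrite mulrAC ler_pdivlMr // -!natrM ler_nat.
  apply: (@leq_trans ('C(m, i) * (m - i))); first by rewrite leq_mul2l; lia.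
  rewrite mulnC -mul_bin_left; apply: leq_mul => //; exact: bin_le_half.
case/orP => [/low //|Nj]; have [jm|jm] := leqP j m; last first.
  by rewrite bin_small // mulr_ge0 // divr_ge0.
by rewrite -bin_sub //; apply: low; lia.
Qed.

(** * A parallelepiped inside a dense antichain *)

Section Core.
Variables (R : realType) (I : finType) (V : eqType) (w : I -> V).
Variables (r q : nat).
Variable F : {set {set I}}.
Hypothesis aF : antichain F.
Hypothesis rqI : (r * q <= #|I|)%N.

Let D : {set {set I}} := [set X : {set I} | [exists Y in F, X \subset Y]].

Lemma down_closed (X Y : {set I}) : Y \in D -> X \subset Y -> X \in D.
Proof.
rewrite !inE => /existsP[Z /andP[ZF YZ]] XY; apply/existsP; exists Z.
by rewrite ZF (fintype.subset_trans XY).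
Qed.

Lemma family_sub_down X : X \in F -> X \in D.
Proof. by move=> XF; rewrite inE; apply/existsP; exists X; rewrite XF /=. Qed.

(** Members of [F] are maximal in the down-set [D], so a chain that hits [F] leaves [D] right after
    the hit. *)
Lemma above_notin_down (X Y : {set I}) : X \in F -> X \proper Y -> Y \notin D.
Proof.
move=> XF XY; apply/negP; rewrite inE => /existsP[Z /andP[ZF YZ]].
have XZ := fintype.proper_sub_trans XY YZ.
by have := aF XF ZF (fintype.proper_sub XZ) => e; rewrite e fintype.properxx in XZ.
Qed.

(* Positions of the random order are split into [r] pools of [q] positions, the
   [g l c], and the list [rest]. A choice [c] of one position per pool and a time
   [t] give the set [J c t]; a random permutation [s] turns [J c] into a chain. *)
Let pos_lt (g : 'I_#|{: 'I_r * 'I_q}|) : (g < #|I|)%N.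
Proof. by apply: leq_trans (ltn_ord g) _; rewrite card_prod !card_ord. Qed.

Let g (l : 'I_r) (c : 'I_q) : I := enum_val (Ordinal (pos_lt (enum_rank (l, c)))).

Lemma pool_inj l c l' c' : g l c = g l' c' -> l = l' /\ c = c'.
Proof. by move/enum_val_inj => [] /val_inj /enum_rank_inj [-> ->]. Qed.

Let rest : seq I := enum [set x | [forall l, forall c, g l c != x]].

Let L := (#|I| - r * q)%N.

Lemma size_rest : size rest = L.
Proof.
have := cardC [set g p.1 p.2 | p : 'I_r * 'I_q].
rewrite card_imset; last first.
  by move=> [l c] [l' c'] /= /pool_inj[-> ->].
rewrite card_prod !card_ord /L => <-; rewrite addKn -cardE; apply: eq_card => x.
rewrite !inE; apply/forallP/negP.
  by move=> gx /finset.imsetP[[l c] _ xE]; have /forallP/(_ c)/eqP := gx l; apply.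
move=> gx l; apply/forallP => c; apply/eqP => e; apply: gx.
by apply/finset.imsetP; exists (l, c).
Qed.

Let E (t : nat) : {set I} := [set x in take t rest].
Let T (c : r.-tuple 'I_q) : {set I} := [set g l (tnth c l) | l : 'I_r].
Let J (c : r.-tuple 'I_q) (t : nat) := T c :|: E t.

Lemma pool_notin_prefix l c t : g l c \notin E t.
Proof.
rewrite inE; apply/negP => /mem_take; rewrite mem_enum inE => /forallP/(_ l)/forallP/(_ c).
by rewrite eqxx.
Qed.

Lemma card_prefix t : (t <= L)%N -> #|E t| = t.
Proof.
by move=> tL; rewrite cardsE (card_uniqP _) ?take_uniq ?enum_uniq // size_takel // size_rest.
Qed.

Lemma card_chain c t : (t <= L)%N -> #|J c t| = (r + t)%N.
Proof.
move=> tL; rewrite cardsU card_prefix // card_imset; last by move=> l l' /pool_inj[].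
rewrite card_ord (_ : T c :&: E t = finset.set0) ?cards0 ?subn0 //.
apply/setP => x; rewrite finset.in_setI finset.in_set0; apply/negP => /andP[/finset.imsetP[l _ ->]].
by rewrite (negbTE (pool_notin_prefix _ _ _)).
Qed.

Lemma prefix_mono t t' : (t <= t')%N -> E t \subset E t'.
Proof.
move=> tt'; apply/fintype.subsetP => x; rewrite !inE.
by rewrite -(subnKC tt') takeD mem_cat => ->.
Qed.


Hypothesis q0 : (0 < q)%N.
Variable dl : R.
Hypothesis dl0 : 0 < dl.
Let m := #|I|.
Hypothesis rqm : (r * q < m)%N.
Hypothesis outer_small : (r * q)%:R * ((r * q)%:R / (m - r * q)%:R) <= dl / 2.
Hypothesis F_large : dl * 'C(m, m./2)%:R <= #|F|%:R.

(** The chains visit levels [r] to [r + L] only. The other levels, [r * q] in number, are extreme,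
    and by [outer_small] they carry at most half of the assumed size of [F]. *)
Lemma inner_density : dl / 2 <= \sum_(t < L.+1) layer_density R F (r + t).
Proof.
have B0 : (0 : R) < 'C(m, m./2)%:R by rewrite ltr0n bin_gt0; lia.
rewrite -(ler_pM2l B0) mulr_sumr.
have rN : (r <= r * q)%N by rewrite leq_pmulr.
have out : \sum_(0 <= j < r) (layer F j)%:R + \sum_(r + L.+1 <= j < m.+1) (layer F j)%:R <=
   'C(m, m./2)%:R * (dl / 2).
  pose b : R := (r * q)%:R / (m - r * q)%:R * 'C(m, m./2)%:R.
  apply: (@le_trans _ _ (\sum_(0 <= j < r) b + \sum_(r + L.+1 <= j < m.+1) b)).
    apply: lerD; apply: ler_sum_nat => j jr.
      apply: le_trans (_ : 'C(m, j)%:R <= _); first by rewrite ler_nat layer_le_bin.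
      by apply: bin_outer => //; apply/orP; left; lia.
    apply: le_trans (_ : 'C(m, j)%:R <= _); first by rewrite ler_nat layer_le_bin.
    by apply: bin_outer => //; apply/orP; right; move: jr; rewrite /L -/m; lia.
  rewrite !sumr_const_nat -mulrnDr (_ : (_ + _)%N = (r * q)%N); last by rewrite /L -/m; lia.
  have -> : b *+ (r * q) = 'C(m, m./2)%:R * ((r * q)%:R * ((r * q)%:R / (m - r * q)%:R)).
    by rewrite /b -[LHS]mulr_natr; ring.
  by rewrite (ler_pM2l B0).
have tot : #|F|%:R = \sum_(0 <= j < m.+1) (layer F j)%:R :> R.
  by rewrite card_layers natr_sum big_mkord.
have inn : \sum_(r <= j < r + L.+1) (layer F j)%:R <=
   \sum_(t < L.+1) 'C(m, m./2)%:R * layer_density R F (r + t).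
  rewrite -{1}[r]add0n big_addn addKn big_mkord.
  by apply: ler_sum => t _; rewrite addnC; exact: layer_le_density.
move: F_large; rewrite tot (big_cat_nat (n := r)) //=; last by lia.
rewrite (big_cat_nat (m := r) (n := (r + L.+1)%N)) /= ?leq_addr //; last by rewrite /L -/m; lia.
lra.
Qed.

Let fct : R := ((#|I|)`!)%:R.

Lemma sum_hits_ge c :
  fct * (dl / 2) <= \sum_(s : {perm I}) \sum_(t < L.+1) (s @: J c t \in F)%:R.
Proof.
rewrite exchange_big /= (eq_bigr (fun t : 'I_L.+1 => fct * layer_density R F (r + t))).
  by rewrite -mulr_sumr ler_wpM2l ?inner_density // /fct.
by move=> t _; rewrite sum_perm_imset card_chain // -ltnS.
Qed.

(** As [D] is closed downwards, the number of times spent in [D] is the exit time of the chain. [T0]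
    is that of the bare prefixes and does not depend on the choice [c]. *)
Let T0 (s : {perm I}) : R := \sum_(t < L.+1) (s @: E t \in D)%:R.
Let Tc (s : {perm I}) c : R := \sum_(t < L.+1) (s @: J c t \in D)%:R.

Lemma chain_exit_le s c : Tc s c <= T0 s.
Proof.
apply: ler_sum => t _; case: (boolP (_ \in D)) => // JD.
by rewrite (down_closed JD) // imsetS // finset.subsetUr.
Qed.

(* The two densities compared at time [t] are those of levels [t] and [r + t]
   of the same down-set, so the sum telescopes to at most [r]. *)
Lemma sum_exit_delay_le c : \sum_(s : {perm I}) (T0 s - Tc s c) <= fct * r%:R.
Proof.
rewrite sumrB /T0 /Tc exchange_big /= [X in _ - X]exchange_big /= -sumrB.
rewrite (eq_bigr (fun t : 'I_L.+1 => fct * (layer_density R D t - layer_density R D (r + t)))).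
  rewrite -mulr_sumr ler_wpM2l ?/fct // sum_shift_le // => t.
  by rewrite layer_density_ge0 layer_density_le1.
by move=> t _; rewrite (sum_perm_imset R D (E t)) (sum_perm_imset R D (J c t)) (@card_chain c t) ?(@card_prefix t) -?mulrBr // -ltnS.
Qed.

Lemma chain_mono c t t' : (t <= t')%N -> J c t \subset J c t'.
Proof. by move=> tt'; rewrite finset.setUS // prefix_mono. Qed.

(** Up to time [t] the chain lies below a member of [F], afterwards strictly above it; times start
    at 0, whence [t.+1]. *)
Lemma hit_at_exit (s : {perm I}) c (t : 'I_L.+1) : s @: J c t \in F -> Tc s c = t.+1%:R.
Proof.
move=> hit; rewrite /Tc sum_indicator; congr (_%:R).
have wi : injective (widen_ord (ltn_ord t)) by move=> x y /(congr1 val) /= /val_inj.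
rewrite -[RHS](card_ord t.+1) -[RHS](card_imset _ wi).
apply: eq_card => t'; rewrite inE; apply/idP/finset.imsetP => [t'D|[u _ ->]]; last first.
  by apply: down_closed (family_sub_down hit) _; rewrite imsetS // chain_mono //= -ltnS.
have t't : (t' < t.+1)%N.
  rewrite ltnS leqNgt; apply/negP => tt'; move: t'D; apply/negP.
  apply: above_notin_down hit _; rewrite properEcard imsetS ?chain_mono ?(ltnW tt') //=.
  have tL (u : 'I_L.+1) : (u <= L)%N by rewrite -ltnS.
  rewrite !(card_imset _ (@perm_inj _ s)) (card_chain c (tL t)) (card_chain c (tL t')). by rewrite ltn_add2l.
by exists (Ordinal t't) => //; apply: val_inj.
Qed.

Lemma hits_le1 (s : {perm I}) c : \sum_(t < L.+1) (s @: J c t \in F)%:R <= 1 :> R.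
Proof.
apply: (@sum_truth_le1 R _ (fun t : 'I_L.+1 => s @: J c t \in F)) => t t' tF t'F; apply: val_inj.
by apply/eqP; have := hit_at_exit t'F; rewrite (hit_at_exit tF) => /eqP; rewrite eqr_nat.
Qed.

Variable C : nat.
Hypothesis C_large : 4 * r%:R / dl <= C%:R.
Hypothesis r0 : (0 < r)%N.

Lemma C_gt0 : 0 < C%:R :> R.
Proof. by apply: lt_le_trans C_large; rewrite divr_gt0 // mulr_gt0 // ltr0n. Qed.

(** The chain of a close hit leaves [D] less than [C] steps before the prefix chain does. As [T0]
    ignores [c], the close hits of all choices fall in one window of [C] times. *)
Let close (s : {perm I}) c (t : nat) := (s @: J c t \in F) && (T0 s < t.+1%:R + C%:R).

(** Markov's inequality: a hit that is not close has a delay of at least [C], while the mean delay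
    is at most [r]; by [C_large] the loss is at most [dl / 4]. *)
Lemma sum_close_hits_ge c :
  fct * (dl / 4) <= \sum_(s : {perm I}) \sum_(t < L.+1) (close s c t)%:R.
Proof.
have C0 := C_gt0.
have H (s : {perm I}) : \sum_(t < L.+1) (s @: J c t \in F)%:R - (T0 s - Tc s c) / C%:R <=
    \sum_(t < L.+1) (close s c t)%:R.
  have d0 : 0 <= (T0 s - Tc s c) / C%:R by rewrite divr_ge0 // subr_ge0 chain_exit_le.
  have [[t hit]|no] := pselect (exists t : 'I_L.+1, s @: J c t \in F); last first.
    rewrite big1 => [|t _]; last by case: (boolP (_ \in F)) => // ?; case: no; exists t.
    by rewrite sub0r (@le_trans _ _ 0) ?oppr_le0 // sumr_ge0.
  have [cl|ncl] := boolP (close s c t).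
    apply: (@le_trans _ _ 1); last by rewrite (bigD1 t) //= cl lerDl sumr_ge0.
    by have := hits_le1 s c; lra.
  move: ncl; rewrite /close hit /= -leNgt => far.
  apply: (@le_trans _ _ 0); last by rewrite sumr_ge0.
  rewrite subr_le0 (le_trans (hits_le1 s c)) // ler_pdivlMr // mul1r (hit_at_exit hit).
  lra.
apply: le_trans (ler_sum _ (fun s _ => H s)).
rewrite sumrB -mulr_suml; have := sum_hits_ge c; have := sum_exit_delay_le c.
set x := \sum_s (T0 s - _); set y := \sum_s \sum_t _ => xr yd.
have : x / C%:R <= fct * (dl / 4).
  rewrite ler_pdivrMr // (le_trans xr) // -mulrA ler_wpM2l ?/fct //.
  by move: C_large; rewrite ler_pdivrMr //; lra.
lra.
Qed.

Variable K : R.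
Hypothesis small_classes : forall v, #|[set i | w i == v]|%:R <= K * #|I|%:R.
Hypothesis K_small : (r * q)%:R ^+ 2 * (2 * K) <= dl / 16.

Let collide (s : {perm I}) :=
  [exists p : ('I_r * 'I_q) * ('I_r * 'I_q),
    (p.1 != p.2) && (w (s (g p.1.1 p.1.2)) == w (s (g p.2.1 p.2.2)))].

Lemma sum_collisions_le : \sum_(s : {perm I}) (collide s)%:R <= fct * (dl / 16).
Proof.
have [f0 N0] : 0 <= fct /\ 0 <= fct by rewrite /fct.
apply: (@le_trans _ _ (\sum_(s : {perm I}) \sum_(p : ('I_r * 'I_q) * ('I_r * 'I_q))
    ((p.1 != p.2) && (w (s (g p.1.1 p.1.2)) == w (s (g p.2.1 p.2.2))))%:R)).
  apply: ler_sum => s _; rewrite /collide; case: existsP => [[p Hp]|_]; last exact: sumr_ge0.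
  by rewrite (bigD1 p) //= Hp lerDl sumr_ge0.
rewrite exchange_big /= mulrC.
have K0 : 0 <= K.
  have [i _] : exists i : I, true.
    have /card_gt0P[i _] : (0 < #|I|)%N by apply: leq_ltn_trans rqm.
    by exists i.
  rewrite -(pmulr_lge0 _ (_ : 0 < #|I|%:R)) ?(le_trans _ (small_classes (w i))) //.
  by rewrite ltr0n; apply: leq_ltn_trans rqm.
apply: (@le_trans _ _ (\sum_(p : ('I_r * 'I_q) * ('I_r * 'I_q)) 2 * K * fct)).
  apply: ler_sum => -[[l c] [l' c']] _ /=.
  have [e|ne] := eqVneq (l, c) (l', c').
    by rewrite big1 // !mulr_ge0.
  rewrite /=; apply: perm_collision => //.
  by apply: contra ne => /eqP /pool_inj [-> ->].
rewrite sumr_const !card_prod !card_ord -[leLHS]mulr_natl !natrM mulrA ler_wpM2r //.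
by move: K_small; rewrite natrM expr2 !mulrA.
Qed.

(** If no permutation qualified, the mean number of close hits, summed over [c], would be at most
    [q ^ r (dl / 16 + dl / 8)], less than the [q ^ r dl / 4] already secured; permutations with a
    collision account for the first term. *)
Lemma good_perm : exists s, ~~ collide s /\
  q%:R ^+ r * (dl / 8) <= \sum_(c : r.-tuple 'I_q) \sum_(t < L.+1) (close s c t)%:R.
Proof.
have f0 : 0 < fct by rewrite /fct ltr0n fact_gt0.
have Q0 : 0 < q%:R ^+ r :> R by rewrite exprn_gt0 // ltr0n.
have cQ (x : R) : \sum_(c : r.-tuple 'I_q) x = q%:R ^+ r * x.
  by rewrite sumr_const card_tuple card_ord -[LHS]mulr_natl natrX.
have [//|no] := pselect (exists s, ~~ collide s /\
  q%:R ^+ r * (dl / 8) <= \sum_(c : r.-tuple 'I_q) \sum_(t < L.+1) (close s c t)%:R).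
exfalso.
have H (s : {perm I}) : \sum_(c : r.-tuple 'I_q) \sum_(t < L.+1) (close s c t)%:R <=
    q%:R ^+ r * (collide s)%:R + q%:R ^+ r * (dl / 8).
  have [col|ncol] := boolP (collide s).
    rewrite mulr1; apply: (@le_trans _ _ (q%:R ^+ r)); last by rewrite lerDl mulr_ge0 ?(ltW Q0) ?divr_ge0 ?(ltW dl0).
    rewrite -[leRHS]mulr1 -cQ; apply: ler_sum => c _.
    apply: le_trans (hits_le1 s c); apply: ler_sum => t _; rewrite /close.
    by case: (_ \in F) => //=; case: (_ < _).
  rewrite mulr0 add0r leNgt; apply/negP => lt; apply: no; exists s; split=> //.
  exact: ltW.
have : q%:R ^+ r * (fct * (dl / 4)) <=
    \sum_(s : {perm I}) \sum_(c : r.-tuple 'I_q) \sum_(t < L.+1) (close s c t)%:R.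
  by rewrite exchange_big /= -cQ; apply: ler_sum => c _; exact: sum_close_hits_ge.
apply/negP; rewrite -ltNge; apply: le_lt_trans (ler_sum _ (fun s _ => H s)) _.
rewrite big_split /= -mulr_sumr sumr_const card_perms -[X in _ + X]mulr_natl -/fct.
have := sum_collisions_le; set y := \sum_s _ => yb.
rewrite mulrCA -mulrDr ltr_pM2l //.
have : 0 < fct * dl by rewrite mulr_gt0.
lra.
Qed.

Hypothesis kst : forall H : {set r.-tuple 'I_q},
  dl / (16 * C%:R) * q%:R ^+ r <= #|H|%:R ->
  exists c0 c1 : r.-tuple 'I_q,
    (forall s, tnth c0 s != tnth c1 s) /\ forall z, mix c0 c1 z \in H.

(** Pigeonhole over the window [W] of at most [C] times: if every time stayed below the threshold,
    the total would be at most [q ^ r dl / 16]. *)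
Lemma popular_level s :
  q%:R ^+ r * (dl / 8) <= \sum_(c : r.-tuple 'I_q) \sum_(t < L.+1) (close s c t)%:R ->
  exists t : 'I_L.+1, dl / (16 * C%:R) * q%:R ^+ r <= #|[set c | close s c t]|%:R.
Proof.
have C0 := C_gt0; have Q0 : 0 < q%:R ^+ r :> R by rewrite exprn_gt0 // ltr0n.
move=> big; have [//|no] := pselect (exists t : 'I_L.+1,
  dl / (16 * C%:R) * q%:R ^+ r <= #|[set c | close s c t]|%:R).
exfalso; move: big; apply/negP; rewrite -ltNge exchange_big /=.
pose n0 := #|[set t : 'I_L.+1 | s @: E t \in D]|.
have T0n : T0 s = n0%:R by rewrite /T0 sum_indicator.
pose W := [set t : 'I_L.+1 | (t < n0 <= t + C)%N].
have Cn : (0 < C)%N by move: C0; rewrite ltr0n.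
have WC : (#|W| <= C)%N.
  pose f (t : 'I_L.+1) : 'I_C.-1.+1 := inord (n0 - t.+1).
  have fW : {in W &, injective f}.
    move=> t t'; rewrite !inE => /andP[t1 t2] /andP[t1' t2'] /(congr1 val).
    by rewrite /= !inordK; [move=> ?; apply: val_inj => /=; lia | lia | lia].
  by rewrite -(card_in_imset fW) (leq_trans (max_card _)) // card_ord prednK.
have closeW c (t : 'I_L.+1) : close s c t -> t \in W.
  move=> /andP[hit]; rewrite T0n -natrD ltr_nat inE addSn ltnS => ->; rewrite andbT.
  by have := chain_exit_le s c; rewrite T0n (hit_at_exit hit) ler_nat.
apply: (@le_lt_trans _ _ (\sum_(t in W) dl / (16 * C%:R) * q%:R ^+ r)).
  rewrite [leRHS]big_mkcond; apply: ler_sum => t _; rewrite sum_indicator; case: ifP => tW.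
    by rewrite leNgt; apply/negP => lt; apply: no; exists t; exact: ltW.
  rewrite (eq_card0 (A := [set c | close s c t])) // => c; rewrite inE.
  by apply/negP => /closeW; rewrite tW.
rewrite sumr_const -[ltLHS]mulr_natl.
apply: (@le_lt_trans _ _ (C%:R * (dl / (16 * C%:R) * q%:R ^+ r))).
  by rewrite ler_wpM2r ?ler_nat // mulr_ge0 ?ltW // divr_gt0 // mulr_gt0.
have -> : C%:R * (dl / (16 * C%:R) * q%:R ^+ r) = q%:R ^+ r * (dl / 16).
  by field; rewrite lt0r_neq0.
by rewrite ltr_pM2l //; have := dl0; lra.
Qed.

(** At a popular time all hits share the image of one prefix and differ only in their pool elements;
    a subcube of choices becomes the cube, and the absence of collisions separates the two ends of
    each edge under [w]. *)
Lemma antichain_cube : exists (E0 : {set I}) (v0 v1 : 'I_r -> I),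
  (forall l, w (v0 l) != w (v1 l)) /\
  forall z : 'I_r -> bool, let v l := if z l then v1 l else v0 l in
    [/\ injective v, forall l, v l \notin E0 & [set v l | l : 'I_r] :|: E0 \in F].
Proof.
have [s [ncol /popular_level[t /kst[c0 [c1 [c01 cz]]]]]] := good_perm.
exists (s @: E t), (fun l => s (g l (tnth c0 l))), (fun l => s (g l (tnth c1 l))).
split=> [l|z v].
  apply: contraNN ncol => e; apply/existsP; exists ((l, tnth c0 l), (l, tnth c1 l)).
  rewrite /= e andbT; apply: contraNN (c01 l) => /eqP[] ->; exact: eqxx.
have vE l : v l = s (g l (tnth (mix c0 c1 z) l)).
  by rewrite /v tnth_mktuple; case: (z l).
split.
- by move=> l l'; rewrite !vE => /perm_inj /pool_inj[].
- move=> l; rewrite vE; apply/negP => /finset.imsetP[x xE /perm_inj e].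
  by move: (pool_notin_prefix l (tnth (mix c0 c1 z) l) t); rewrite e xE.
- have := cz z; rewrite inE => /andP[+ _]; rewrite /J finset.imsetU /T -finset.imset_comp.
  congr (is_true (_ :|: _ \in F)).
  apply/setP => x; apply/finset.imsetP/finset.imsetP => [[l _ ->]|[l _ ->]]; exists l => //.
Qed.

End Core.

(** * Convex position *)

Section ConvexPosition.
Variables (R : realType) (k : nat).
Implicit Types (S : set 'rV[R]_k) (x p : 'rV[R]_k).

(* [d_s] for [s <= k] satisfy a linear relation [\sum_s la_s d_s = 0]; at the
   vertex of the parallelepiped selected by the signs of [la], it expresses the
   vertex as a convex combination of its neighbours. *)
Lemma convex_position_no_cube S p (d : 'I_k.+1 -> 'rV[R]_k) :
  convex_position S -> (forall s, d s != 0) ->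
  (forall z : 'I_k.+1 -> bool, S (p + \sum_s (if z s then d s else 0))) -> False.
Proof.
move=> cS d0 Sd.
pose M := \matrix_s d s; pose la := nz_row (kermx M).
have la0 : la != 0.
  rewrite nz_row_eq0 -mxrank_eq0 mxrank_ker subn_eq0 -ltnNge.
  by apply: leq_ltn_trans (rank_leq_col M) _.
have laM : \sum_s la 0 s *: d s = 0.
  have /sub_kermxP := nz_row_sub (kermx M); rewrite -/la => e; rewrite -[RHS]e.
  by rewrite mulmx_sum_row; apply: eq_bigr => s _; rewrite rowK.
pose z s := la 0 s < 0.
pose x := p + \sum_s (if z s then d s else 0).
pose y s := x + (if z s then - d s else d s).
pose A := \sum_s `|la 0 s|.
have A0 : 0 < A.
  rewrite lt_neqAle sumr_ge0 ?andbT //; apply: contra la0 => /eqP/esym A0.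
  apply/eqP/rowP => s; rewrite mxE; apply/eqP; rewrite -normr_eq0.
  by move/psumr_eq0P: A0 => -> // ? _.
have Sy s : S (y s).
  have := Sd (fun t => if t == s then ~~ z t else z t).
  congr (S _); rewrite /y /x (bigD1 s) //= eqxx [in RHS](bigD1 s) //= -addrA; congr (_ + _).
  rewrite (eq_bigr (fun t => if z t then d t else 0)) => [|t /negbTE -> //].
  by case: (z s); rewrite /= ?add0r [RHS]addrC ?addrA ?addNr ?addKr ?add0r // addrC.
have Hy s : S (y s) /\ y s != x.
  split=> //; rewrite /y -subr_eq0 addrAC subrr add0r.
  by case: (z s); rewrite ?oppr_eq0.
have A1 : \sum_s (`|la 0 s| / A) = 1 by rewrite -mulr_suml divff // lt0r_neq0.
have := cS x k.+1 y _ (Sd z) Hy (fun s => divr_ge0 (normr_ge0 _) (ltW A0)) A1.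
have -> : \sum_s (`|la 0 s| / A) *: y s = x + A^-1 *: \sum_s la 0 s *: d s.
  rewrite scaler_sumr.
  rewrite (eq_bigr (fun s => (`|la 0 s| / A) *: x + A^-1 *: (la 0 s *: d s))).
    rewrite big_split /= -scaler_suml -mulr_suml divff ?scale1r //.
    by rewrite lt0r_neq0.
  move=> s _; rewrite /y scalerDr; congr (_ + _); rewrite scalerA mulrC.
  rewrite /z; case: ltP => [l0|l0].
    by rewrite ltr0_norm // scalerN mulrN scaleNr opprK.
  by rewrite ger0_norm.
by rewrite laM scaler0 addr0 eqxx.
Qed.

(** * Exposed points through Gordan's alternative *)

Definition dot (u v : 'rV[R]_k) : R := \sum_j u 0 j * v 0 j.

Lemma dotDr u v w : dot u (v + w) = dot u v + dot u w.
Proof. by rewrite /dot -big_split; apply: eq_bigr => j _; rewrite mxE mulrDr. Qed.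

Lemma dotC u v : dot u v = dot v u.
Proof. by apply: eq_bigr => j _; rewrite mulrC. Qed.

Lemma dotDl u v w : dot (u + v) w = dot u w + dot v w.
Proof. by rewrite dotC dotDr !(dotC w). Qed.

Lemma dotZr a u v : dot u (a *: v) = a * dot u v.
Proof. by rewrite /dot mulr_sumr; apply: eq_bigr => j _; rewrite mxE mulrCA. Qed.

Lemma dotZl a u v : dot (a *: u) v = a * dot u v.
Proof. by rewrite dotC dotZr dotC. Qed.

Lemma dot0r u : dot u 0 = 0.
Proof. by rewrite -(scale0r 0) dotZr mul0r. Qed.

Lemma dot0l u : dot 0 u = 0.
Proof. by rewrite dotC dot0r. Qed.

Lemma dotNr u v : dot u (- v) = - dot u v.
Proof. by rewrite -scaleN1r dotZr mulN1r. Qed.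

Lemma dotBr u v w : dot u (v - w) = dot u v - dot u w.
Proof. by rewrite dotDr dotNr. Qed.

Lemma dot_sumr (J : Type) (s : seq J) (P : pred J) u (f : J -> 'rV[R]_k) :
  dot u (\sum_(j <- s | P j) f j) = \sum_(j <- s | P j) dot u (f j).
Proof. by apply: (big_morph (dot u) (dotDr u) (dot0r u)). Qed.

Lemma dot_suml (J : Type) (s : seq J) (P : pred J) u (f : J -> 'rV[R]_k) :
  dot (\sum_(j <- s | P j) f j) u = \sum_(j <- s | P j) dot (f j) u.
Proof. by rewrite dotC dot_sumr; apply: eq_bigr => j _; rewrite dotC. Qed.

Lemma dot_gt0 v : v != 0 -> 0 < dot v v.
Proof.
move=> v0; rewrite lt_neqAle sumr_ge0 ?andbT => [|j _]; last by rewrite -expr2 sqr_ge0.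
apply: contra v0 => /eqP/esym/psumr_eq0P e; apply/eqP/rowP => j; rewrite mxE.
by apply/eqP; rewrite -sqrf_eq0 expr2 e // => i _; rewrite -expr2 sqr_ge0.
Qed.

Lemma small_perturbation (x y : nat -> R) (n : nat) :
  (forall i, (i < n)%N -> 0 < x i) ->
  exists2 t, 0 < t & forall s i, 0 < s <= t -> (i < n)%N -> 0 < x i + s * y i.
Proof.
elim: n => [|n IH] x0; first by exists 1.
have [i ni|t t0 Ht] := IH; first by apply: x0; lia.
exists (Num.min t (x n / (2 * (`|y n| + 1)))).
  by rewrite lt_min t0 divr_gt0 ?x0 // mulr_gt0 // ltr_wpDl.
move=> s i; rewrite le_min => /andP[s0 /andP[st sx]]; rewrite ltnS leq_eqVlt => /orP[/eqP ->|]; last first.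
  by apply: Ht; rewrite s0.
have x0n := x0 n (ltnSn n); have yp : 0 < `|y n| + 1 by rewrite ltr_wpDl.
move: sx; rewrite ler_pdivlMr ?mulr_gt0 // => sx.
have : - (s * `|y n|) <= s * y n by rewrite -mulrN ler_pM2l // lerNl -normrN ler_norm.
nra.
Qed.

(** Gordan's alternative, by induction on [n]: a direction positive on the first [n] vectors is
    corrected for the last one, unless a relation between projected vectors lifts to the original
    ones. *)
Lemma gordan (n : nat) (y : nat -> 'rV[R]_k) :
  (exists u, forall i, (i < n)%N -> 0 < dot u (y i)) \/
  (exists c : nat -> R, [/\ forall i, 0 <= c i, 0 < \sum_(i < n) c i &
     \sum_(i < n) c i *: y i = 0]).
Proof.
elim: n y => [|n IH] y; first by left; exists 0.
have [yn0|yn0] := eqVneq (y n) 0.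
  right; exists (fun i => (i == n)%:R); split=> [i||]; first by rewrite ler0n.
    by rewrite big_ord_recr /= eqxx ltr_wpDl // sumr_ge0.
  rewrite big_ord_recr /= yn0 scaler0 addr0 big1 // => i _.
  by rewrite ltn_eqF // scale0r.
have [[u Hu]|[c [c0 cs cy]]] := IH y; last first.
  right; exists (fun i => if (i < n)%N then c i else 0); split=> [i||]; first by case: ifP.
    by rewrite big_ord_recr /= ltnn addr0; under eq_bigr => i _ do rewrite ltn_ord.
  by rewrite big_ord_recr /= ltnn scale0r addr0; under eq_bigr => i _ do rewrite ltn_ord.
have [un|un] := ltP 0 (dot u (y n)).
  left; exists u => i; rewrite ltnS leq_eqVlt => /orP[/eqP -> //|]; exact: Hu.
pose al := - dot u (y n); have al0 : 0 <= al by rewrite oppr_ge0.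
(* These combinations are orthogonal to [u]: the vectors [y i] are projected along [y n], whose
   product with [u] is [- al]. *)
have [[u' Hu']|[c [c0 cs cy]]] := IH (fun i => al *: y i + dot u (y i) *: y n); last first.
  right; exists (fun i => if (i < n)%N then al * c i else \sum_(j < n) c j * dot u (y j)).
  have n0 : 0 < \sum_(j < n) c j * dot u (y j).
    rewrite lt_neqAle sumr_ge0 ?andbT => [|j _]; last by rewrite mulr_ge0 // ltW // Hu.
    apply/negP => /eqP/esym/psumr_eq0P e; move: cs; rewrite big1 ?ltxx // => j _.
    have /eqP := e (fun i _ => mulr_ge0 (c0 i) (ltW (Hu i (ltn_ord i)))) j isT.
    by rewrite mulf_eq0 [X in _ || X]gt_eqF ?Hu // orbF => /eqP.
  split=> [i||].
  - by case: ifP => _; rewrite ?mulr_ge0 // ltW.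
  - rewrite big_ord_recr /= ltnn ltr_wpDl // sumr_ge0 // => i _.
    by rewrite ltn_ord mulr_ge0.
  - rewrite big_ord_recr /= ltnn -[RHS]cy scaler_suml -big_split; apply: eq_bigr => i _ /=.
    by rewrite ltn_ord scalerDr !scalerA mulrC.
pose be := dot u' (y n).
(* [v] is orthogonal to [y n] and positive on the other vectors; a small step along [y n] then makes
   every product positive. *)
pose v := al *: u' + be *: u.
have Hv i : (i < n)%N -> 0 < dot v (y i).
  by move=> /Hu'; rewrite /v dotDr !dotZr dotDl !dotZl -/be mulrC [X in _ + X]mulrC mulrC [be * _]mulrC.
have vn : dot v (y n) = 0 by rewrite /v dotDl !dotZl -/be /al mulNr mulrC addNr.
have [t t0 Ht] := small_perturbation (fun i => dot (y n) (y i)) Hv.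
left; exists (v + t *: y n) => i; rewrite ltnS leq_eqVlt dotDl dotZl => /orP[/eqP ->|].
  by rewrite vn add0r mulr_gt0 // dot_gt0.
by apply: Ht; rewrite t0 lexx.
Qed.

(** The vectors of [ws] are treated one at a time: if the current direction is orthogonal to one of
    them, a small push along this vector makes the product nonzero. *)
Lemma generic_direction (L ws : seq 'rV[R]_k) u :
  (forall v, v \in L -> 0 < dot u v) -> (forall v, v \in ws -> v != 0) ->
  exists2 u', forall v, v \in L -> 0 < dot u' v & forall v, v \in ws -> dot u' v != 0.
Proof.
move=> uL; elim: ws => [|w ws IH] ws0; first by exists u.
have [v vws|u1 u1L u1ws] := IH; first by apply: ws0; rewrite inE vws orbT.
have [u1w|] := eqVneq (dot u1 w) 0; last first.
  by move=> u1w; exists u1 => // v; rewrite inE => /orP[/eqP ->|/u1ws].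
(* The vectors already treated join the list with the sign that makes their products positive, so
   that the same perturbation keeps these products nonzero. *)
pose L' := L ++ [seq Num.sg (dot u1 v) *: v | v <- ws].
have pL' i : (i < size L')%N -> 0 < dot u1 (nth 0 L' i).
  move=> /(mem_nth 0); rewrite mem_cat => /orP[/u1L //|/mapP[v vws ->]].
  by rewrite dotZr -normrEsg normr_gt0 u1ws.
have [t t0 Ht] := small_perturbation (fun i => dot w (nth 0 L' i)) pL'.
have u'L v : v \in L' -> 0 < dot (u1 + t *: w) v.
  move=> vL; rewrite dotDl dotZl -(nth_index 0 vL); apply: Ht; first by rewrite t0 lexx.
  by rewrite index_mem.
exists (u1 + t *: w) => [v vL|v]; first by apply: u'L; rewrite mem_cat vL.
rewrite inE => /orP[/eqP ->|vws].
  by rewrite dotDl dotZl u1w add0r mulf_neq0 ?lt0r_neq0 // dot_gt0 // ws0 // inE eqxx.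
have := u'L (Num.sg (dot u1 v) *: v); rewrite mem_cat (map_f (fun v => Num.sg (dot u1 v) *: v)) // orbT => /(_ isT).
by apply: contraTneq => e; rewrite dotZr e mulr0 ltxx.
Qed.

(** Gordan's alternative for the differences [x - v]: a nonnegative relation among them, once
    normalised, would write [x] as a convex combination of other points of [S]. *)
Lemma exposed_point S (x : 'rV[R]_k) (s ws : seq 'rV[R]_k) :
  convex_position S -> S x -> (forall v, v \in s -> S v) ->
  (forall v, v \in ws -> v != 0) ->
  exists2 u, forall v, v \in s -> v != x -> dot u v < dot u x &
    forall v, v \in ws -> dot u v != 0.
Proof.
move=> cS Sx Ss ws0.
pose ys := [seq x - v | v <- [seq v <- s | v != x]].
have [[u Hu]|[c [c0 cs cy]]] := gordan (size ys) (nth 0 ys); last first.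
  exfalso.
  pose f (i : 'I_(size ys)) := nth 0 [seq v <- s | v != x] i.
  have szi (i : 'I_(size ys)) : (i < size [seq v <- s | (v != x)%R])%N.
    by apply: leq_trans (ltn_ord i) _; rewrite size_map.
  have fi i : f i \in [seq v <- s | v != x] by rewrite mem_nth.
  have Hf i : S (f i) /\ f i != x.
    by have := fi i; rewrite mem_filter => /andP[fx /Ss].
  pose A := \sum_(i < size ys) c i.
  have A1 : \sum_(i < size ys) c i / A = 1 by rewrite -mulr_suml divff // lt0r_neq0.
  have := cS x _ f _ Sx Hf (fun i => divr_ge0 (c0 i) (ltW cs)) A1.
  rewrite (_ : \sum_i _ = x) ?eqxx //.
  rewrite (eq_bigr (fun i : 'I_(size ys) => (c i / A) *: x - A^-1 *: (c i *: nth 0 ys i))).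
    by rewrite sumrB -scaler_suml A1 scale1r -scaler_sumr cy scaler0 subr0.
  move=> i _; rewrite (nth_map 0) // -/(f i).
  by rewrite scalerA [A^-1 * _]mulrC scalerBr opprB addrC subrK.
have uL v : v \in ys -> 0 < dot u v.
  by move=> vy; rewrite -(nth_index 0 vy) Hu // index_mem.
have [u' u'L u'ws] := generic_direction uL ws0.
exists u' => // v vs vx; by rewrite -subr_gt0 -dotBr u'L // (map_f (fun v => x - v)) // mem_filter vx vs.
Qed.

End ConvexPosition.

Lemma small_classes_antichain (R : realType) (k : nat) (dl : R) : 0 < dl ->
  exists2 K : R, 0 < K &
  forall (I : finType) (w : I -> 'rV[R]_k) (p : 'rV[R]_k) (S : set 'rV[R]_k)
    (F : {set {set I}}),
  (0 < #|I|)%N -> convex_position S -> antichain F ->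
  (forall X, X \in F -> S (p + \sum_(i in X) w i)) ->
  (forall v, #|[set i | w i == v]|%:R <= K * #|I|%:R) ->
  #|F|%:R <= dl * 'C(#|I|, #|I|./2)%:R.
Proof.
wlog dl1 : dl / dl <= 1 => [hw|] dl0.
  have [||K K0 HK] := hw (Num.min dl 1).
  - by rewrite ge_min lexx orbT.
  - by rewrite lt_min dl0 ltr01.
  exists K => // I w p S F I0 cS aF FS sm; apply: le_trans (HK _ _ _ _ _ I0 cS aF FS sm) _.
  by rewrite ler_wpM2r // ge_min lexx.
pose r := k.+1.
pose C := (Num.truncn (4 * r%:R / dl)).+1.
have C0 : (0 : R) < C%:R by rewrite ltr0n.
have [q0 Hq] := dense_subcube r (divr_gt0 dl0 (mulr_gt0 (ltr0n R 16) C0)).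
pose q := maxn q0 1; pose N := (r * q)%N.
have N1 : (1 : R) <= N%:R by rewrite ler1n muln_gt0 /= leq_max orbT.
(* The union bound over the [N ^ 2] pairs of pool positions costs [N ^ 2 * 2 K], which is
   [dl / 16]. *)
pose K := dl / (32 * N%:R ^+ 2).
have N20 : 0 < 32 * N%:R ^+ 2 :> R by rewrite mulr_gt0 // exprn_gt0 //; lra.
have K0 : 0 < K by rewrite divr_gt0.
exists K => // I w p S F I0 cS aF FS sm.
have /card_gt0P[i0 _] := I0.
(* The class of [w i0] is nonempty, so the bound on classes forces [K #|I| >= 1]; this is where a
   lower bound on [#|I|] comes from. *)
have m1 : 32 * N%:R ^+ 2 <= dl * #|I|%:R.
  have : 1 <= K * #|I|%:R.
    apply: le_trans (sm (w i0)); rewrite ler1n; apply/card_gt0P; exists i0.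
    by rewrite inE.
  by rewrite /K mulrAC ler_pdivlMr // mul1r.
have mI : dl * #|I|%:R <= #|I|%:R by rewrite ler_piMl.
have NN : N%:R <= N%:R ^+ 2 :> R by rewrite expr2 ler_peMl //; lra.
have Nm : (N < #|I|)%N by rewrite -(ltr_nat R); lra.
rewrite leNgt; apply/negP => /ltW large.
have rqI : (r * q <= #|I|)%N by exact: ltnW.
have q1 : (0 < q)%N by rewrite leq_max orbT.
have Nm' : 0 < (#|I| - N)%:R :> R by rewrite ltr0n subn_gt0.
have out : (r * q)%:R * ((r * q)%:R / (#|I| - r * q)%:R) <= dl / 2.
  rewrite -/N mulrA ler_pdivrMr // natrB 1?ltnW // -expr2.
  have : dl * N%:R <= N%:R by rewrite ler_piMl.
  nra.
have CC : 4 * r%:R / dl <= C%:R by rewrite ltW // truncnS_gt.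
have KN : (r * q)%:R ^+ 2 * (2 * K) <= dl / 16.
  rewrite -/N /K le_eqVlt; apply/orP; left; apply/eqP; field.
  by rewrite lt0r_neq0 //; lra.
have kst : forall H : {set r.-tuple 'I_q}, dl / (16 * C%:R) * q%:R ^+ r <= #|H|%:R ->
  exists c0 c1 : r.-tuple 'I_q,
    (forall s, tnth c0 s != tnth c1 s) /\ forall z, mix c0 c1 z \in H.
  by apply: Hq; rewrite leq_max leqnn.
have [E0 [v0 [v1 [v01 Hz]]]] :=
  antichain_cube aF rqI q1 dl0 Nm out large CC (ltn0Sn k) sm KN kst.
pose d s := w (v1 s) - w (v0 s).
apply: (@convex_position_no_cube R k S (p + \sum_(i in E0) w i + \sum_s w (v0 s)) d cS).
  by move=> s; rewrite subr_eq0 eq_sym v01.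
move=> z; have /= [vi vE /FS] := Hz z; congr (S _).
rewrite -!addrA; congr (_ + _); rewrite sum_disjointU /=; last first.
  apply/pred0P => x /=; apply/negP => /andP[/finset.imsetP[l _ ->]].
  by apply/negP; exact: vE.
rewrite addrC; congr (_ + _); rewrite big_imset /=; last by move=> ? ? _ _; exact: vi.
rewrite -big_split; apply: eq_bigr => s _ /=.
by case: (z s); rewrite ?addr0 // addrC subrK.
Qed.

(** * Cells of directions *)

Section ExtremeRays.
Variables (R : realType) (k M : nat) (h : 'I_M -> 'rV[R]_k.+1).
Hypothesis span_h : forall z, (forall j, dot (h j) z = 0) -> z = 0.
Implicit Types u z : 'rV[R]_k.+1.

(** Its nonzero rows are normals of the hyperplanes of the arrangement that pass through [u]; its
    rank is the codimension of the face containing [u]. *)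
Let zero_mx u : 'M[R]_(M, k.+1) := \matrix_j (if dot (h j) u == 0 then h j else 0).

(** [z] lies in the closed face of [u] in the arrangement of hyperplanes orthogonal to the [h j]. *)
Definition agree u z := forall j,
  (dot (h j) u = 0 -> dot (h j) z = 0) /\ 0 <= dot (h j) u * dot (h j) z.

Lemma agree_trans u z y : agree u z -> agree z y -> agree u y.
Proof.
move=> uz zy j; have [uz0 uzp] := uz j; have [zy0 zyp] := zy j.
split=> [/uz0/zy0 //|].
have [z0|z0] := eqVneq (dot (h j) z) 0; first by rewrite zy0 // mulr0.
rewrite -(pmulr_rge0 _ (_ : 0 < dot (h j) z ^+ 2)); last by rewrite exprn_even_gt0.
by have := mulr_ge0 uzp zyp; congr (0 <= _); ring.
Qed.

Lemma mulmx_dot u z : (u *m z^T) = (dot u z)%:M.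
Proof.
apply/matrixP => i j; rewrite !ord1 !mxE mulr1n; apply: eq_bigr => l _.
by rewrite mxE.
Qed.

Lemma zero_mx_dot u z :
  reflect (forall j, dot (h j) u = 0 -> dot (h j) z = 0) (zero_mx u *m z^T == 0).
Proof.
apply: (iffP eqP) => [e j uj|H].
  have := congr1 (fun A => row j A) e; rewrite row_mul rowK uj eqxx row0 mulmx_dot.
  by move/(congr1 (fun A : 'M[R]_1 => A 0 0)); rewrite !mxE mulr1n.
apply/row_matrixP => j; rewrite row_mul rowK row0; case: eqP => [/H e|_].
  by rewrite mulmx_dot e raddf0.
by rewrite mul0mx.
Qed.

Lemma zero_mx_self u : zero_mx u *m u^T == 0.
Proof. by apply/zero_mx_dot. Qed.

Lemma rank_zero_mx_lt u z j : (forall j, dot (h j) u = 0 -> dot (h j) z = 0) ->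
  dot (h j) u != 0 -> dot (h j) z = 0 -> (\rank (zero_mx u) < \rank (zero_mx z))%N.
Proof.
move=> uz uj zj; apply: rank_ltmx; rewrite ltmxE; apply/andP; split.
  apply/row_subP => i; rewrite rowK; case: eqP => [/uz e|_]; last exact: sub0mx.
  by have <- : row i (zero_mx z) = h i; [rewrite rowK e eqxx | exact: row_sub].
apply/negP => /(submx_trans (row_sub j _)); rewrite rowK zj eqxx => /submxP[D hD].
move: uj; rewrite -[dot _ _]mulr1n.
have : h j *m u^T = 0 by rewrite hD -mulmxA (eqP (zero_mx_self u)) mulmx0.
by rewrite mulmx_dot => /(congr1 (fun A : 'M[R]_1 => A 0 0)); rewrite !mxE => ->; rewrite eqxx.
Qed.

(** Among the hyperplanes towards which [w] moves, the one with the least ratio [f j] is reached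
    first, and until then no sign changes. *)
Lemma first_hit u w (j0 : 'I_M) :
  (forall j, dot (h j) u = 0 -> dot (h j) w = 0) ->
  dot (h j0) u * dot (h j0) w < 0 ->
  exists t j, [/\ 0 < t, dot (h j) u != 0, dot (h j) (u + t *: w) = 0 &
    forall j, 0 <= dot (h j) u * dot (h j) (u + t *: w)].
Proof.
move=> uw neg0.
pose P j := dot (h j) u * dot (h j) w < 0.
pose f j := - dot (h j) u / dot (h j) w.
have [j Pj fmin] : exists2 j, P j & forall i, P i -> f j <= f i.
  by case: (arg_minP f (neg0 : P j0)) => j Pj Hj; exists j.
have nz i : P i -> dot (h i) u != 0 /\ dot (h i) w != 0.
  by rewrite /P => Pi; split; apply: contraTneq Pi => ->; rewrite ?mul0r ?mulr0 ltxx.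
have f0 i : P i -> 0 < f i.
  move=> Pi; have [ui wi] := nz i Pi.
  have -> : f i = - (dot (h i) u * dot (h i) w) / dot (h i) w ^+ 2 by rewrite /f; field.
  by rewrite divr_gt0 ?oppr_gt0 // exprn_even_gt0.
exists (f j), j; have [uj wj] := nz j Pj; split=> //; first exact: f0.
  by rewrite dotDr dotZr /f; field.
move=> i; rewrite dotDr dotZr mulrDr mulrCA.
have [Pi|nPi] := boolP (P i); last first.
  rewrite addr_ge0 //; first by rewrite -expr2 sqr_ge0.
  by rewrite mulr_ge0 ?(ltW (f0 _ Pj)) // leNgt.
have [ui wi] := nz i Pi; have := fmin i Pi.
rewrite -(ler_nM2r Pi) /f (_ : - dot (h i) u / _ * _ = - (dot (h i) u * dot (h i) u)); last by field.
by rewrite -/(f j); lra.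
Qed.

(** The linear span of a face of dimension at least two contains a vector not proportional to [u].
    Following it from [u] to the boundary of the face writes [u] as a sum of two points of smaller
    faces. *)
Lemma split_ray u : u != 0 -> (\rank (zero_mx u) < k)%N ->
  exists u1 u2, [/\ u = u1 + u2,
    [/\ u1 != 0, agree u u1 & (\rank (zero_mx u) < \rank (zero_mx u1))%N] &
    [/\ u2 != 0, agree u u2 & (\rank (zero_mx u) < \rank (zero_mx u2))%N]].
Proof.
move=> u0 rk.
have nzP z : z != 0 -> exists j, dot (h j) z != 0.
  move=> z0; have [//|no] := pselect (exists j, dot (h j) z != 0).
  by move: z0; rewrite (span_h (z := z)) ?eqxx // => j; apply/eqP/negPn/negP => ?; apply: no; exists j.
have [i] : exists i, ~~ (row i (kermx (zero_mx u)^T) <= u)%MS.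
  apply/row_subPn; apply/negP => /mxrankS; rewrite mxrank_ker mxrank_tr.
  by move=> /leq_trans/(_ (rank_leq_row u)); lia.
set w0 := row i _ => w0u.
have w0Z : forall j, dot (h j) u = 0 -> dot (h j) w0 = 0.
  apply/zero_mx_dot; rewrite -[X in X == _]trmxK trmx_mul trmxK.
  have : w0 *m (zero_mx u)^T = 0 by apply/sub_kermxP; exact: row_sub.
  by move=> ->; rewrite trmx0.
have [j0 uj0] := nzP u u0.
(* Subtracting a multiple of [u] makes [w] vanish on [h j0], where [u] does not; hence the line
   [u + t w] avoids 0. *)
pose w := w0 - (dot (h j0) w0 / dot (h j0) u) *: u.
have w_0 : w != 0.
  by apply: contra w0u; rewrite subr_eq0 => /eqP ->; apply: scalemx_sub.
have wZ j : dot (h j) u = 0 -> dot (h j) w = 0.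
  by move=> uj; rewrite dotBr dotZr w0Z // uj mulr0 subrr.
have wj0 : dot (h j0) w = 0 by rewrite dotBr dotZr; field.
have indep t s : t *: w != s *: u \/ (t = 0 /\ s = 0).
  have [s0|s0] := eqVneq s 0.
    have [t0|t0] := eqVneq t 0; first by right.
    by left; rewrite s0 scale0r scaler_eq0 negb_or t0.
  left; apply/eqP => /(congr1 (dot (h j0))); rewrite !dotZr wj0 mulr0 => /esym/eqP.
  by rewrite mulf_eq0 (negbTE s0) (negbTE uj0).
have [j1 wj1] := nzP w w_0.
(* The line [u + t w] leaves the cell in at least one of its two directions. *)
have [v [v_0 vZ vj0 vind [j2 vneg]]] : exists v, [/\ v != 0,
    forall j, dot (h j) u = 0 -> dot (h j) v = 0, dot (h j0) v = 0,
    forall t, u + t *: v != 0 & exists j, dot (h j) u * dot (h j) v < 0].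
  have uj1 : dot (h j1) u != 0 by apply: contraNneq wj1 => /wZ ->.
  have ne t : u + t *: w != 0.
    apply/eqP => /(congr1 (dot (h j0))); rewrite dotDr dotZr wj0 mulr0 addr0 dot0r => /eqP.
    by rewrite (negbTE uj0).
  have := mulf_neq0 uj1 wj1; rewrite neq_lt => /orP[neg|pos].
    by exists w; split=> //; exists j1.
  exists (- w); split=> //; rewrite ?oppr_eq0 //.
  - by move=> j /wZ; rewrite dotNr => ->; rewrite oppr0.
  - by rewrite dotNr wj0 oppr0.
  - by move=> t; rewrite scalerN -scaleNr.
  - by exists j1; rewrite dotNr mulrN oppr_lt0.
have [t1 [j3 [t10 uj3 j3z pos1]]] := first_hit vZ vneg.
have Z1 j : dot (h j) u = 0 -> dot (h j) (u + t1 *: v) = 0.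
  by move=> uj; rewrite dotDr dotZr vZ // uj mulr0 addr0.
(* If the line leaves the face on the other side as well, [u] is a convex combination of the two
   exit points. Otherwise [- v] itself lies in the closed face, and it vanishes on [h j0]. *)
have [[j4 vpos]|nopos] := pselect (exists j, dot (h j) u * dot (h j) (- v) < 0).
  have vZ' j : dot (h j) u = 0 -> dot (h j) (- v) = 0.
    by move=> /vZ; rewrite dotNr => ->; rewrite oppr0.
  have [t2 [j5 [t20 uj5 j5z pos2]]] := first_hit vZ' vpos.
  have Z2 j : dot (h j) u = 0 -> dot (h j) (u + t2 *: - v) = 0.
    by move=> uj; rewrite dotDr dotZr vZ' // uj mulr0 addr0.
  have t120 : 0 < t1 + t2 by rewrite addr_gt0.
  pose a1 := t2 / (t1 + t2); pose a2 := t1 / (t1 + t2).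
  have a10 : 0 < a1 by rewrite divr_gt0.
  have a20 : 0 < a2 by rewrite divr_gt0.
  exists (a1 *: (u + t1 *: v)), (a2 *: (u + t2 *: - v)); split.
  - by apply/rowP => l; rewrite !mxE /a1 /a2; field; rewrite lt0r_neq0.
  - split; first by rewrite scaler_eq0 negb_or lt0r_neq0 //=.
      move=> j; rewrite dotZr; split=> [/Z1 ->|]; first by rewrite mulr0.
      by rewrite mulrCA mulr_ge0 // ltW.
    apply: (rank_zero_mx_lt (j := j3)) => // [j /Z1|]; rewrite dotZr.
      by move=> ->; rewrite mulr0.
    by rewrite j3z mulr0.
  - split; first by rewrite scaler_eq0 negb_or lt0r_neq0 //= scalerN -scaleNr vind.
      move=> j; rewrite dotZr; split=> [/Z2 ->|]; first by rewrite mulr0.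
      by rewrite mulrCA mulr_ge0 // ltW.
    apply: (rank_zero_mx_lt (j := j5)) => // [j /Z2|]; rewrite dotZr.
      by move=> ->; rewrite mulr0.
    by rewrite j5z mulr0.
exists (u + t1 *: v), (- (t1 *: v)); split; first by rewrite addrK.
- by split; [exact: vind | split; [exact: Z1 | exact: pos1] | exact: (rank_zero_mx_lt (j := j3))].
- split; first by rewrite oppr_eq0 scaler_eq0 negb_or lt0r_neq0.
    move=> j; rewrite dotNr dotZr; split=> [/vZ ->|]; first by rewrite mulr0 oppr0.
    rewrite -mulrN mulrCA pmulr_rge0 // leNgt; apply/negP => neg; apply: nopos.
    by exists j; rewrite dotNr.
  apply: (rank_zero_mx_lt (j := j0)) => // [j /vZ|]; rewrite dotNr dotZr.
    by move=> ->; rewrite mulr0 oppr0.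
  by rewrite vj0 mulr0 oppr0.
Qed.

(** Each splitting raises the rank for both parts and doubles their number, so [k] rounds lead to
    faces of dimension at most one. *)
Lemma ray_decomposition u : u != 0 ->
  exists s : seq 'rV[R]_k.+1, [/\ (size s <= 2 ^ k)%N, u = \sum_(z <- s) z &
    forall z, z \in s -> [/\ z != 0, agree u z & (k <= \rank (zero_mx z))%N]].
Proof.
suff H n : forall u, u != 0 -> (k <= \rank (zero_mx u) + n)%N ->
  exists s : seq 'rV[R]_k.+1, [/\ (size s <= 2 ^ n)%N, u = \sum_(z <- s) z &
    forall z, z \in s -> [/\ z != 0, agree u z & (k <= \rank (zero_mx z))%N]].
  by move=> u0; apply: H => //; rewrite leq_addl.
elim: n => [|n IH] {}u u0 kr.
  exists [:: u]; split; rewrite ?big_seq1 // => z; rewrite inE => /eqP ->.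
  split=> //; last by rewrite addn0 in kr.
  by move=> j; split=> //; rewrite -expr2 sqr_ge0.
have [rk|rk] := leqP k (\rank (zero_mx u)).
  have [s [ss us Hs]] := IH u u0 (leq_trans rk (leq_addr _ _)).
  by exists s; split=> //; rewrite (leq_trans ss) // leq_exp2l.
have [u1 [u2 [uE [u10 u1a r1] [u20 u2a r2]]]] := split_ray u0 rk.
have [|s1 [ss1 us1 Hs1]] := IH u1 u10; first by lia.
have [|s2 [ss2 us2 Hs2]] := IH u2 u20; first by lia.
exists (s1 ++ s2); split; first by rewrite size_cat expnS mul2n -addnn leq_add.
  by rewrite big_cat -us1 -us2.
move=> z; rewrite mem_cat => /orP[/Hs1|/Hs2] [z0 za zr]; split=> //.
  exact: agree_trans za.
exact: agree_trans za.
Qed.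

(** A vector orthogonal to [k] chosen vectors; when these are independent it spans the line that
    they determine. *)
Definition ray_of (J : {ffun 'I_k -> 'I_M}) : 'rV[R]_k.+1 :=
  nz_row (kermx (\matrix_l h (J l))^T).

(** The rank is exactly [k], since full rank would force [z = 0]; then [k] independent rows
    determine the line of [z]. *)
Lemma ray_determined z : z != 0 -> (k <= \rank (zero_mx z))%N ->
  exists J c, z = c *: ray_of J.
Proof.
move=> z0 kr.
have rk : \rank (zero_mx z) = k.
  apply/eqP; rewrite eqn_leq kr andbT -ltnS ltn_neqAle rank_leq_col andbT.
  apply: contra z0 => full.
  have := row_full_inj full (etrans (eqP (zero_mx_self z)) (esym (mulmx0 _ _))).
  by move=> e; apply/eqP/trmx_inj; rewrite e trmx0.
pose A := zero_mx z; pose f (l : 'I_k) := maxrankfun A (cast_ord (esym rk) l).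
have rf : \rank (rowsub f A) = k.
  apply/eqP; rewrite eqn_leq rank_leq_row /= -{1}rk -/A.
  have /eqP <- := maxrowsub_free A; apply: mxrankS; apply/row_subP => i.
  have -> : row i (rowsub (maxrankfun A) A) = row (cast_ord rk i) (rowsub f A).
    by apply/rowP => j; rewrite !mxE /f cast_ordK.
  exact: row_sub.
have fz l : dot (h (f l)) z = 0.
  have : row l (rowsub f A) != 0.
    have rff : row_free (rowsub f A) by rewrite /row_free rf.
    by rewrite rowE (mulmx_free_eq0 _ rff) -mxrank_eq0 mxrank_delta.
  by rewrite row_rowsub rowK; case: (eqVneq (dot (h (f l)) z)); rewrite ?eqxx.
have Bf : \matrix_l h (f l) = rowsub f A.
  by apply/row_matrixP => l; rewrite row_rowsub !rowK fz eqxx.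
exists (finfun f).
have fE : \matrix_l h ([ffun l => f l] l) = rowsub f A.
  by rewrite -Bf; apply/matrixP => i j; rewrite !mxE ffunE.
suff /sub_rVP : (z <= ray_of (finfun f))%MS by [].
have kr1 : \rank (kermx (rowsub f A)^T) = 1%N.
  by rewrite mxrank_ker mxrank_tr rf subSnn.
have zk : (z <= kermx (rowsub f A)^T)%MS.
  apply/sub_kermxP; apply: trmx_inj; rewrite trmx_mul trmxK trmx0 -Bf.
  by apply/row_matrixP => l; rewrite row_mul rowK row0 mulmx_dot fz raddf0.
rewrite /ray_of fE; apply: (submx_trans zk).
have := mxrank_leqif_eq (nz_row_sub (kermx (rowsub f A)^T)).
rewrite kr1 rank_rV nz_row_eq0 -mxrank_eq0 kr1 /= => /leqif_refl.
by rewrite /eqmx => /andP[].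
Qed.

End ExtremeRays.

(** * Random samples of steps *)

(** Once the samples indexed by [P] are fixed, so is [Nf s], and each of the other samples
    independently has at most [b] admissible values. *)
Lemma card_avoiding_samples (R : realType) (I : finType) (r : nat) (P : {set 'I_r})
    (Nf : {ffun 'I_r -> I} -> {set I}) (b : R) :
  (0 < #|I|)%N -> (forall s s' : {ffun 'I_r -> I}, (forall a, a \in P -> s a = s' a) -> Nf s = Nf s') ->
  (forall s, #|Nf s|%:R <= b) ->
  #|[set s : {ffun 'I_r -> I} | [forall a, (a \notin P) ==> (s a \in Nf s)]]|%:R <=
    #|I|%:R ^+ #|P| * b ^+ (r - #|P|).
Proof.
move=> /card_gt0P[i0 _] locN Nb.
have b0 : 0 <= b := le_trans (ler0n _ _) (Nb [ffun=> i0]).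
set X := [set s | _].
pose res (s : {ffun 'I_r -> I}) : {ffun 'I_r -> I} := [ffun a => if a \in P then s a else i0].
rewrite -sum1_card natr_sum (partition_big res (mem (pffun_on i0 (mem P) (mem I)))) /=; last first.
  move=> s _; apply/pffun_onP; split.
    by apply/fintype.subsetP => a; rewrite unfold_in /= ffunE; case: ifP; rewrite ?eqxx.
  by [].
rewrite -natrX -(card_pffun_on i0 (mem P) (mem I)) mulr_natl -sumr_const.
apply: ler_sum => t _.
pose Fam a : pred I := if a \in P then pred1 (t a) else mem (Nf t).
rewrite -natr_sum; apply: (@le_trans _ _ #|(family Fam : pred {ffun 'I_r -> I})|%:R).
  rewrite ler_nat sum1_card; apply: subset_leq_card; apply/fintype.subsetP => s.
  rewrite unfold_in inE => /andP[/forallP sX /eqP st]; apply/familyP => a; rewrite /Fam.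
  have sta b' : b' \in P -> s b' = t b' by move=> bP; rewrite -st ffunE bP.
  case: ifP => aP; first by rewrite unfold_in /= sta.
  by have := sX a; rewrite aP /= (locN s t sta).
rewrite card_family foldrE big_map big_enum /= natr_prod.
have -> : (r - #|P|)%N = #|~: P|.
  apply/eqP; rewrite -(eqn_add2l #|P|) cardsC card_ord subnKC //.
  by rewrite -[leqRHS](card_ord r) max_card.
rewrite -prodr_const [leRHS]big_mkcond /=; apply: ler_prod => a _; rewrite ler0n /= inE /Fam.
case: (a \in P) => /=; last exact: Nb.
by rewrite card1.
Qed.

(** Bernoulli's inequality gives [(1 - x) ^ t * (t x) <= 1]. Its power of exponent [p + 1] beats a
    polynomial of degree [p] in [t], so [s = t (p + 1)] works for large [t]. *)
Lemma exp_dominates (R : realType) (x : R) (p c : nat) : 0 < x < 1 ->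
  exists s : nat, 4 * (s + c)%:R ^+ p * (1 - x) ^+ s < 1.
Proof.
move=> /andP[x0 x1].
have b0 : 0 < 1 - x by rewrite subr_gt0.
pose A : R := 4 * (p.+1 + c)%:R ^+ p.
pose t := (Num.truncn (A / x ^+ p.+1)).+1.
have xp : 0 < x ^+ p.+1 by rewrite exprn_gt0.
have t1 : (1 : R) <= t%:R by rewrite ler1n.
have At : A < t%:R * x ^+ p.+1 by rewrite -ltr_pdivrMr // truncnS_gt.
exists (t * p.+1)%N; rewrite exprM.
have bern : (1 - x) ^+ t * (t%:R * x) <= 1.
  have H m : (1 - x) ^+ m * (1 + m%:R * x) <= 1.
    elim: m => [|m IH]; first by rewrite expr0 mul0r addr0 mulr1.
    rewrite exprS -mulrA mulrCA; apply: le_trans IH; rewrite ler_wpM2l //.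
      by rewrite exprn_ge0 // ltW.
    rewrite -natr1; have : 0 <= m%:R * x by rewrite mulr_ge0 // ltW.
    nra.
  apply: le_trans (H t); rewrite ler_wpM2l //; first by rewrite exprn_ge0 // ltW.
  by rewrite lerDr.
have Y : ((1 - x) ^+ t) ^+ p.+1 * (t%:R ^+ p.+1 * x ^+ p.+1) <= 1.
  rewrite -!exprMn; apply: exprn_ile1 => //.
  by rewrite !mulr_ge0 ?exprn_ge0 // ltW.
apply: (@le_lt_trans _ _ (A * t%:R ^+ p * ((1 - x) ^+ t) ^+ p.+1)).
  rewrite ler_wpM2r //; first by rewrite !exprn_ge0 // ltW.
  rewrite /A -mulrA ler_wpM2l // -exprMn lerXn2r ?nnegrE // -natrM ler_nat.
  by rewrite mulnDl mulnC leq_add // leq_pmulr.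
apply: lt_le_trans Y; rewrite [ltRHS]mulrC ltr_pM2r; last by rewrite !exprn_gt0.
have -> : t%:R ^+ p.+1 * x ^+ p.+1 = t%:R * x ^+ p.+1 * t%:R ^+ p.
  by rewrite [t%:R ^+ p.+1]exprS mulrAC.
by rewrite ltr_pM2r // exprn_gt0 // ltr0n.
Qed.

Section Cells.
Variables (R : realType) (k : nat).

Section Sample.
Variables (I : finType) (w : I -> 'rV[R]_k.+1) (r : nat).
Implicit Type s : {ffun 'I_r -> I}.

Let M := (r + k.+1)%N.
Let label := ({ffun 'I_k -> 'I_M} * bool)%type.

(** The unit vectors are appended so that the family always spans the space. *)
Definition sample_vec s (j : 'I_(r + k.+1)) : 'rV[R]_k.+1 :=
  match fintype.split j with inl a => w (s a) | inr b => delta_mx 0 b end.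

Lemma sample_vec_span s z : (forall j, dot (sample_vec s j) z = 0) -> z = 0.
Proof.
move=> H; apply/rowP => b; rewrite mxE -(H (rshift r b)) /sample_vec.
rewrite (unsplitK (inr b : 'I_r + 'I_k.+1)) /dot (bigD1 b) //= mxE !eqxx mul1r big1 ?addr0 //.
by move=> j jb; rewrite mxE (negbTE jb) andbF mul0r.
Qed.

Lemma sample_vec_lshift s a : sample_vec s (lshift _ a) = w (s a).
Proof. by rewrite /sample_vec (unsplitK (inl a : 'I_r + 'I_k.+1)). Qed.

(** A ray is named by [k] vectors of the sample orthogonal to it and by a sign; [None] names the
    zero vector and serves as padding. *)
Definition label_ray s (L : option label) : 'rV[R]_k.+1 :=
  if L is Some (J, e) then (-1) ^+ (e : bool) *: ray_of (sample_vec s) J else 0.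

Definition separators s L L' : {set I} :=
  [set i | dot (w i) (label_ray s L) * dot (w i) (label_ray s L') < 0].

Lemma ray_of_local s s' (J : {ffun 'I_k -> 'I_M}) :
  (forall a l, J l = lshift _ a -> s a = s' a) ->
  ray_of (sample_vec s) J = ray_of (sample_vec s') J.
Proof.
move=> H; rewrite /ray_of; congr (nz_row (kermx _^T)).
apply/matrixP => l j; rewrite !mxE; congr (_ _ _).
rewrite /sample_vec; case: fintype.splitP => // a e.
by rewrite (H a l) //; apply: val_inj.
Qed.

(* Union bound over pairs of labels: a label only involves [k] of the samples, so
   all the other samples still avoid its separators independently. *)
Lemma good_sample (eta : R) (t : nat) : (0 < #|I|)%N -> 0 < eta < 1 ->
  r = (t + 2 * k)%N -> 4 * M%:R ^+ (2 * k) * (1 - eta) ^+ t < 1 ->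
  exists s, forall L L', (forall a, s a \notin separators s L L') ->
    #|separators s L L'|%:R <= eta * #|I|%:R.
Proof.
move=> I0 /andP[eta0 eta1] rE small.
have [//|no] := pselect (exists s, forall L L', (forall a, s a \notin separators s L L') ->
    #|separators s L L'|%:R <= eta * #|I|%:R).
exfalso; pose n : R := #|I|%:R.
have n0 : 0 < n by rewrite ltr0n.
(* For a pair with too many separators, the samples outside [P p] must all avoid them; a pair with
   few separators needs no control, and [Nf] is empty. *)
pose Nf (p : label * label) s : {set I} := if eta * n < #|separators s (Some p.1) (Some p.2)|%:R
  then ~: separators s (Some p.1) (Some p.2) else finset.set0.
pose P (p : label * label) : {set 'I_r} :=
  [set a | [exists l, p.1.1 l == lshift _ a] || [exists l, p.2.1 l == lshift _ a]].
have Pk p : (#|P p| <= 2 * k)%N.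
  have li : injective (@lshift r k.+1) by exact: lshift_inj.
  rewrite -(card_imset _ li) mul2n -addnn.
  apply: leq_trans (_ : #|[set p.1.1 l | l : 'I_k] :|: [set p.2.1 l | l : 'I_k]| <= _)%N.
    apply: subset_leq_card; apply/fintype.subsetP => _ /finset.imsetP[a + ->].
    rewrite !inE => /orP[/existsP[l /eqP <-]|/existsP[l /eqP <-]].
      by rewrite imset_f.
    by rewrite imset_f ?orbT.
  apply: leq_trans (leq_card_setU _ _) _.
  by rewrite leq_add // (leq_trans (leq_imset_card _ _)) // card_ord.
pose X p := [set s : {ffun 'I_r -> I} | [forall a, (a \notin P p) ==> (s a \in Nf p s)]].
have cX p : #|X p|%:R <= n ^+ r * (1 - eta) ^+ t.
  apply: le_trans (@card_avoiding_samples R I r (P p) (Nf p) ((1 - eta) * n) I0 _ _) _.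
  - move=> s s' ss'; have e (i : bool) :
      label_ray s (Some (if i then p.1 else p.2)) = label_ray s' (Some (if i then p.1 else p.2)).
      rewrite /label_ray; case: i; [case E : p.1 => [J e]|case E : p.2 => [J e]].
        congr (_ *: _); apply: ray_of_local => a l Jl; apply: ss'; rewrite inE E /=.
        by apply/orP; left; apply/existsP; exists l; rewrite Jl.
      congr (_ *: _); apply: ray_of_local => a l Jl; apply: ss'; rewrite inE E /=.
      by apply/orP; right; apply/existsP; exists l; rewrite Jl.
    by rewrite /Nf /separators (e true) (e false).
  - move=> s; rewrite /Nf; case: ifP => [big|_]; last by rewrite cards0 mulr_ge0 ?ltW // subr_gt0.
    have : #|separators s (Some p.1) (Some p.2)|%:R +
      #|~: separators s (Some p.1) (Some p.2)|%:R = n by rewrite -natrD cardsC.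
    by move: big; lra.
  - rewrite exprMn mulrCA -exprD subnKC; last by rewrite (leq_trans (Pk p)) // rE leq_addl.
    rewrite mulrC ler_pM2l ?exprn_gt0 // ler_wiXn2l ?subr_ge0 ?ltW //.
      by rewrite gtrBl.
    by have := Pk p; move: rE; lia.
have cov : (\bigcup_(p : label * label) X p)%SET = [set: {ffun 'I_r -> I}].
  apply/setP => s; rewrite [RHS]inE; apply/finset.bigcupP.
  have [[[p1 p2] Hp]|nop] := pselect (exists p : label * label,
      eta * n < #|separators s (Some p.1) (Some p.2)|%:R /\
      forall a, s a \notin separators s (Some p.1) (Some p.2)).
    exists (p1, p2) => //; rewrite inE; apply/forallP => a; apply/implyP => _.
    by rewrite /Nf Hp.1 finset.in_setC; exact: Hp.2.
  exfalso; apply: no; exists s => -[L|] [L'|] sL; rewrite leNgt; apply/negP => big.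
  - by apply: nop; exists (L, L').
  - move: big; rewrite (_ : separators _ _ _ = finset.set0) ?cards0.
      by rewrite ltNge mulr_ge0 ?ltW.
    by apply/setP => i; rewrite !inE /= dot0r mulr0 ltxx.
  - move: big; rewrite (_ : separators _ _ _ = finset.set0) ?cards0.
      by rewrite ltNge mulr_ge0 ?ltW.
    by apply/setP => i; rewrite !inE /= dot0r mul0r ltxx.
  - move: big; rewrite (_ : separators _ _ _ = finset.set0) ?cards0.
      by rewrite ltNge mulr_ge0 ?ltW.
    by apply/setP => i; rewrite !inE /= dot0r mul0r ltxx.
have : n ^+ r <= \sum_(p : label * label) #|X p|%:R.
  have -> : n ^+ r = #|[set: {ffun 'I_r -> I}]|%:R by rewrite cardsT card_ffun card_ord natrX.
  rewrite -cov -natr_sum ler_nat; elim/big_rec2 : _ => [|p x y _ xy]; first by rewrite cards0.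
  by rewrite (leq_trans (leq_card_setU _ _)) // leq_add2l.
apply/negP; rewrite -ltNge; apply: le_lt_trans (ler_sum _ (fun p _ => cX p)) _.
(* The number of pairs of labels is [4 * M ^ (2 * k)]. *)
rewrite sumr_const !card_prod card_bool card_ffun !card_ord -[ltLHS]mulr_natl.
rewrite mulrCA -[ltRHS]mulr1 ltr_pM2l ?exprn_gt0 //.
apply: le_lt_trans small; apply: ler_wpM2r; first by rewrite exprn_ge0 // subr_ge0 ltW.
rewrite -natrX -natrM ler_nat leq_eqVlt; apply/orP; left; apply/eqP.
by rewrite mulnACA mulnC -expnD addnn -mul2n.
Qed.

End Sample.

(** The cell of [u] records the labels of at most [2 ^ k] extreme rays, for the arrangement of a
    good sample, whose positive cone contains [u]. [G] keeps the indices whose steps separate no two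
    of these rays. The size of the sample, hence [N], depends on [k] only. *)
Lemma sign_cells : exists N : nat, forall (I : finType) (w : I -> 'rV[R]_k.+1), (0 < #|I|)%N ->
  exists (cls : 'rV[R]_k.+1 -> 'I_N) (G : 'I_N -> {set I}),
  (forall u, (forall i, dot u (w i) != 0) -> (#|I| <= 2 * #|G (cls u)|)%N) /\
  (forall u u', (forall i, dot u (w i) != 0) -> (forall i, dot u' (w i) != 0) ->
    cls u = cls u' -> forall i, i \in G (cls u) -> 0 < dot u (w i) * dot u' (w i)).
Proof.
pose B := (2 ^ k)%N.
have B0 : 0 < B%:R :> R by rewrite ltr0n expn_gt0.
(* Each of the [B ^ 2] pairs of rays excludes at most a proportion [eta] of the indices, at most
   half of them in total. *)
pose eta : R := (2 * B%:R ^+ 2)^-1.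
have eta01 : 0 < eta < 1.
  rewrite invr_gt0 mulr_gt0 ?exprn_gt0 //= invf_lt1 ?mulr_gt0 ?exprn_gt0 //.
  have : 1 <= B%:R :> R by rewrite ler1n expn_gt0.
  nra.
(* With [r = t + 2 k] samples, [t + (3 k + 1)] is the number [r + k + 1] of vectors in the
   family. *)
have [t Ht] := exp_dominates (2 * k) (3 * k + 1) eta01.
pose r := (t + 2 * k)%N.
pose label := option ({ffun 'I_k -> 'I_(r + k.+1)} * bool).
pose cell := {ffun 'I_B -> label}.
pose c0 : cell := [ffun=> None].
exists #|{: cell}| => I w I0.
have [|s Hs] := @good_sample I w r eta t I0 eta01 erefl.
  apply: le_lt_trans Ht; rewrite le_eqVlt; apply/orP; left; apply/eqP.
  by congr (_ * _%:R ^+ _ * _); rewrite /r; lia.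
pose ray := label_ray w s.
pose in_cell u (c : cell) :=
  (exists2 a : 'I_B -> R, (forall l, 0 < a l) & u = \sum_l a l *: ray (c l)) /\
  (forall l, agree (sample_vec w s) u (ray (c l))).
have cellP u : u != 0 -> exists c, in_cell u c.
  move=> u0.
  have [zs [szs uzs Hzs]] := ray_decomposition (@sample_vec_span I w r s) u0.
  have lab z : z \in zs -> exists (L : label) a, 0 < a /\ z = a *: ray L.
    move=> /Hzs[z0 _ rz]; have [J [c zc]] := ray_determined z0 rz.
    have c_0 : c != 0 by apply: contra z0 => /eqP c0'; rewrite zc c0' scale0r.
    exists (Some (J, c < 0)), `|c|; rewrite normr_gt0; split=> //.
    by rewrite /ray /= scalerA mulrC -numEsign.
  have ch (l : 'I_B) : exists p : label * R, 0 < p.2 /\ nth 0 zs l = p.2 *: ray p.1.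
    have [lz|lz] := ltnP l (size zs).
      by have [L [a [a0 ->]]] := lab _ (mem_nth 0 lz); exists (L, a).
    by exists (None, 1); rewrite nth_default // /ray /= scaler0.
  pose f l := projT1 (cid (ch l)).
  have fP l : 0 < (f l).2 /\ nth 0 zs l = (f l).2 *: ray (f l).1 by rewrite /f; case: cid.
  exists [ffun l => (f l).1]; split.
    exists (fun l => (f l).2) => [l|]; first by case: (fP l).
    under eq_bigr => l _ do rewrite ffunE -(fP l).2.
    rewrite uzs (big_nth 0) big_mkord.
    rewrite (big_ord_widen _ (fun i => nth 0 zs i) szs) [RHS](bigID (fun i : 'I_B => (i < size zs)%N)) /=.
    by rewrite [X in _ + X]big1 ?addr0 // => i; rewrite -leqNgt => /(nth_default 0).
  move=> l; rewrite ffunE => j; have [fl0 fl] := fP l.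
  have Hn : agree (sample_vec w s) u (nth 0 zs l).
    have [lz|lz] := ltnP l (size zs); first by have [] := Hzs _ (mem_nth 0 lz).
    by move=> i; rewrite nth_default // dot0r mulr0.
  have [n1 n2] := Hn j; move: n1 n2; rewrite fl dotZr mulrCA pmulr_rge0 // => n1 n2.
  by split=> // /n1 /eqP; rewrite mulf_eq0 gt_eqF //= => /eqP.
pose cl u : cell := if pselect (exists c, in_cell u c) is left e then projT1 (cid e) else c0.
have clP u : u != 0 -> in_cell u (cl u).
  by move=> /cellP e; rewrite /cl; case: pselect => // e'; case: cid.
pose G (c : cell) := [set i | [forall l, forall l', 0 <= dot (w i) (ray (c l)) * dot (w i) (ray (c l'))]].
exists (fun u => enum_rank (cl u)), (fun q => G (enum_val q)).
have /card_gt0P[i0 _] := I0.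
have gen0 u : (forall i, dot u (w i) != 0) -> u != 0.
  by move=> /(_ i0); apply: contra => /eqP ->; rewrite dot0l.
split=> [u gu|u u' gu gu' /enum_rank_inj e i].
  rewrite enum_rankK; have [_ ag] := clP u (gen0 u gu).
  have sub : ~: G (cl u) \subset
      (\bigcup_(p : 'I_B * 'I_B) separators w s (cl u p.1) (cl u p.2))%SET.
    apply/fintype.subsetP => i; rewrite !inE negb_forall => /existsP[l].
    rewrite negb_forall => /existsP[l' neg]; apply/finset.bigcupP; exists (l, l') => //.
    by rewrite inE ltNge.
  (* The rays of the cell agree with [u] on the sample, so no sampled step separates two of them. *)
  have sep (p : 'I_B * 'I_B) : #|separators w s (cl u p.1) (cl u p.2)|%:R <= eta * #|I|%:R.
    apply: Hs => a; rewrite inE -leNgt.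
    have [_] := ag p.1 (lshift _ a); have [_] := ag p.2 (lshift _ a).
    rewrite !sample_vec_lshift -/ray => h2 h1.
    rewrite -(pmulr_rge0 _ (_ : 0 < dot (w (s a)) u ^+ 2)).
      by have := mulr_ge0 h1 h2; congr (0 <= _); ring.
    by rewrite exprn_even_gt0 //= dotC.
  have : #|~: G (cl u)|%:R <= B%:R ^+ 2 * (eta * #|I|%:R) :> R.
    apply: (@le_trans _ _ (\sum_(p : 'I_B * 'I_B) #|separators w s (cl u p.1) (cl u p.2)|%:R)).
      rewrite -natr_sum ler_nat (leq_trans (subset_leq_card sub)) //.
      elim/big_rec2 : _ => [|p x y _ xy]; first by rewrite cards0.
      by rewrite (leq_trans (leq_card_setU _ _)) // leq_add2l.
    apply: le_trans (ler_sum _ (fun p _ => sep p)) _.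
    by rewrite sumr_const card_prod !card_ord -[leLHS]mulr_natl natrM expr2.
  have -> : B%:R ^+ 2 * (eta * #|I|%:R) = #|I|%:R / 2 :> R.
    by rewrite /eta; field; rewrite lt0r_neq0.
  rewrite ler_pdivlMr // -natrM ler_nat => le; have := cardsC (G (cl u)); lia.
rewrite enum_rankK inE => /forallP Gi.
(* Both directions are expanded over the same rays: the product is a sum of nonnegative terms, and
   it is nonzero because the directions are generic. *)
have [[a a0 uE] _] := clP u (gen0 u gu); have [[a' a'0 u'E] _] := clP u' (gen0 u' gu').
rewrite lt_neqAle eq_sym mulf_neq0 //= uE [in X in _ * dot X _]u'E -e !dot_suml.
rewrite mulr_suml sumr_ge0 // => l _; rewrite mulr_sumr sumr_ge0 // => l' _.
rewrite !dotZl mulrACA; apply: mulr_ge0; first by rewrite mulr_ge0 ?ltW.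
by have /forallP := Gi l; move=> /(_ l'); rewrite ![dot (w i) _]dotC.
Qed.

End Cells.

(** * The central binomial coefficient *)

Section Wallis.
Variable R : realType.

(* A primitive of [sin ^+ n] vanishing at [0]. *)
Fixpoint sin_primitive (n : nat) : R -> R :=
  match n with
  | 0%N => id
  | 1%N => cst 1 - cos
  | S (S m) => (m.+2%:R^-1 : R) *: ((m.+1%:R : R) *: sin_primitive m - sin ^+ m.+1 * cos)
  end.

Lemma is_derive_sin_primitive n (x : R) : is_derive x 1 (sin_primitive n) (sin x ^+ n).
Proof.
suff: is_derive x 1 (sin_primitive n) (sin x ^+ n) /\
  is_derive x 1 (sin_primitive n.+1) (sin x ^+ n.+1) by case.
elim: n => [|n [IH0 IH1]]; split=> //.
- by rewrite expr0; exact: is_derive_id.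
- by apply: is_derive_eq; rewrite expr1 sub0r opprK.
- have H := is_deriveX n.+1 (is_derive_sin x).
  rewrite [sin_primitive _]/=; apply: is_derive_eq.
  have e : cos x ^+ 2 = 1 - sin x ^+ 2 by rewrite -(cos2Dsin2 x) addrK.
  rewrite /= !fctE /GRing.scale /= [sin x ^+ n.+2]exprSr exprSr.
  have n2 : (n.+2%:R : R) != 0 by rewrite pnatr_eq0.
  apply: (mulfI n2); rewrite [LHS]mulrA divff // mul1r.
  rewrite (_ : cos x * (_ * cos x) = n.+1%:R * sin x ^+ n * cos x ^+ 2); last by ring.
  by rewrite e -!natr1; ring.
Qed.

Lemma sin_primitive0 n : sin_primitive n 0 = 0.
Proof.
suff: sin_primitive n 0 = 0 /\ sin_primitive n.+1 0 = 0 by case.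
elim: n => [|n [IH0 IH1]]; split=> //; first by rewrite /= !fctE cos0 subrr.
rewrite [sin_primitive _]/= !fctE /GRing.scale /= IH0 sin0 exprS mul0r mul0r.
by rewrite mulr0 subrr mulr0.
Qed.

Let a n := sin_primitive n (pi / 2).

Lemma wallisSS n : n.+2%:R * a n.+2 = n.+1%:R * a n.
Proof.
have n2 : (n.+2%:R : R) != 0 by rewrite pnatr_eq0.
rewrite /a [sin_primitive n.+2]/= !fctE /GRing.scale /= cos_pihalf mulr0 subr0.
by rewrite [LHS]mulrA divff // mul1r.
Qed.

(** On the interval from 0 to [pi / 2] the powers of sine are nonnegative and decrease with the
    exponent; the mean value theorem transfers this to the primitives. *)
Lemma wallis_nincr n : 0 <= a n.+1 <= a n.
Proof.
have p0 : (0 : R) <= pi / 2 by rewrite divr_ge0 // pi_ge0.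
have sin01 x : x \in `[0, (pi / 2 : R)] -> 0 <= sin x <= 1.
  rewrite in_itv /= => /andP[x0 x1]; rewrite sin_le1 sin_ge0_pi // x0 /=.
  by have := pi_ge0 R; lra.
have ge0 (f df : R -> R) : (forall x : R, is_derive x 1 f (df x)) ->
    (forall x, x \in `[0, (pi / 2 : R)] -> 0 <= df x) -> f 0 <= f (pi / 2).
  move=> fd fp; rewrite -subr_ge0.
  have [|c cI ->] := MVT_segment p0 (fun x _ => fd x).
    apply: continuous_subspaceT => x; apply: differentiable_continuous.
    by apply/derivable1_diffP; case: (fd x).
  by rewrite mulr_ge0 ?fp // subr0.
apply/andP; split.
  rewrite -(sin_primitive0 n.+1); apply: ge0 (is_derive_sin_primitive n.+1) _ => x /sin01/andP[? _].
  by rewrite exprn_ge0.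
rewrite -subr_ge0.
have := ge0 (sin_primitive n - sin_primitive n.+1) (fun x => sin x ^+ n - sin x ^+ n.+1).
rewrite !fctE !sin_primitive0 subrr; apply.
  by move=> x; apply: is_deriveB; exact: is_derive_sin_primitive.
move=> x /sin01/andP[s0 s1]; rewrite exprS -{1}[sin x ^+ n]mul1r -mulrBl.
by rewrite mulr_ge0 ?exprn_ge0 // subr_ge0.
Qed.

Lemma wallis_prod n : n.+1%:R * a n.+1 * a n = pi / 2.
Proof.
elim: n => [|n IH]; first by rewrite /a /= !fctE cos_pihalf subr0 !mul1r.
by rewrite wallisSS mulrAC mulrC mulrA -[RHS]IH; ring.
Qed.

(** Induction on [m]: ['C(2 * m, m) / 4 ^ m] and [a (2 * m)] satisfy the same recurrence. *)
Lemma wallis_bin m : 'C(2 * m, m)%:R * (pi / 2) = 4 ^+ m * a (2 * m).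
Proof.
elim: m => [|m IH]; first by rewrite /a /= bin0 expr0.
rewrite mulnS add2n.
have e : ('C((2 * m).+2, m.+1) * m.+1 = 2 * (2 * m).+1 * 'C(2 * m, m))%N.
  rewrite mulnC -mul_bin_diag /=.
  have h : (m.+1 * 'C((2 * m).+1, m) = (2 * m).+1 * 'C(2 * m, m))%N.
    have := mul_bin_down (2 * m).+1 m; rewrite /= => ->.
    by congr (_ * _)%N; lia.
  have -> : ((2 * m).+2 = 2 * m.+1)%N by lia.
  by rewrite -mulnA h mulnA.
have m1 : (m.+1%:R : R) != 0 by rewrite pnatr_eq0.
have eR : 'C((2 * m).+2, m.+1)%:R * m.+1%:R = 2 * (2 * m).+1%:R * 'C(2 * m, m)%:R :> R.
  by rewrite -!natrM e.
apply: (mulIf m1); rewrite mulrAC eR -[LHS]mulrA IH.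
have := wallisSS (2 * m).
have -> : ((2 * m).+2%:R : R) = 2 * m.+1%:R by rewrite -natrM; congr (_%:R); lia.
rewrite exprS => h.
rewrite (_ : 2 * (2 * m).+1%:R * (4 ^+ m * a (2 * m)) = 2 * 4 ^+ m * ((2 * m).+1%:R * a (2 * m))); last by ring.
by rewrite -h; ring.
Qed.

(** For even [m], monotonicity bounds the square of [a m] by a product of consecutive terms, known
    from [wallis_prod]. An odd [m] reduces to [m + 1], whose central coefficient is twice that of
    [m]. *)
Lemma central_bin_le m : (0 < m)%N ->
  'C(m, m./2)%:R <= 2 ^+ m * Num.sqrt (2 / (pi * m%:R)) :> R.
Proof.
have pi0 := pi_gt0 R.
have even j : (0 < j)%N -> 'C(2 * j, j)%:R <= 2 ^+ (2 * j) * Num.sqrt (2 / (pi * (2 * j)%:R)) :> R.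
  case: j => // j _.
  have p0 : 0 < pi * (2 * j.+1)%:R :> R by rewrite mulr_gt0.
  rewrite -ler_sqr ?nnegrE ?mulr_ge0 ?sqrtr_ge0 // exprMn sqr_sqrtr; last first.
    by rewrite divr_ge0 // ltW.
  rewrite mulrA ler_pdivlMr // exprM.
  have := wallis_prod (2 * j).+1; have /andP[a0 aa] := wallis_nincr (2 * j).+1.
  have := wallis_bin j.+1; rewrite mulnS add2n.
  set b := 'C(_, _)%:R; set x := a (2 * j).+2 in a0 aa *; set y := a _ => bx xy.
  have J : (0 : R) < (2 * j).+2%:R by rewrite ltr0n.
  have -> : (2 : R) ^+ 2 = 4 by rewrite -natrX.
  have H : (2 * j).+2%:R * x * x <= pi / 2.
    by rewrite -xy ler_wpM2l // mulr_ge0 // ltW.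
  have xE : 4 ^+ j.+1 * x = b * (pi / 2) by rewrite bx.
  set F := 4 ^+ j.+1 in xE *.
  have F0 : 0 < F by rewrite /F exprn_gt0.
  have : F ^+ 2 * ((2 * j).+2%:R * x * x) <= F ^+ 2 * (pi / 2).
    by rewrite ler_wpM2l // sqr_ge0.
  rewrite (_ : F ^+ 2 * ((2 * j).+2%:R * x * x) = (2 * j).+2%:R * (F * x) ^+ 2); last by ring.
  rewrite xE => H2.
  have -> : b ^+ 2 * (pi * (2 * j).+2%:R) = 4 / pi * ((2 * j).+2%:R * (b * (pi / 2)) ^+ 2).
    by move: (pi : R) pi0 => P P0; field; exact: lt0r_neq0.
  apply: (@le_trans _ _ (4 / pi * (F ^+ 2 * (pi / 2)))); first by rewrite ler_wpM2l // divr_ge0 // ltW.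
  rewrite le_eqVlt; apply/orP; left; apply/eqP.
  by rewrite -/F; clearbody F; move: (pi : R) pi0 => P P0; field; exact: lt0r_neq0.
move=> m0; have := odd_double_half m; case: (odd m) => /= mE.
  pose j := m./2; have mE' : m = (2 * j).+1 by rewrite /j; lia.
  have := even j.+1 isT; rewrite mulnS add2n.
  have -> : ('C((2 * j).+2, j.+1) = 2 * 'C(m, m./2))%N.
    rewrite binS mE' -/j; have -> : 'C((2 * j).+1, j.+1) = 'C((2 * j).+1, j).
      by rewrite -bin_sub; [congr 'C(_, _); lia | lia].
    have -> : ((2 * j).+1./2 = j)%N by lia.
    by rewrite addnn -mul2n.
  rewrite natrM exprS -mE' -mulrA ler_pM2l // => h; apply: le_trans h _.
  rewrite ler_wpM2l // ler_sqrt; last by rewrite divr_ge0 // mulr_ge0 // ltW.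
  rewrite ler_pM2l // lef_pV2 ?posrE ?mulr_gt0 ?ltr0n //.
  by rewrite ler_pM2l // ler_nat.
rewrite add0n -mul2n in mE; have := even m./2; rewrite mE; apply; lia.
Qed.

Lemma central_bin_le_weak m : (0 < m)%N ->
  'C(m, m./2)%:R <= 2 ^+ m / Num.sqrt m%:R :> R.
Proof.
move=> m0; apply: le_trans (central_bin_le m0) _; rewrite ler_wpM2l //.
have m0' : (0 : R) < m%:R by rewrite ltr0n.
rewrite -sqrtrV ?(ltW m0') // ler_sqrt; last by rewrite invr_ge0 ltW.
have p2 := pi_ge2 R; have pi0 := pi_gt0 R.
by rewrite invfM mulrA ler_piMl ?invr_ge0 // ler_pdivrMr // mul1r.
Qed.

End Wallis.

(** * Conditioning on the indices outside a subset *)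

Lemma card_fibers (R : realType) (I : finType) (G : {set I}) (F : {set {set I}}) (b : R) :
  (forall Y : {set I}, [disjoint Y & G] ->
    #|[set Z : {set {x | x \in G}} | [set val z | z in Z] :|: Y \in F]|%:R <= b) ->
  #|F|%:R <= 2 ^+ (#|I| - #|G|) * b.
Proof.
move=> Hb; rewrite -sum1_card natr_sum.
rewrite (partition_big (fun X => X :\: G) (mem (powerset (~: G)))) /=; last first.
  by move=> X _; rewrite powersetE; apply/fintype.subsetP => x; rewrite !inE => /andP[].
have -> : (#|I| - #|G|)%N = #|~: G| by rewrite -(cardsC G) addKn.
rewrite -natrX -card_powerset mulr_natl -sumr_const; apply: ler_sum => Y.
rewrite powersetE => YG; have dYG : [disjoint Y & G] by rewrite finset.disjoints_subset.
apply: le_trans (Hb Y dYG); rewrite -natr_sum sum1dep_card ler_nat.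
pose f (X : {set I}) : {set {x | x \in G}} := [set z | val z \in X].
rewrite -(card_in_imset (f := f)).
  apply: subset_leq_card; apply/fintype.subsetP => _ /finset.imsetP[X + ->].
  rewrite !inE => /andP[XF /eqP XY]; move: XF; congr (is_true (_ \in F)).
  apply/setP => x; rewrite inE -XY; apply/idP/orP => [xX|[/finset.imsetP[z]|]].
  - have [xG|xG] := boolP (x \in G); last by right; rewrite !inE xG.
    by left; apply/finset.imsetP; exists (exist _ x xG) => //; rewrite inE.
  - by rewrite inE => zX ->.
  - by rewrite inE => /andP[].
move=> X X'; rewrite !inE => /andP[_ /eqP XY] /andP[_ /eqP XY'] /setP e.
apply/setP => x; have [xG|xG] := boolP (x \in G).
  by have := e (exist _ x xG); rewrite !inE.
by have := congr1 (fun A : {set I} => x \in A) (etrans XY (esym XY')); rewrite /= !inE xG.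
Qed.

Lemma card_sub_set (I : finType) (G : {set I}) : #|{: {x | x \in G}}| = #|G|.
Proof. by rewrite card_sig; apply: eq_card. Qed.

Lemma sum_fiber (V : zmodType) (I : finType) (G Y : {set I}) (Z : {set {x | x \in G}})
    (w : I -> V) : [disjoint Y & G] ->
  \sum_(i in [set val z | z in Z] :|: Y) w i =
  \sum_(i in Y) w i + \sum_(z in Z) w (val z).
Proof.
move=> YG; rewrite sum_disjointU.
  by rewrite addrC big_imset //= => z z' _ _; exact: val_inj.
rewrite disjoint_sym; apply: (disjointWr _ YG).
by apply/fintype.subsetP => _ /finset.imsetP[z _ ->]; exact: (valP z).
Qed.

(** * Orienting the steps *)

Section Orientation.
Variables (R : realType) (k : nat) (I : finType).
Implicit Types (w : I -> 'rV[R]_k) (p : 'rV[R]_k) (F : {set {set I}}).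

Definition subset_sum w p (X : {set I}) := p + \sum_(i in X) w i.

(* Every member of [F] is strictly extremal, within [F], in a direction along
   which all the steps [w i] increase. *)
Definition oriented w p F := forall X, X \in F -> exists u,
  (forall i, 0 < dot u (w i)) /\
  forall Y, Y \in F -> subset_sum w p Y != subset_sum w p X ->
    dot u (subset_sum w p Y) < dot u (subset_sum w p X).

(** If [X] is properly contained in [Y], then [Y] goes further along the direction in which [X] is
    strictly extremal. *)
Lemma oriented_antichain w p F : oriented w p F -> antichain F.
Proof.
move=> oF X Y XF YF XY; apply/eqP; rewrite finset.eqEsubset XY /= .
have [u [uw uF]] := oF X XF.
have sY : subset_sum w p Y = subset_sum w p X + \sum_(i in Y :\: X) w i.
  rewrite /subset_sum -addrA; congr (_ + _); rewrite [LHS](finset.big_setID X) /=.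
  by rewrite (finset.setIidPr XY).
have du : dot u (subset_sum w p Y) = dot u (subset_sum w p X) + \sum_(i in Y :\: X) dot u (w i).
  by rewrite sY dotDr dot_sumr.
apply/fintype.subsetP => i iY; apply/negPn/negP => iX.
have pos : 0 < \sum_(i in Y :\: X) dot u (w i).
  rewrite (bigD1 i) /=; last by rewrite inE iX.
  by rewrite ltr_pwDl // sumr_ge0 // => j _; rewrite ltW.
have ne : subset_sum w p Y != subset_sum w p X.
  by apply/eqP => e; move: pos; rewrite e in du; rewrite -(ltrD2l (dot u (subset_sum w p X))) -du addr0 ltxx.
by have := uF Y YF ne; rewrite du ltNge lerDl ltW.
Qed.

(** Reverse the steps that are negative along one of the directions and replace each [X] by its
    symmetric difference with this set of indices: the sums do not change once [p] is moved. As the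
    directions agree in sign on every step, all steps become positive along all of them. *)
Lemma orientation w p F (U : {set I} -> 'rV[R]_k) :
  (forall X i, X \in F -> dot (U X) (w i) != 0) ->
  (forall X Y, X \in F -> Y \in F -> subset_sum w p Y != subset_sum w p X ->
    dot (U X) (subset_sum w p Y) < dot (U X) (subset_sum w p X)) ->
  (forall X Y i, X \in F -> Y \in F -> 0 < dot (U X) (w i) * dot (U Y) (w i)) ->
  exists w' p' (F' : {set {set I}}),
  [/\ #|F'| = #|F|, forall i, w' i = w i \/ w' i = - w i,
      forall i j, w i = w j -> w' i = w' j,
      forall X, X \in F' -> exists2 Y, Y \in F & subset_sum w' p' X = subset_sum w p Y &
      oriented w' p' F'].
Proof.
move=> U0 Us Upos.
have [F0|[X0 X0F]] := finset.set_0Vmem F.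
  exists w, p, F; split=> //; first by left.
    by move=> X XF; exists X.
  by move=> X; rewrite F0 inE.
pose u0 := U X0.
pose Ng := [set i | dot u0 (w i) < 0].
pose flip (X : {set I}) := (X :\: Ng) :|: (Ng :\: X).
pose w' i := if i \in Ng then - w i else w i.
pose p' := p + \sum_(i in Ng) w i.
have flipK : involutive flip.
  by move=> X; apply/setP => x; rewrite !inE; case: (x \in X); case: (_ < 0).
have sflip X : subset_sum w' p' (flip X) = subset_sum w p X.
  rewrite /subset_sum /p' -addrA; congr (_ + _).
  rewrite sum_disjointU; last first.
    by rewrite -finset.setI_eq0; apply/eqP/setP => x; rewrite !inE; case: (x \in X); case: (_ < 0).
  have -> : \sum_(i in X :\: Ng) w' i = \sum_(i in X :\: Ng) w i.
    by apply: eq_bigr => i; rewrite /w' finset.in_setD => /andP[/negbTE ->].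
  have -> : \sum_(i in Ng :\: X) w' i = - \sum_(i in Ng :\: X) w i.
    rewrite -sumrN; apply: eq_bigr => i; rewrite /w' finset.in_setD => /andP[_ iN].
    by rewrite iN.
  rewrite [RHS](finset.big_setID Ng) [\sum_(i in Ng) _](finset.big_setID X) /= [X :&: Ng]finset.setIC.
  by rewrite addrACA subrr addr0.
have w'pos X i : X \in F -> 0 < dot (U X) (w' i).
  move=> XF; have := Upos X0 X i X0F XF; rewrite /w' inE -/u0.
  case: (ltP (dot u0 (w i)) 0) => [neg|pos]; first by rewrite dotNr oppr_gt0 nmulr_rgt0.
  rewrite pmulr_rgt0 // lt_neqAle pos eq_sym U0 //.
exists w', p', [set flip X | X in F]; split.
- by rewrite card_imset //; exact: (inv_inj flipK).
- by move=> i; rewrite /w'; case: ifP; [right|left].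
- by move=> i j e; rewrite /w' !inE e.
- by move=> _ /finset.imsetP[X XF ->]; exists X.
move=> _ /finset.imsetP[X XF ->]; exists (U X); split=> [i|]; first exact: w'pos.
by move=> _ /finset.imsetP[Y YF ->]; rewrite !sflip; exact: Us.
Qed.

End Orientation.

Lemma exposing_directions (R : realType) (k : nat) (I : finType) (w : I -> 'rV[R]_k) p
    (F : {set {set I}}) (S : set 'rV[R]_k) :
  convex_position S -> (forall i, w i != 0) ->
  (forall X, X \in F -> S (subset_sum w p X)) ->
  exists U : {set I} -> 'rV[R]_k,
  (forall X i, X \in F -> dot (U X) (w i) != 0) /\
  (forall X Y, X \in F -> Y \in F -> subset_sum w p Y != subset_sum w p X ->
    dot (U X) (subset_sum w p Y) < dot (U X) (subset_sum w p X)).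
Proof.
move=> cS w0 FS.
have ch (X : {set I}) : exists u, X \in F -> (forall i, dot u (w i) != 0) /\
    forall Y, Y \in F -> subset_sum w p Y != subset_sum w p X ->
    dot u (subset_sum w p Y) < dot u (subset_sum w p X).
  have [XF|] := boolP (X \in F); last by exists 0.
  have [||u uF uw] := @exposed_point R k S (subset_sum w p X)
      [seq subset_sum w p Y | Y in F] [seq w i | i in I] cS (FS X XF).
  - by move=> v /fintype.imageP[Y YF ->]; exact: FS.
  - by move=> v /fintype.imageP[i _ ->].
  exists u => _; split=> [i|Y YF]; first by apply: uw; exact: fintype.image_f.
  by apply: uF; exact: fintype.image_f.
exists (fun X => projT1 (cid (ch X))); split=> [X i XF|X Y XF]; case: cid => u /= /(_ XF)[? ?] //.
by move=> YF; auto.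
Qed.

(** Within one cell, conditioning on the indices outside [G q] leaves steps on which all directions
    agree, and the antichain bound applies after orientation. Classes are counted up to sign because
    orientation may merge opposite steps. *)
Lemma small_classes_bound (R : realType) (k : nat) (dl : R) : 0 < dl ->
  exists2 K : R, 0 < K &
  forall (I : finType) (w : I -> 'rV[R]_k) (p : 'rV[R]_k) (S : set 'rV[R]_k)
    (F : {set {set I}}),
  (0 < #|I|)%N -> convex_position S -> (forall i, w i != 0) ->
  (forall X, X \in F -> S (subset_sum w p X)) ->
  (forall v, #|[set i | (w i == v) || (w i == - v)]|%:R <= K * #|I|%:R) ->
  #|F|%:R <= dl * (2 ^+ #|I| / Num.sqrt #|I|%:R).
Proof.
case: k => [|k] dl0.
  exists 1 => // I w p S F /card_gt0P[i _] _ /(_ i) /eqP[].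
  by apply/rowP => -[].
have [N HN] := @sign_cells R k.
(* The factor 2 pays for [sqrt #|I| <= 2 sqrt #|G q|], and [N.+1] for the number of cells. *)
pose dl' := dl / (2 * N.+1%:R).
have dl'0 : 0 < dl' by rewrite divr_gt0 // mulr_gt0.
have [K K0 HK] := @small_classes_antichain R k.+1 dl' dl'0.
(* [G q] holds at least half of the indices, so a class of proportion [K / 2] has proportion at most
   [K] there. *)
exists (K / 2) => [|I w p S F I0 cS w0 FS sm]; first by rewrite divr_gt0.
have [cls [G [Gbig Gsgn]]] := HN I w I0.
have [U [U0 Us]] := exposing_directions cS w0 FS.
pose B : R := 2 ^+ #|I| / Num.sqrt #|I|%:R.
have nR : (0 : R) < #|I|%:R by rewrite ltr0n.
have B0 : 0 < B by rewrite divr_gt0 ?exprn_gt0 // sqrtr_gt0.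
have cell q : #|[set X in F | cls (U X) == q]|%:R <= 2 * dl' * B.
  set Fq := [set X in F | _].
  have FqF X : X \in Fq -> X \in F by rewrite inE => /andP[].
  have clsq X : X \in Fq -> cls (U X) = q by rewrite inE => /andP[_ /eqP].
  have [->|[X0 X0F]] := finset.set_0Vmem Fq; first by rewrite cards0 mulr_ge0 ?ltW // mulr_gt0.
  have Gq : (#|I| <= 2 * #|G q|)%N.
    by rewrite -(clsq X0 X0F); apply: Gbig => i; apply: U0; exact: FqF.
  pose g := #|G q|; have g0 : (0 < g)%N by rewrite /g; lia.
  have gR : (0 : R) < g%:R by rewrite ltr0n.
  have gI : (g <= #|I|)%N by exact: max_card.
  apply: le_trans (@card_fibers R I (G q) Fq (dl' * (2 ^+ g / Num.sqrt g%:R)) _) _; last first.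
    have -> : 2 ^+ (#|I| - g) * (dl' * (2 ^+ g / Num.sqrt g%:R)) = dl' * (2 ^+ #|I| / Num.sqrt g%:R) :> R.
      by rewrite -[in RHS](subnK gI) exprD; ring.
    rewrite [leRHS](_ : _ = dl' * (2 * B)); last by ring.
    rewrite ler_pM2l // /B [leRHS]mulrCA ler_pM2l ?exprn_gt0 //.
    rewrite ler_pdivlMr ?sqrtr_gt0 // mulrC ler_pdivrMr ?sqrtr_gt0 //.
    rewrite -ler_sqr ?nnegrE ?mulr_ge0 ?sqrtr_ge0 // exprMn !sqr_sqrtr ?ltW //.
    have : #|I|%:R <= 2 * g%:R :> R by rewrite -natrM ler_nat.
    nra.
  move=> Y YG; set FY := [set Z | _].
  pose wY (z : {x | x \in G q}) := w (val z).
  pose pY := p + \sum_(i in Y) w i.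
  pose ext (Z : {set {x | x \in G q}}) := [set val z | z in Z] :|: Y.
  have extE Z : subset_sum wY pY Z = subset_sum w p (ext Z).
    by rewrite /subset_sum sum_fiber // addrA.
  have FYF Z : Z \in FY -> ext Z \in Fq by rewrite inE.
  have [||| w' [p' [F' [<- w'w _ F'F oF']]]] := @orientation R k.+1 _ wY pY FY (fun Z => U (ext Z)).
  - by move=> Z i /FYF/FqF ZF; exact: U0.
  - by move=> Z Z' /FYF/FqF ZF /FYF/FqF ZF'; rewrite !extE; exact: Us.
  - move=> Z Z' i /FYF ZF /FYF ZF'; apply: Gsgn.
    + by move=> j; apply: U0; exact: FqF.
    + by move=> j; apply: U0; exact: FqF.
    + by rewrite !clsq.
    + by rewrite clsq // (valP i).
  apply: le_trans (HK _ w' p' S F' _ cS (oriented_antichain oF') _ _) _.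
  - by rewrite card_sub_set.
  - by move=> X /F'F[Z /FYF/FqF ZF]; rewrite /subset_sum => ->; rewrite -/(subset_sum _ _ _) extE; exact: FS.
  - move=> v; rewrite card_sub_set.
    apply: (@le_trans _ _ #|[set i | (w i == v) || (w i == - v)]|%:R).
      rewrite ler_nat -(card_imset _ (@val_inj _ _ {x | x \in G q})).
      apply: subset_leq_card; apply/fintype.subsetP => _ /finset.imsetP[z + ->].
      by rewrite !inE => /eqP <-; case: (w'w z) => ->; rewrite ?opprK /wY eqxx ?orbT.
    apply: le_trans (sm v) _; rewrite -mulrA ler_pM2l // ler_pdivrMl //.
    by rewrite -natrM ler_nat.
  - by rewrite card_sub_set ler_pM2l // central_bin_le_weak.
have -> : #|F|%:R = \sum_(q < N) #|[set X in F | cls (U X) == q]|%:R :> R.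
  rewrite -natr_sum -sum1_card (partition_big (fun X => cls (U X)) xpredT) //=.
  by congr (_%:R); apply: eq_bigr => q _; rewrite sum1dep_card; apply: eq_card => X; rewrite !inE.
apply: le_trans (ler_sum _ (fun q _ => cell q)) _.
rewrite sumr_const card_ord -[leLHS]mulr_natl mulrA ler_wpM2r ?(ltW B0) // /dl'.
rewrite (_ : N%:R * _ = dl * (N%:R / N.+1%:R)); last by field; rewrite ?natr1 ?nat1r pnatr_eq0.
by apply: ler_piMr; rewrite ?(ltW dl0) // ler_pdivrMr // mul1r ler_nat.
Qed.

(** * Two repeated directions *)

Section Translates.
Variables (R : realType) (k : nat) (S : set 'rV[R]_k).
Hypothesis cS : convex_position S.

Lemma convex_position3 (x y1 y2 y3 : 'rV[R]_k) (c1 c2 c3 : R) :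
  S x -> S y1 -> S y2 -> S y3 -> y1 != x -> y2 != x -> y3 != x ->
  0 <= c1 -> 0 <= c2 -> 0 <= c3 -> c1 + c2 + c3 = 1 ->
  x != c1 *: y1 + c2 *: y2 + c3 *: y3.
Proof.
move=> Sx S1 S2 S3 n1 n2 n3 p1 p2 p3 sum1.
have := cS (x := x) (m := 3) (y := fun i => nth 0 [:: y1; y2; y3] i)
  (c := fun i => nth 0 [:: c1; c2; c3] i) Sx.
rewrite !big_ord_recr !big_ord0 /= !add0r; apply=> //.
  by move=> -[[|[|[|]]]].
by move=> -[[|[|[|]]]].
Qed.

(** If [s] is nonnegative, [x2] is a convex combination of [x1], [x3] and [x2 + e]; otherwise
    [x2 + e] is one of [x1 + e], [x3 + e] and [x2]. *)
Lemma no_three_parallel (x1 x2 x3 e : 'rV[R]_k) (la s : R) :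
  S x1 -> S x2 -> S x3 -> S (x1 + e) -> S (x2 + e) -> S (x3 + e) ->
  x1 != x2 -> x3 != x2 -> e != 0 -> 0 <= la <= 1 ->
  x2 = (1 - la) *: x1 + la *: x3 + s *: e -> False.
Proof.
move=> S1 S2 S3 S1e S2e S3e n1 n3 e0 /andP[la0 la1] x2E.
have la1' : 0 <= 1 - la by rewrite subr_ge0.
have x2e : x2 + e != x2 by rewrite -subr_eq0 addrAC subrr add0r.
have [s0|s0] := leP 0 s.
  have s1 : 0 < 1 + s by rewrite ltr_pwDl.
  have sum1 : (1 - la) / (1 + s) + la / (1 + s) + s / (1 + s) = 1.
    by field; rewrite lt0r_neq0.
  have := convex_position3 S2 S1 S3 S2e n1 n3 x2e (divr_ge0 la1' (ltW s1))
    (divr_ge0 la0 (ltW s1)) (divr_ge0 s0 (ltW s1)) sum1.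
  move=> /negP; apply; apply/eqP/rowP => j; have /rowP/(_ j) := x2E; rewrite !mxE => E.
  by rewrite !E; field; rewrite lt0r_neq0.
have s1 : 0 < 1 - s by rewrite subr_gt0 (lt_trans s0).
have c1 : x1 + e != x2 + e by rewrite (inj_eq (addIr e)).
have c3 : x3 + e != x2 + e by rewrite (inj_eq (addIr e)).
have x2e' : x2 != x2 + e by rewrite eq_sym.
have s0' : 0 <= - s by rewrite oppr_ge0 ltW.
have sum1 : (1 - la) / (1 - s) + la / (1 - s) + - s / (1 - s) = 1.
  by field; rewrite lt0r_neq0.
have := convex_position3 S2e S1e S3e S2 c1 c3 x2e' (divr_ge0 la1' (ltW s1))
  (divr_ge0 la0 (ltW s1)) (divr_ge0 s0' (ltW s1)) sum1.
move=> /negP; apply; apply/eqP/rowP => j; have /rowP/(_ j) := x2E; rewrite !mxE => E.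
by rewrite !E; field; rewrite lt0r_neq0.
Qed.

(** The linear form [det] vanishes on [e], so it orders the lines parallel to [e] through the three
    points; the middle line meets the segment between the other two points. *)
Lemma no_three_translates (P v1 v2 : 'rV[R]_k) (a b : R) (p q : 'I_3 -> R) :
  (forall c d, c *: v1 + d *: v2 = 0 -> c = 0 /\ d = 0) -> 0 < a -> 0 < b ->
  (forall i, S (P + p i *: v1 + q i *: v2)) ->
  (forall i, S (P + (p i + a) *: v1 + (q i - b) *: v2)) ->
  (forall i j, p i = p j -> i = j) -> False.
Proof.
move=> ind a0 b0 Sx Sy pinj.
pose x i := P + p i *: v1 + q i *: v2.
pose e := a *: v1 - b *: v2.
have xe i : x i + e = P + (p i + a) *: v1 + (q i - b) *: v2.
  by apply/rowP => j; rewrite !mxE; ring.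
have e0 : e != 0.
  apply/eqP; rewrite /e -scaleNr => /ind[a_0 _]; by rewrite a_0 ltxx in a0.
have xinj i j : i != j -> x i != x j.
  move=> ij; apply/eqP => xx; move: ij; apply/negP/negPn/eqP/pinj.
  have := ind (p i - p j) (q i - q j); case; last by move/eqP; rewrite subr_eq0 => /eqP.
  have /eqP := xx; rewrite -subr_eq0 => /eqP xx0; rewrite -[RHS]xx0.
  by apply/rowP => l; rewrite !mxE; ring.
pose det i := a * q i + b * p i.
have key i j l : i != j -> l != j -> det i <= det j <= det l -> False.
  move=> ij lj /andP[d1 d2].
  have SS m : S (x m + e) by rewrite xe.
  have npar := fun la s => @no_three_parallel (x i) (x j) (x l) e la s
    (Sx i) (Sx j) (Sx l) (SS i) (SS j) (SS l) (xinj _ _ ij) (xinj _ _ lj) e0.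
  have aN : a != 0 by rewrite lt0r_neq0.
  have qE m : q m = (det m - b * p m) / a by rewrite /det; field.
  (* When the extreme values coincide, the three points lie on one line parallel to [e]. *)
  have [dil|dil] := eqVneq (det i) (det l).
    apply: (npar 0 ((p j - p i) / a)); first by rewrite lexx ler01.
    have dj : det j = det i by apply/le_anti; rewrite d1 dil d2.
    by apply/rowP => m; rewrite !mxE (qE i) (qE j) dj; field.
  have dd : 0 < det l - det i by rewrite subr_gt0 lt_neqAle dil (le_trans d1).
  pose la := (det j - det i) / (det l - det i).
  apply: (npar la ((p j - (1 - la) * p i - la * p l) / a)).
    have dle : det i <= det l := le_trans d1 d2.
    rewrite divr_ge0 ?subr_ge0 //=.
    by rewrite ler_pdivrMr // mul1r lerB.
  have dN : det l - det i != 0 by rewrite lt0r_neq0.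
  apply/rowP => m; rewrite !mxE (qE i) (qE j) (qE l) /la.
  by move: (det i) (det j) (det l) dN => Di Dj Dl dN; field; rewrite aN dN.
pose i0 : 'I_3 := ord0; pose i1 : 'I_3 := lift ord0 ord0; pose i2 : 'I_3 := ord_max.
have [h01|/ltW h10] := leP (det i0) (det i1); have [h12|/ltW h21] := leP (det i1) (det i2);
  have [h02|/ltW h20] := leP (det i0) (det i2).
- by apply: (key i0 i1 i2) => //; rewrite h01.
- by apply: (key i0 i1 i2) => //; rewrite h01.
- by apply: (key i0 i2 i1) => //; rewrite h02.
- by apply: (key i2 i0 i1) => //; rewrite h20.
- by apply: (key i1 i0 i2) => //; rewrite h10.
- by apply: (key i1 i2 i0) => //; rewrite h12.
- by apply: (key i2 i1 i0) => //; rewrite h21.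
- by apply: (key i2 i1 i0) => //; rewrite h21.
Qed.

End Translates.

(** * Variance and tails of the binomial distribution *)

Section Binomial.
Variable R : realType.

Lemma sum_pascal (m : nat) (g : nat -> R) :
  \sum_(p < m.+2) 'C(m.+1, p)%:R * g p = \sum_(p < m.+1) 'C(m, p)%:R * (g p + g p.+1).
Proof.
rewrite big_ord_recl /= bin0 mul1r.
under eq_bigr => p _ do rewrite /bump /= add1n binS natrD mulrDl.
rewrite big_split /= addrA.
have -> : g 0%N + \sum_(p < m.+1) 'C(m, p.+1)%:R * g p.+1 = \sum_(p < m.+1) 'C(m, p)%:R * g p.
  transitivity (\sum_(p < m.+2) 'C(m, p)%:R * g p).
    by rewrite [RHS]big_ord_recl /= bin0 mul1r.
  by rewrite big_ord_recr /= bin_small // mul0r addr0.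
by rewrite -big_split; apply: eq_bigr => p _ /=; rewrite mulrDr.
Qed.

Lemma sum_bin (m : nat) : \sum_(p < m.+1) 'C(m, p)%:R = 2 ^+ m :> R.
Proof.
elim: m => [|m IH]; first by rewrite big_ord_recr big_ord0 /= add0r.
under eq_bigr => p _ do rewrite -[_%:R]mulr1.
by rewrite (sum_pascal m (fun=> 1)) -mulr_suml IH exprS mulrC.
Qed.

(** Induction by Pascal's rule, with [(x - 1) ^ 2 + (x + 1) ^ 2 = 2 x ^ 2 + 2]. *)
Lemma binomial_variance (m : nat) :
  \sum_(p < m.+1) 'C(m, p)%:R * (2 * p%:R - m%:R) ^+ 2 = m%:R * 2 ^+ m :> R.
Proof.
elim: m => [|m IH]; first by rewrite big_ord_recr big_ord0 /= add0r bin0 subr0 mulr0 expr0n mulr0 mul0r.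
rewrite (sum_pascal m (fun p => (2 * p%:R - m.+1%:R) ^+ 2)).
rewrite (eq_bigr (fun p : 'I_m.+1 => 2 * ('C(m, p)%:R * (2 * p%:R - m%:R) ^+ 2) + 2 * 'C(m, p)%:R)).
  by rewrite big_split /= -!mulr_sumr IH sum_bin -natr1 exprS; ring.
by move=> p _; rewrite -[p.+1%:R]natr1 -[m.+1%:R]natr1; ring.
Qed.

Lemma binomial_tail (m : nat) (L : R) : 0 < L -> (0 < m)%N ->
  \sum_(p < m.+1 | L ^+ 2 * m%:R < (2 * p%:R - m%:R) ^+ 2) 'C(m, p)%:R <= 2 ^+ m / L ^+ 2 :> R.
Proof.
move=> L0 m0; have mR : (0 : R) < m%:R by rewrite ltr0n.
have Lm : 0 < L ^+ 2 * m%:R by rewrite mulr_gt0 ?exprn_gt0.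
rewrite -(ler_pM2l Lm) mulr_sumr.
have -> : L ^+ 2 * m%:R * (2 ^+ m / L ^+ 2) = m%:R * 2 ^+ m.
  by field; rewrite lt0r_neq0.
rewrite -binomial_variance [leLHS]big_mkcond; apply: ler_sum => p _.
case: ifP => [tail|_]; last by rewrite mulr_ge0 // sqr_ge0.
by rewrite mulrC ler_wpM2l // ltW.
Qed.

End Binomial.

(** * Antichains in a two-dimensional grid *)

Lemma shifted_diff_bound (p q M H : nat) :
  (2 * p <= M + H)%N -> (M <= 2 * p + H)%N -> (2 * q <= M + H)%N -> (M <= 2 * q + H)%N ->
  (q <= p + H)%N /\ (p + H - q <= 2 * H)%N.
Proof. lia. Qed.

Lemma shifted_diff_eq (p q p' q' H : nat) : (p <= p')%N -> (q <= p + H)%N -> (q' <= p' + H)%N ->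
  (p + H - q)%N = (p' + H - q')%N -> (q <= q')%N.
Proof. lia. Qed.

Lemma shifted_diff_mono (p q p' q' H : nat) : (p' <= p)%N -> (q <= q')%N ->
  (p + H - q < p' + H - q')%N = false.
Proof. lia. Qed.

Lemma shifted_diff_gap (p q p' q' H D : nat) : (p < p')%N -> (q' < q)%N ->
  (q <= p + H)%N -> (q' <= p' + H)%N -> (p' + H - q' < p + H - q + D)%N ->
  (p' - p < D)%N /\ (q - q' < D)%N.
Proof. lia. Qed.

Section GridAntichain.
Variables (R : realType) (k : nat) (S : set 'rV[R]_k) (P v1 v2 : 'rV[R]_k) (M : nat).
Hypothesis cS : convex_position S.
Hypothesis ind : forall c d, c *: v1 + d *: v2 = 0 -> c = 0 /\ d = 0.
Hypothesis M0 : (0 < M)%N.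
Let grid := ('I_M.+1 * 'I_M.+1)%type.
Variable T : {set grid}.
Hypothesis aT : forall s t : grid, s \in T -> t \in T ->
  (s.1 <= t.1)%N -> (s.2 <= t.2)%N -> s = t.
Hypothesis TS : forall s : grid, s \in T -> S (P + s.1%:R *: v1 + s.2%:R *: v2).

Lemma grid_fst_inj (s t : grid) : s \in T -> t \in T -> s.1 = t.1 -> s = t.
Proof.
move=> sT tT e; have [st|/ltnW ts] := leqP s.2 t.2; first by apply: aT; rewrite // e.
by apply/esym/aT; rewrite // e.
Qed.

Lemma grid_snd_inj (s t : grid) : s \in T -> t \in T -> s.2 = t.2 -> s = t.
Proof.
move=> sT tT e; have [st|/ltnW ts] := leqP s.1 t.1; first by apply: aT; rewrite // e.
by apply/esym/aT; rewrite // e.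
Qed.

(** Three points with the same gap would give three pairs of points of [S] that differ by
    [a v1 - b v2]; their first coordinates are distinct because [T] is an antichain. *)
Lemma gap_at_most_two (A : {set grid}) (a b : nat) : (0 < a)%N -> (0 < b)%N ->
  (forall s, s \in A -> s \in T /\ exists2 t : grid, t \in T & t.1 = (s.1 + a)%N :> nat /\ s.2 = (t.2 + b)%N :> nat) ->
  (#|A| <= 2)%N.
Proof.
move=> a0 b0 HA; rewrite leqNgt; apply/negP => /card_gt2P[x [y [z [[xA yA zA] [xy yz zx]]]]].
pose f (i : 'I_3) : grid := nth x [:: x; y; z] i.
have fA i : f i \in A by case: i => -[|[|[|]]].
have f_inj i j : (f i).1 = (f j).1 -> i = j.
  have [iT _] := HA _ (fA i); have [jT _] := HA _ (fA j).
  move=> /(grid_fst_inj iT jT) e; apply: val_inj.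
  case: i j e {iT jT} => -[|[|[|//]]] Hi [[|[|[|//]]] Hj] //= e.
  - by move: e; rewrite /f /= => e; rewrite e eqxx in xy.
  - by move: e; rewrite /f /= => e; rewrite e eqxx in zx.
  - by move: e; rewrite /f /= => e; rewrite e eqxx in xy.
  - by move: e; rewrite /f /= => e; rewrite e eqxx in yz.
  - by move: e; rewrite /f /= => e; rewrite e eqxx in zx.
  - by move: e; rewrite /f /= => e; rewrite e eqxx in yz.
apply: (@no_three_translates R k S cS P v1 v2 a%:R b%:R
  (fun i => (f i).1%:R) (fun i => (f i).2%:R) ind); rewrite ?ltr0n //.
- by move=> i; apply: TS; have [] := HA _ (fA i).
- move=> i; have [_ [t tT [t1 t2]]] := HA _ (fA i).
  by have := TS tT; rewrite t1 t2 !natrD addrK.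
- by move=> i j /eqP; rewrite eqr_nat => /eqP e; apply: f_inj; apply: val_inj.
Qed.

Variables (L : R) (D : nat).
Hypothesis L0 : 0 < L.
Hypothesis D0 : (0 < D)%N.

Let tail (p : nat) := L ^+ 2 * M%:R < (2 * p%:R - M%:R) ^+ 2.
Let cM : R := 2 ^+ M / Num.sqrt M%:R.
Let sM : R := Num.sqrt M%:R.

Let sM0 : 0 < sM. Proof. by rewrite sqrtr_gt0 ltr0n. Qed.

Let bin_cM p : 'C(M, p)%:R <= cM.
Proof. by apply: le_trans (central_bin_le_weak R M0); rewrite ler_nat bin_le_half. Qed.

Let cM0 : 0 <= cM. Proof. by rewrite divr_ge0 // ?exprn_ge0 // ltW. Qed.

Let Wd := [set s in T | ~~ tail s.1 && ~~ tail s.2].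
Let Hn := (Num.truncn (L * sM)).+1.

Lemma window_width p : ~~ tail p -> (2 * p <= M + Hn)%N && (M <= 2 * p + Hn)%N.
Proof.
rewrite /tail -leNgt => H.
have LH : L * sM <= Hn%:R by rewrite ltW // truncnS_gt.
have : `|2 * p%:R - M%:R| <= L * sM.
  rewrite -ler_sqr ?nnegrE // ?mulr_ge0 ?(ltW L0) ?(ltW sM0) //.
  by rewrite real_normK ?num_real // exprMn sqr_sqrtr.
rewrite ler_norml => /andP[h1 h2].
rewrite -!(ler_nat R) [(_ + Hn)%:R]natrD [X in _ && (_ <= X)]natrD natrM; apply/andP; split; lra.
Qed.

(* Cut the range of [s.1 - s.2] into blocks of length [D]: a point which is not the
   last of its block is followed by a short gap, and each gap occurs at most twice. *)
Lemma window_card : (#|Wd| <= 2 * D ^ 2 + (2 * Hn) %/ D + 1)%N.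
Proof.
(* The offset [Hn] keeps the truncated difference exact on the window. *)
pose h (s : grid) := (s.1 + Hn - s.2)%N.
have hle s : s \in Wd -> (s.2 <= s.1 + Hn)%N /\ (h s <= 2 * Hn)%N.
  rewrite inE => /and3P[_ /window_width/andP[a1 a2] /window_width/andP[b1 b2]].
  exact: shifted_diff_bound a1 a2 b1 b2.
have WT s : s \in Wd -> s \in T by rewrite inE => /andP[].
pose follow (s t : grid) := [&& t \in Wd, (h s < h t)%N & (h t %/ D == h s %/ D)%N].
pose A := [set s in Wd | [exists t, follow s t]].
pose Bk := Wd :\: A.
have WAB : (#|Wd| <= #|A| + #|Bk|)%N.
  by rewrite -(cardsID A Wd) leq_add2r; apply/subset_leq_card/finset.subsetIr.
have cB : (#|Bk| <= (2 * Hn) %/ D + 1)%N.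
  pose f (s : grid) : 'I_((2 * Hn) %/ D).+1 := inord (h s %/ D).
  have hb s : s \in Wd -> (h s %/ D < ((2 * Hn) %/ D).+1)%N.
    by move=> /hle[_ ?]; rewrite ltnS leq_div2r.
  have fi : {in Bk &, injective f}.
    move=> s t; rewrite !finset.in_setD => /andP[sA sW] /andP[tA tW] /(congr1 val).
    rewrite /= !inordK ?hb // => e.
    have nf s' t' : s' \in Wd -> s' \notin A -> t' \in Wd -> (h t' %/ D = h s' %/ D)%N -> (h t' <= h s')%N.
      move=> s'W s'A t'W e'; rewrite leqNgt; apply: contra s'A => lt.
      by rewrite inE s'W; apply/existsP; exists t'; rewrite /follow t'W lt e' eqxx.
    have hst : h s = h t by apply/eqP; rewrite eqn_leq (nf t s) // (nf s t).
    have [hs _] := hle s sW; have [ht _] := hle t tW.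
    have [st|/ltnW ts] := leqP s.1 t.1.
      by apply: aT; rewrite ?WT //; apply: shifted_diff_eq st hs ht hst.
    by apply/esym/aT; rewrite ?WT //; apply: shifted_diff_eq ts ht hs (esym hst).
  by rewrite -(card_in_imset fi) (leq_trans (max_card _)) // card_ord addn1.
have cA : (#|A| <= 2 * D ^ 2)%N.
  pose nx s : grid := odflt s [pick t | follow s t].
  have nxP s : s \in A -> follow s (nx s).
    rewrite inE => /andP[_ /existsP[t st]]; rewrite /nx; case: pickP => //= /(_ t).
    by rewrite st.
  pose f s : 'I_D.-1.+1 * 'I_D.-1.+1 := (inord ((nx s).1 - s.1), inord (s.2 - (nx s).2)).
  have gap s : s \in A -> [/\ (s.1 < (nx s).1)%N, ((nx s).2 < s.2)%N,
      ((nx s).1 - s.1 < D)%N & (s.2 - (nx s).2 < D)%N].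
    move=> sA; have /and3P[tW lt /eqP e] := nxP s sA.
    have sW : s \in Wd by move: sA; rewrite inE => /andP[].
    have [hs _] := hle s sW; have [ht _] := hle _ tW.
    have lD : (h (nx s) < h s + D)%N.
      rewrite (divn_eq (h (nx s)) D) (divn_eq (h s) D) e.
      by rewrite -addnA ltn_add2l (leq_trans (ltn_pmod _ D0)) // leq_addl.
    have s12 : (s.1 < (nx s).1)%N.
      rewrite ltnNge; apply/negP => le1; have [le2|/ltnW le2] := leqP (nx s).2 s.2.
        have e1 := aT (WT _ tW) (WT _ sW) le1 le2; by rewrite e1 ltnn in lt.
      by rewrite /h shifted_diff_mono in lt.
    have s21 : ((nx s).2 < s.2)%N.
      rewrite ltnNge; apply/negP => le2.
      have e1 := aT (WT _ sW) (WT _ tW) (ltnW s12) le2.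
      by rewrite {1}e1 ltnn in s12.
    by have [] := shifted_diff_gap s12 s21 hs ht lD.
  rewrite -sum1_card (partition_big f xpredT) //=.
  apply: leq_trans (_ : \sum_(d : 'I_D.-1.+1 * 'I_D.-1.+1) 2 <= _)%N; last first.
    by rewrite sum_nat_const card_prod card_ord prednK // mulnC.
  apply: leq_sum => d _; rewrite sum1dep_card.
  set Ad := [set s | _].
  have [->|[s0]] := finset.set_0Vmem Ad; first by rewrite cards0.
  rewrite inE => /andP[s0A /eqP fs0]; have [g1 g2 g3 g4] := gap s0 s0A.
  have d1 : d.1 = ((nx s0).1 - s0.1)%N :> nat by rewrite -fs0 /= inordK // prednK.
  have d2 : d.2 = (s0.2 - (nx s0).2)%N :> nat by rewrite -fs0 /= inordK // prednK.
  apply: (@gap_at_most_two Ad d.1 d.2); rewrite ?d1 ?d2 ?subn_gt0 //.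
  move=> s; rewrite inE => /andP[sA /eqP fs]; have [k1 k2 k3 k4] := gap s sA.
  have e1 : d.1 = ((nx s).1 - s.1)%N :> nat by rewrite -fs /= inordK // prednK.
  have e2 : d.2 = (s.2 - (nx s).2)%N :> nat by rewrite -fs /= inordK // prednK.
  split; first by apply: WT; move: sA; rewrite inE => /andP[].
  exists (nx s); first by have /and3P[/WT] := nxP s sA.
  by rewrite -d1 -d2 e1 e2 !subnKC // ltnW.
by apply: leq_trans WAB _; rewrite -addnA leq_add.
Qed.

(** [T] projects injectively to either coordinate, so in the tails Chebyshev's inequality for one
    factor and the central bound for the other suffice. In the window each term is at most [cM ^ 2],
    and there are few terms. The sum is small for [L], then [D], then [M] large. *)
Lemma grid_mass : \sum_(s in T) 'C(M, s.1)%:R * 'C(M, s.2)%:R <=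
  2 ^+ (M + M) / sM * (2 / L ^+ 2 + ((2 * D%:R ^+ 2 + 1 + 2 / D%:R) / sM + 2 * L / D%:R)).
Proof.
have tail1 : \sum_(s in T | tail s.1) 'C(M, s.1)%:R * 'C(M, s.2)%:R <= cM * (2 ^+ M / L ^+ 2).
  apply: (@le_trans _ _ (\sum_(s in T | tail s.1) 'C(M, s.1)%:R * cM)).
    by apply: ler_sum => s _; rewrite ler_wpM2l.
  rewrite -mulr_suml mulrC ler_wpM2l //; apply: le_trans (binomial_tail L0 M0).
  rewrite (eq_bigl (mem [set s in T | tail s.1])); last by move=> s; rewrite !inE.
  rewrite -(big_imset (fun p : 'I_M.+1 => 'C(M, p)%:R)) /=; last first.
    by move=> s t; rewrite !inE => /andP[sT _] /andP[tT _]; exact: grid_fst_inj.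
  rewrite big_mkcond [leRHS]big_mkcond; apply: ler_sum => p _ /=.
  case: ifP => [/finset.imsetP[s + ->]|_]; last by case: ifP.
  by rewrite inE => /andP[_]; rewrite /tail => ->.
have tail2 : \sum_(s in T | tail s.2) 'C(M, s.1)%:R * 'C(M, s.2)%:R <= cM * (2 ^+ M / L ^+ 2).
  apply: (@le_trans _ _ (\sum_(s in T | tail s.2) cM * 'C(M, s.2)%:R)).
    by apply: ler_sum => s _; rewrite ler_wpM2r.
  rewrite -mulr_sumr ler_wpM2l //; apply: le_trans (binomial_tail L0 M0).
  rewrite (eq_bigl (mem [set s in T | tail s.2])); last by move=> s; rewrite !inE.
  rewrite -(big_imset (fun p : 'I_M.+1 => 'C(M, p)%:R)) /=; last first.
    by move=> s t; rewrite !inE => /andP[sT _] /andP[tT _]; exact: grid_snd_inj.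
  rewrite big_mkcond [leRHS]big_mkcond; apply: ler_sum => p _ /=.
  case: ifP => [/finset.imsetP[s + ->]|_]; last by case: ifP.
  by rewrite inE => /andP[_]; rewrite /tail => ->.
have win : \sum_(s in Wd) 'C(M, s.1)%:R * 'C(M, s.2)%:R <= cM * cM * (2 * D%:R ^+ 2 + 2 * Hn%:R / D%:R + 1).
  apply: (@le_trans _ _ (\sum_(s in Wd) cM * cM)).
    by apply: ler_sum => s _; apply: ler_pM.
  rewrite sumr_const -[leLHS]mulr_natr ler_wpM2l ?mulr_ge0 //.
  have := window_card; rewrite -(ler_nat R) => /le_trans; apply.
  have -> : (2 * D ^ 2 + (2 * Hn) %/ D + 1)%:R = 2 * D%:R ^+ 2 + ((2 * Hn) %/ D)%:R + 1 :> R.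
    by rewrite -natrX -natrM -natrD natr1 addn1.
  rewrite lerD2r lerD2l ler_pdivlMr ?ltr0n // -!natrM ler_nat.
  exact: leq_trunc_div.
have split3 : \sum_(s in T) 'C(M, s.1)%:R * 'C(M, s.2)%:R <=
    \sum_(s in T | tail s.1) 'C(M, s.1)%:R * 'C(M, s.2)%:R +
    \sum_(s in T | tail s.2) 'C(M, s.1)%:R * 'C(M, s.2)%:R +
    \sum_(s in Wd) 'C(M, s.1)%:R * 'C(M, s.2)%:R :> R.
  rewrite [leLHS]big_mkcond [X in _ <= X + _ + _]big_mkcond [X in _ <= _ + X + _]big_mkcond.
  rewrite [X in _ <= _ + _ + X]big_mkcond -!big_split; apply: ler_sum => s _ /=.
  have z : 0 <= 'C(M, s.1)%:R * 'C(M, s.2)%:R :> R by rewrite mulr_ge0.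
  rewrite inE; case: (s \in T); case: (tail s.1); case: (tail s.2); rewrite /= ?addr0 ?add0r //.
  by rewrite lerDl.
apply: le_trans split3 _; apply: le_trans (lerD (lerD tail1 tail2) win) _.
have Dp : (0 : R) < D%:R by rewrite ltr0n.
have LH : Hn%:R <= L * sM + 1.
  by rewrite -natr1 lerD2r truncn_le // mulr_ge0 // ltW.
have cMc : cM * cM = 2 ^+ (M + M) / sM / sM by rewrite /cM -/sM exprD; field; rewrite lt0r_neq0.
have cML : cM * (2 ^+ M / L ^+ 2) = 2 ^+ (M + M) / sM * (1 / L ^+ 2).
  by rewrite /cM -/sM exprD; field; rewrite !lt0r_neq0.
rewrite cMc cML.
have X0 : 0 < 2 ^+ (M + M) / sM by rewrite divr_gt0 // exprn_gt0.
move: (2 ^+ (M + M) / sM) X0 => X X0.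
apply: (@le_trans _ _ (X * (1 / L ^+ 2) + X * (1 / L ^+ 2) +
    X / sM * (2 * D%:R ^+ 2 + 2 * (L * sM + 1) / D%:R + 1))).
  rewrite lerD2l ler_wpM2l ?divr_ge0 ?(ltW X0) ?(ltW sM0) // lerD2r lerD2l.
  by rewrite ler_wpM2r ?invr_ge0 ?(ltW Dp) // ler_wpM2l.
rewrite le_eqVlt; apply/orP; left; apply/eqP.
by move: (D%:R : R) Dp sM sM0 => d d0 s s0; field; rewrite !lt0r_neq0.
Qed.

End GridAntichain.

(** * From two repeated directions to the grid *)

Lemma subset_sum_two_classes (R : realType) (k : nat) (I : finType) (w : I -> 'rV[R]_k) p
    (B X : {set I}) v1 v2 :
  (forall i, i \in B -> w i = v1) -> (forall i, i \notin B -> w i = v2) ->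
  subset_sum w p X = p + #|X :&: B|%:R *: v1 + #|X :\: B|%:R *: v2.
Proof.
move=> wB wC; rewrite /subset_sum (finset.big_setID B) /= -addrA; congr (_ + (_ + _)).
  rewrite (eq_bigr (fun=> v1)) ?sumr_const ?scaler_nat // => i.
  by rewrite inE => /andP[_ /wB].
rewrite (eq_bigr (fun=> v2)) ?sumr_const ?scaler_nat // => i.
by rewrite inE => /andP[/wC].
Qed.

Lemma card_two_sizes (I : finType) (B : {set I}) (a b : nat) :
  (#|[set X : {set I} | (#|X :&: B| == a) && (#|X :\: B| == b)]| <=
    'C(#|B|, a) * 'C(#|~: B|, b))%N.
Proof.
rewrite -!cards_draws -cardsX.
pose f (X : {set I}) := (X :&: B, X :\: B).
have fi : injective f.
  by move=> X Y [e1 e2]; rewrite -(setID X B) -(setID Y B) e1 e2.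
rewrite -(card_imset _ fi); apply/subset_leq_card/fintype.subsetP => _ /finset.imsetP[X + ->].
rewrite !inE /= => /andP[-> ->]; rewrite finset.subsetIr !andbT /=.
by apply/fintype.subsetP => x; rewrite !inE => /andP[].
Qed.

(** A sum depends only on how many elements the subset has inside and outside [B]; orientation makes
    the pairs of sizes that occur an antichain of the grid. *)
Lemma oriented_two_classes (R : realType) (k : nat) (eps : R) : 0 < eps ->
  exists M0 : nat, forall (I : finType) (w : I -> 'rV[R]_k) p (S : set 'rV[R]_k)
    (F : {set {set I}}) (B : {set I}) v1 v2 M,
  (M0 <= M)%N -> #|B| = M -> #|~: B| = M -> convex_position S ->
  (forall c d, c *: v1 + d *: v2 = 0 -> c = 0 /\ d = 0) ->
  (forall i, i \in B -> w i = v1) -> (forall i, i \notin B -> w i = v2) ->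
  (forall X, X \in F -> S (subset_sum w p X)) -> oriented w p F ->
  #|F|%:R <= eps * (2 ^+ #|I| / Num.sqrt M%:R).
Proof.
move=> e0.
(* [L], [D] and [Q] make each of the three terms of [grid_mass] at most [eps / 3], the last one as
   soon as [sqrt M >= Q]. *)
pose L := Num.sqrt (6 / eps).
have L0 : 0 < L by rewrite sqrtr_gt0 divr_gt0.
pose D := (Num.truncn (6 * L / eps)).+1.
have D0 : (0 : R) < D%:R by rewrite ltr0n.
pose Q : R := 3 * (2 * D%:R ^+ 2 + 3) / eps.
have Q0 : 0 < Q by rewrite divr_gt0 // mulr_gt0 // ltr_wpDl // mulr_ge0 // sqr_ge0.
exists (Num.truncn (Q ^+ 2)).+1 => I w p S F B v1 v2 M M0M BM CM cS ind wB wC FS oF.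
have M0 : (0 < M)%N by exact: leq_trans M0M.
have MQ : Q <= Num.sqrt M%:R.
  rewrite -ler_sqr ?nnegrE ?sqrtr_ge0 ?(ltW Q0) // sqr_sqrtr //.
  apply: le_trans (_ : (Num.truncn (Q ^+ 2)).+1%:R <= _); last by rewrite ler_nat.
  by rewrite ltW // truncnS_gt.
pose grid := ('I_M.+1 * 'I_M.+1)%type.
pose T := [set s : grid | [exists X in F, (#|X :&: B| == s.1) && (#|X :\: B| == s.2)]].
have sE X := @subset_sum_two_classes R k I w p B X v1 v2 wB wC.
have card1 X : (#|X :&: B| < M.+1)%N by rewrite ltnS -BM subset_leq_card // finset.subsetIr.
have card2 X : (#|X :\: B| < M.+1)%N.
  rewrite ltnS -CM subset_leq_card //; apply/fintype.subsetP => x.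
  by rewrite !inE => /andP[].
have TS (s : grid) : s \in T -> S (p + s.1%:R *: v1 + s.2%:R *: v2).
  rewrite inE => /existsP[X /and3P[XF /eqP <- /eqP <-]].
  by rewrite -sE; exact: FS.
have aT (s t : grid) : s \in T -> t \in T -> (s.1 <= t.1)%N -> (s.2 <= t.2)%N -> s = t.
  rewrite !inE => /existsP[X /and3P[XF /eqP X1 /eqP X2]] /existsP[Y /and3P[YF /eqP Y1 /eqP Y2]] l1 l2.
  have [u [uw uF]] := oF X XF.
  have uB : (0 < M)%N -> 0 < dot u v1.
    rewrite -BM => /card_gt0P[i iB]; by rewrite -(wB i iB).
  have uC : (0 < M)%N -> 0 < dot u v2.
    rewrite -CM => /card_gt0P[i]; rewrite inE => iB; by rewrite -(wC i iB).
  have du : dot u (subset_sum w p Y) - dot u (subset_sum w p X) =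
      (t.1%:R - s.1%:R) * dot u v1 + (t.2%:R - s.2%:R) * dot u v2.
    by rewrite !sE X1 X2 Y1 Y2 !dotDr !dotZr; ring.
  have g1 : 0 <= t.1%:R - s.1%:R :> R by rewrite subr_ge0 ler_nat.
  have g2 : 0 <= t.2%:R - s.2%:R :> R by rewrite subr_ge0 ler_nat.
  have h1 := mulr_ge0 g1 (ltW (uB M0)); have h2 := mulr_ge0 g2 (ltW (uC M0)).
  have eXY : subset_sum w p Y = subset_sum w p X.
    apply/eqP/negPn/negP => ne; have := uF Y YF ne.
    by rewrite -subr_lt0 du ltNge addr_ge0.
  move: du; rewrite eXY subrr => /esym/eqP; rewrite paddr_eq0 // !mulf_eq0.
  rewrite (gt_eqF (uB M0)) (gt_eqF (uC M0)) !orbF !subr_eq0 !eqr_nat => /andP[/eqP e1 /eqP e2].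
  by case: s t e1 e2 {l1 l2 X1 X2 Y1 Y2 g1 g2 h1 h2} => s1 s2 [t1 t2] /= e1 e2; congr (_, _); apply: val_inj.
have cF : #|F|%:R <= \sum_(s in T) 'C(M, s.1)%:R * 'C(M, s.2)%:R :> R.
  pose cl (X : {set I}) : grid := (inord #|X :&: B|, inord #|X :\: B|).
  rewrite -sum1_card natr_sum (partition_big cl (mem T)) /=; last first.
    move=> X XF; rewrite inE; apply/existsP; exists X.
    by rewrite XF /= !inordK ?eqxx.
  apply: ler_sum => s _; rewrite -natr_sum sum1dep_card -natrM ler_nat.
  have := card_two_sizes B s.1 s.2; rewrite BM CM; apply: leq_trans.
  apply/subset_leq_card/fintype.subsetP => X; rewrite !inE => /andP[_ /eqP <-].
  by rewrite /= !inordK ?eqxx.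
apply: le_trans cF _.
apply: le_trans (@grid_mass R k S p v1 v2 M cS ind M0 T aT TS L D L0 _) _ => //.
rewrite -(cardsC B) BM CM mulrC ler_wpM2r ?divr_ge0 ?exprn_ge0 ?sqrtr_ge0 //.
have sM0 : 0 < Num.sqrt M%:R :> R by rewrite sqrtr_gt0 ltr0n.
have b1 : 2 / L ^+ 2 = eps / 3.
  rewrite /L sqr_sqrtr ?divr_ge0 ?(ltW e0) //; field.
  by rewrite lt0r_neq0.
have b2 : 2 * L / D%:R <= eps / 3.
  have : 6 * L / eps <= D%:R by rewrite ltW // truncnS_gt.
  rewrite ler_pdivrMr // => h; rewrite ler_pdivrMr //; lra.
have b3 : (2 * D%:R ^+ 2 + 1 + 2 / D%:R) / Num.sqrt M%:R <= eps / 3.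
  rewrite ler_pdivrMr //.
  have D1 : 2 / D%:R <= 2 :> R by rewrite ler_pdivrMr // ler_peMr // ler1n.
  have : eps / 3 * Q <= eps / 3 * Num.sqrt M%:R by rewrite ler_wpM2l // divr_ge0 // ltW.
  rewrite (_ : eps / 3 * Q = 2 * D%:R ^+ 2 + 3); first by lra.
  by rewrite /Q; field; rewrite lt0r_neq0.
lra.
Qed.

(** The directions fall into four classes by their signs on [v1] and [v2]; the hits of one class can
    be oriented together, hence the [eps / 4]. *)
Lemma two_classes_bound (R : realType) (k : nat) (eps : R) : 0 < eps ->
  exists M0 : nat, forall (I : finType) (w : I -> 'rV[R]_k) p (S : set 'rV[R]_k)
    (F : {set {set I}}) (B : {set I}) v1 v2 M,
  (M0 <= M)%N -> #|B| = M -> #|~: B| = M -> convex_position S ->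
  (forall c d, c *: v1 + d *: v2 = 0 -> c = 0 /\ d = 0) ->
  (forall i, i \in B -> w i = v1 \/ w i = - v1) ->
  (forall i, i \notin B -> w i = v2 \/ w i = - v2) ->
  (forall X, X \in F -> S (subset_sum w p X)) ->
  #|F|%:R <= eps * (2 ^+ #|I| / Num.sqrt M%:R).
Proof.
move=> e0; have e40 : 0 < eps / 4 by rewrite divr_gt0.
have [M0 HM] := @oriented_two_classes R k _ e40.
exists M0.+1 => I w p S F B v1 v2 M M0M BM CM cS ind wB wC FS.
have Mp : (0 < M)%N by exact: leq_trans M0M.
have v10 : v1 != 0.
  apply/eqP => e; have := ind 1 0; rewrite e scaler0 scale0r addr0 => /(_ erefl)[/eqP].
  by rewrite oner_eq0.
have v20 : v2 != 0.
  apply/eqP => e; have := ind 0 1; rewrite e scaler0 scale0r addr0 => /(_ erefl)[_ /eqP].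
  by rewrite oner_eq0.
have w0 i : w i != 0.
  by have [/wB[]|/wC[]] := boolP (i \in B) => ->; rewrite ?oppr_eq0.
have [U [U0 Us]] := exposing_directions cS w0 FS.
pose cl X := (0 < dot (U X) v1, 0 < dot (U X) v2).
have [i1 i1B] : exists i, i \in B by apply/card_gt0P; rewrite BM.
have [i2 i2B] : exists i, i \in ~: B by apply/card_gt0P; rewrite CM.
rewrite inE in i2B.
have Uv1 X : X \in F -> dot (U X) v1 != 0.
  by move=> XF; have := U0 X i1 XF; case: (wB i1 i1B) => ->; rewrite ?dotNr ?oppr_eq0.
have Uv2 X : X \in F -> dot (U X) v2 != 0.
  by move=> XF; have := U0 X i2 XF; case: (wC i2 i2B) => ->; rewrite ?dotNr ?oppr_eq0.
have same (x y : R) : x != 0 -> y != 0 -> (0 < x) = (0 < y) -> 0 < x * y.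
  rewrite !neq_lt => /orP[xn|xp] /orP[yn|yp].
  - by rewrite nmulr_rgt0.
  - by rewrite yp ltNge (ltW xn).
  - by rewrite xp => /esym; rewrite ltNge (ltW yn).
  - by rewrite mulr_gt0.
have cell c : #|[set X in F | cl X == c]|%:R <= eps / 4 * (2 ^+ #|I| / Num.sqrt M%:R).
  set Fc := [set X in F | _].
  have FcF X : X \in Fc -> X \in F by rewrite inE => /andP[].
  have [||X Y i XFc YFc|w' [p' [F' [<- w'w w'e F'F oF']]]] := @orientation R k I w p Fc U.
  - by move=> X i /FcF; exact: U0.
  - by move=> X Y /FcF XF /FcF YF; exact: Us.
  - have XF := FcF _ XFc; have YF := FcF _ YFc.
    have : cl X = cl Y by move: XFc YFc; rewrite !inE => /andP[_ /eqP ->] /andP[_ /eqP ->].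
    move=> [c1 c2]; have [/wB[]|/wC[]] := boolP (i \in B) => ->; rewrite ?dotNr ?mulrNN; apply: same; auto.
  have [F'0|[X0 X0F']] := finset.set_0Vmem F'.
    by rewrite F'0 cards0 mulr_ge0 ?(ltW e40) // divr_ge0 ?exprn_ge0 ?sqrtr_ge0.
  have [u [uw _]] := oF' X0 X0F'.
  (* One direction is positive on all oriented steps, so the steps over [B] are all [v1] or all
     [- v1]. *)
  have [s1 s1E] : exists s1 : bool, forall i, i \in B -> w' i = (-1) ^+ s1 *: v1.
    exists (dot u v1 < 0) => i iB; have := uw i.
    have [->|->] : w' i = v1 \/ w' i = - v1.
      by case: (w'w i) => ->; case: (wB i iB) => ->; rewrite ?opprK; auto.
    - by move=> up; rewrite ltNge (ltW up) expr0 scale1r.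
    - by rewrite dotNr oppr_gt0 => un; rewrite un expr1 scaleN1r.
  have [s2 s2E] : exists s2 : bool, forall i, i \notin B -> w' i = (-1) ^+ s2 *: v2.
    exists (dot u v2 < 0) => i iB; have := uw i.
    have [->|->] : w' i = v2 \/ w' i = - v2.
      by case: (w'w i) => ->; case: (wC i iB) => ->; rewrite ?opprK; auto.
    - by move=> up; rewrite ltNge (ltW up) expr0 scale1r.
    - by rewrite dotNr oppr_gt0 => un; rewrite un expr1 scaleN1r.
  apply: (HM I w' p' S F' B _ _ M (ltnW M0M) BM CM cS _ s1E s2E _ oF').
    move=> x y; rewrite !scalerA => /ind[] /eqP; rewrite mulf_eq0 signr_eq0 orbF => /eqP ->.
    by move=> /eqP; rewrite mulf_eq0 signr_eq0 orbF => /eqP ->.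
  by move=> X /F'F[Y /FcF YF ->]; exact: FS.
have -> : #|F|%:R = \sum_(c : bool * bool) #|[set X in F | cl X == c]|%:R :> R.
  rewrite -natr_sum -sum1_card (partition_big cl xpredT) //=.
  by congr (_%:R); apply: eq_bigr => q _; rewrite sum1dep_card; apply: eq_card => X; rewrite !inE.
apply: le_trans (ler_sum _ (fun c _ => cell c)) _.
rewrite sumr_const card_prod card_bool -[leLHS]mulr_natl mulrA.
by rewrite (_ : _ * (eps / 4) = eps) //; field.
Qed.

(** * The counting theorem *)

Section Counting.
Variables (R : realType) (k : nat) (S : set 'rV[R]_k).
Hypothesis cS : convex_position S.

Lemma fiber_bound (I : finType) (w : I -> 'rV[R]_k) p (F : {set {set I}}) (G : {set I}) (b : R) :
  (forall X, X \in F -> S (subset_sum w p X)) ->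
  (forall p' (F' : {set {set {x | x \in G}}}),
    (forall Z, Z \in F' -> S (subset_sum (fun z => w (val z)) p' Z)) -> #|F'|%:R <= b) ->
  #|F|%:R <= 2 ^+ (#|I| - #|G|) * b.
Proof.
move=> FS Hb; apply: card_fibers => Y YG; apply: (Hb (p + \sum_(i in Y) w i)) => Z.
by rewrite inE => /FS; rewrite /subset_sum sum_fiber // addrA.
Qed.

(** The sign of the exposing direction on [v] splits the hits into two classes. Each class can be
    oriented as a whole, becomes an antichain and falls under Sperner's theorem. *)
Lemma collinear_bound (I : finType) (w : I -> 'rV[R]_k) p (F : {set {set I}}) (v : 'rV[R]_k) :
  (forall i, w i != 0) -> (forall i, (w i <= v)%MS) ->
  (forall X, X \in F -> S (subset_sum w p X)) ->
  (#|F| <= 2 * 'C(#|I|, #|I|./2))%N.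
Proof.
move=> w0 wv FS.
have [U [U0 Us]] := exposing_directions cS w0 FS.
pose cl X := 0 < dot (U X) v.
have cell c : (#|[set X in F | cl X == c]| <= 'C(#|I|, #|I|./2))%N.
  set Fc := [set X in F | _].
  have FcF X : X \in Fc -> X \in F by rewrite inE => /andP[].
  have [||X Y i XFc YFc|w' [p' [F' [<- _ _ _ oF']]]] := @orientation R k I w p Fc U.
  - by move=> X i /FcF; exact: U0.
  - by move=> X Y /FcF XF /FcF YF; exact: Us.
  - have XF := FcF _ XFc; have YF := FcF _ YFc.
    have e : cl X = cl Y by move: XFc YFc; rewrite !inE => /andP[_ /eqP ->] /andP[_ /eqP ->].
    have /sub_rVP[a wE] := wv i; have := U0 X i XF; have := U0 Y i YF.
    rewrite wE !dotZr !mulf_eq0 !negb_or => /andP[a0 Yv] /andP[_ Xv].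
    rewrite mulrACA mulr_gt0 //; first by rewrite -expr2 exprn_even_gt0.
    move: e; rewrite /cl; have [yp|yn] := ltP 0 (dot (U Y) v).
      by move=> xp; rewrite mulr_gt0.
    move=> /negbT; rewrite -leNgt => xn.
    by rewrite nmulr_rgt0 lt_neqAle ?Xv ?Yv.
  exact: (sperner R (oriented_antichain oF')).
rewrite -sum1_card (partition_big cl xpredT) //= big_bool /= mul2n -addnn.
apply: leq_add; rewrite sum1dep_card.
  by apply: leq_trans (cell true); apply: subset_leq_card; apply/fintype.subsetP => X; rewrite !inE.
by apply: leq_trans (cell false); apply: subset_leq_card; apply/fintype.subsetP => X; rewrite !inE.
Qed.

End Counting.

Lemma subset_of_card (I : finType) (A : {set I}) (m : nat) : (m <= #|A|)%N ->
  exists2 B : {set I}, B \subset A & #|B| = m.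
Proof.
rewrite -bin_gt0 -cards_draws => /card_gt0P[B]; rewrite inE => /andP[BA /eqP Bm].
by exists B.
Qed.

Lemma counting_bound (R : realType) (k : nat) (eps : R) : 0 < eps ->
  exists n0 : nat, forall (I : finType) (w : I -> 'rV[R]_k) p (S : set 'rV[R]_k)
    (F : {set {set I}}), (n0 <= #|I|)%N -> convex_position S -> (forall i, w i != 0) ->
  (forall X, X \in F -> S (subset_sum w p X)) ->
  #|F|%:R <= (2 * Num.sqrt (2 / pi) + eps) * (2 ^+ #|I| / Num.sqrt #|I|%:R).
Proof.
move=> e0; pose c : R := 2 * Num.sqrt (2 / pi).
have pi0 := pi_gt0 R.
have c1 : 1 <= c.
  have : 1 / 2 <= Num.sqrt (2 / pi) :> R.
    rewrite -ler_sqr ?nnegrE ?divr_ge0 ?sqrtr_ge0 // sqr_sqrtr ?divr_ge0 ?pi_ge0 //.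
    rewrite ler_pdivlMr //; have := pihalf_lt2 R; move: (pi : R) => P; nra.
  by rewrite /c; lra.
have c2 : c <= 2.
  rewrite /c ler_piMr // -[leRHS]sqrtr1 ler_wsqrtr // ler_pdivrMr // mul1r.
  exact: pi_ge2.
(* Chosen so that [(1 - eta) (1 + eps / 2) ^ 2 = 1]: conditioning down to [(1 - eta) n] indices
   costs a factor [1 + eps / 2], and [c <= 2] turns this into an additive [eps]. *)
pose eta : R := 1 - (1 + eps / 2) ^- 2.
have q0 : 0 < 1 + eps / 2 by lra.
have q1 : (1 + eps / 2) ^- 2 < 1.
  rewrite invf_lt1 ?exprn_gt0 // exprn_egt1 //; lra.
have eta0 : 0 < eta by rewrite subr_gt0.
have eta1 : eta < 1 by rewrite gtrBl invr_gt0 exprn_gt0.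
(* The factor [Num.sqrt eta] compensates for conditioning down to [eta n] indices. *)
have [K K0 HK] := @small_classes_bound R k (Num.sqrt eta) (etrans (sqrtr_gt0 _) eta0).
(* [ka n] bounds from below the sizes of both repeated classes, as the second is found among more
   than [eta n] indices. The factor [Num.sqrt (ka / 2)] compensates for keeping [M >= ka n / 2] of
   each. *)
pose ka := K * eta; have ka0 : 0 < ka by rewrite mulr_gt0.
have [M0 HM] := @two_classes_bound R k (Num.sqrt (ka / 2)) (etrans (sqrtr_gt0 _) (divr_gt0 ka0 (ltr0n R 2))).
exists (Num.truncn ((M0.+1)%:R / ka + 1 / ka)).+1 => I w p S F nI cS w0 FS.
set n := #|I| in nI *.
have n0 : (0 < n)%N by exact: leq_trans nI.
have nR : (0 : R) < n%:R by rewrite ltr0n.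
have sn0 : 0 < Num.sqrt n%:R :> R by rewrite sqrtr_gt0.
have B0 : 0 <= 2 ^+ n / Num.sqrt n%:R :> R by rewrite divr_ge0 ?exprn_ge0 // ltW.
have nbig : M0.+1%:R + 1 <= ka * n%:R.
  have : (M0.+1)%:R / ka + 1 / ka <= n%:R.
    by apply: ltW; apply: lt_le_trans (truncnS_gt _) _; rewrite ler_nat.
  by rewrite -mulrDl ler_pdivrMr // mulrC.
(* As [1 <= c], the constant [1] is enough outside the nearly collinear case. *)
pose B : R := 2 ^+ n / Num.sqrt n%:R.
suff : #|F|%:R <= (c + eps) * B \/ #|F|%:R <= B.
  by case=> [//|le1]; apply: le_trans le1 _; rewrite ler_peMl // (le_trans c1) // lerDl ltW.
rewrite /B {B}.
have fib (G : {set I}) (b : R) (g := #|G|) : (0 < g)%N ->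
    2 ^+ (n - g) * (b * (2 ^+ g / Num.sqrt g%:R)) = b / Num.sqrt g%:R * 2 ^+ n.
  by move=> g0; have gn : (g <= n)%N := max_card (mem G); rewrite -[in RHS](subnK gn) exprD; ring.
have [[v [v0 big]]|noline] := pselect (exists v : 'rV[R]_k, v != 0 /\
    (1 - eta) * n%:R <= #|[set i | (w i <= v)%MS]|%:R).
  left; pose G := [set i | (w i <= v)%MS]; pose g := #|G|.
  have gp : (0 : R) < g%:R by apply: lt_le_trans big; rewrite mulr_gt0 // subr_gt0.
  have g0 : (0 < g)%N by rewrite -(ltr0n R).
  apply: le_trans (fiber_bound (G := G) (b := c * (2 ^+ g / Num.sqrt g%:R)) FS _) _.
    move=> p' F' F'S.
    have := @collinear_bound R k S cS _ (fun z : {x | x \in G} => w (val z)) p' F' v.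
    rewrite card_sub_set -/g => H.
    apply: (@le_trans _ _ (2 * 'C(g, g./2))%:R).
      rewrite ler_nat; apply: H => // z; have := valP z; rewrite inE; exact.
    rewrite natrM /c -mulrA ler_pM2l //; apply: le_trans (central_bin_le R g0) _.
    rewrite le_eqVlt; apply/orP; left; apply/eqP.
    rewrite invfM mulrA sqrtrM ?divr_ge0 ?pi_ge0 // sqrtrV ?(ltW gp) //.
    by rewrite mulrCA.
  rewrite (fib G c g0) mulrCA [leRHS]mulrC ler_wpM2r ?exprn_ge0 //.
  have sg0 : 0 < Num.sqrt g%:R :> R by rewrite sqrtr_gt0.
  rewrite ler_pdivrMr // mulrAC ler_pdivlMr //.
  have h : Num.sqrt n%:R <= (1 + eps / 2) * Num.sqrt g%:R.
    rewrite -ler_sqr ?nnegrE ?mulr_ge0 ?sqrtr_ge0 ?(ltW q0) // exprMn !sqr_sqrtr ?(ltW gp) ?(ltW nR) //.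
    move: big; rewrite /eta opprB addrC subrK -/G -/g mulrC ler_pdivrMr ?exprn_gt0 //.
    by rewrite mulrC.
  apply: (@le_trans _ _ (c * ((1 + eps / 2) * Num.sqrt g%:R))).
    by rewrite ler_wpM2l //; lra.
  rewrite mulrA ler_wpM2r ?(ltW sg0) //; nra.
right.
have small_n : Num.sqrt eta * (2 ^+ n / Num.sqrt n%:R) <= 2 ^+ n / Num.sqrt n%:R.
  by rewrite ler_piMl // -[leRHS]sqrtr1 ler_wsqrtr // ltW.
have [all_small|] := pselect (forall v, #|[set i | (w i == v) || (w i == - v)]|%:R <= K * #|I|%:R).
  by apply: le_trans small_n; exact: (HK I w p S F n0 cS w0 FS all_small).
move=> /existsNP[v1 /negP]; rewrite -ltNge => big1.
pose C1 := [set i | (w i == v1) || (w i == - v1)].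
have [i1 i1C] : exists i, i \in C1.
  by apply/card_gt0P; rewrite -(ltr0n R); apply: le_lt_trans big1; rewrite mulr_ge0 // ltW.
have v10 : v1 != 0.
  by move: i1C (w0 i1); rewrite inE => /orP[]/eqP ->; rewrite ?oppr_eq0.
(* Off the line of the repeated vector [v1] there remain more than [eta n] indices, and a vector
   repeated among them is not parallel to [v1]. *)
pose Q := [set i | ~~ (w i <= v1)%MS].
have Qbig : eta * n%:R < #|Q|%:R.
  rewrite ltNge; apply/negP => le; apply: noline; exists v1; split=> //.
  have : #|[set i | (w i <= v1)%MS]|%:R + #|Q|%:R = n%:R :> R.
    rewrite -natrD; congr (_%:R); rewrite /n -(cardsC [set i | (w i <= v1)%MS]).
    by congr (_ + _)%N; apply: eq_card => i; rewrite !inE.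
  lra.
have Qp : (0 : R) < #|Q|%:R by apply: lt_trans Qbig; rewrite mulr_gt0.
have Q0 : (0 < #|Q|)%N by rewrite -(ltr0n R).
have [Q_small|] := pselect (forall v, #|[set i in Q | (w i == v) || (w i == - v)]|%:R <= K * #|Q|%:R).
  apply: le_trans (fiber_bound (G := Q) (b := Num.sqrt eta * (2 ^+ #|Q| / Num.sqrt #|Q|%:R)) FS _) _.
    move=> p' F' F'S.
    have := HK _ (fun z : {x | x \in Q} => w (val z)) p' S F'; rewrite card_sub_set; apply=> //.
    move=> v; apply: le_trans (Q_small v).
    rewrite ler_nat -(card_imset _ (@val_inj _ _ {x | x \in Q})).
    apply/subset_leq_card/fintype.subsetP => _ /finset.imsetP[z + ->].
    by rewrite !inE => ->; rewrite andbT; have := valP z; rewrite inE.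
  rewrite (fib Q _ Q0) [leRHS]mulrC ler_wpM2r ?exprn_ge0 //.
  rewrite ler_pdivrMr ?sqrtr_gt0 // mulrC ler_pdivlMr // -sqrtrM ?(ltW eta0) //.
  by rewrite ler_wsqrtr // ltW.
move=> /existsNP[v2 /negP]; rewrite -ltNge => big2.
pose C2 := [set i in Q | (w i == v2) || (w i == - v2)].
have [i2 i2C] : exists i, i \in C2.
  by apply/card_gt0P; rewrite -(ltr0n R); apply: le_lt_trans big2; rewrite mulr_ge0 // ltW.
have v21 : ~~ (v2 <= v1)%MS.
  move: i2C; rewrite !inE => /andP[+ /orP[]/eqP e]; rewrite e //.
  by rewrite eqmx_opp.
have ind c1' d1 : c1' *: v1 + d1 *: v2 = 0 -> c1' = 0 /\ d1 = 0.
  have [->|d0] := eqVneq d1 0.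
    by rewrite scale0r addr0 => /eqP; rewrite scaler_eq0 (negbTE v10) orbF => /eqP.
  move=> /(congr1 (fun x => d1^-1 *: x)); rewrite scaler0 scalerDr !scalerA mulVf // scale1r.
  move=> /eqP; rewrite addrC addr_eq0 => /eqP e; move: v21; rewrite e eqmx_opp.
  by rewrite scalemx_sub.
(* Both classes are cut down to the common size [M], since the grid is square. *)
pose M := Num.truncn (ka * n%:R).
have kan0 : 0 <= ka * n%:R by rewrite mulr_ge0 // ltW.
have Mle : M%:R <= ka * n%:R by rewrite truncn_le.
have Mgt : ka * n%:R < M%:R + 1 by rewrite natr1 truncnS_gt.
have MM0 : (M0 <= M)%N.
  by rewrite -(ler_nat R); move: nbig; rewrite -natr1; lra.
have M1 : 1 <= M%:R :> R.
  by move: nbig; have : 0 <= M0%:R :> R by []; rewrite -natr1; lra.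
have [B1 B1C B1M] : exists2 B : {set I}, B \subset C1 & #|B| = M.
  apply: subset_of_card; rewrite -(ler_nat R); apply: le_trans Mle _; apply: le_trans (ltW big1).
  by rewrite /ka -mulrA ler_wpM2l ?(ltW K0) // -/n ler_piMl // ltW.
have [B2 B2C B2M] : exists2 B : {set I}, B \subset C2 & #|B| = M.
  apply: subset_of_card; rewrite -(ler_nat R); apply: le_trans Mle _; apply: le_trans (ltW big2).
  by rewrite /ka -mulrA ler_wpM2l ?(ltW K0) // ltW.
have w1 i : i \in B1 -> w i = v1 \/ w i = - v1.
  by move=> /(fintype.subsetP B1C); rewrite inE => /orP[]/eqP ->; auto.
have w2 i : i \in B2 -> w i = v2 \/ w i = - v2.
  by move=> /(fintype.subsetP B2C); rewrite inE => /andP[_ /orP[]/eqP ->]; auto.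
have dis i : i \in B2 -> i \notin B1.
  move=> iB2; apply/negP => /w1 e.
  have := fintype.subsetP B2C i iB2; rewrite !inE => /andP[/negP + _]; apply.
  by case: e => ->; rewrite ?eqmx_opp.
pose G := B1 :|: B2.
have gM : #|G| = (M + M)%N.
  rewrite /G cardsU B1M B2M (_ : B1 :&: B2 = finset.set0) ?cards0 ?subn0 //.
  apply/setP => i; rewrite finset.in_setI finset.in_set0; apply/negP => /andP[i1B /dis].
  by rewrite i1B.
pose BG := [set z : {x | x \in G} | val z \in B1].
have BGM : #|BG| = M.
  rewrite -B1M -(card_imset _ (@val_inj _ _ {x | x \in G})); apply: eq_card => i.
  apply/finset.imsetP/idP => [[z + ->]|iB]; first by rewrite inE.
  have iG : i \in G by rewrite inE iB.
  by exists (exist _ i iG); rewrite ?inE.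
have BCM : #|~: BG| = M.
  by apply/eqP; rewrite -(eqn_add2l #|BG|) cardsC card_sub_set gM BGM.
apply: le_trans (fiber_bound (G := G) (b := Num.sqrt (ka / 2) * (2 ^+ #|G| / Num.sqrt M%:R)) FS _) _.
  move=> p' F' F'S.
  have := HM _ (fun z : {x | x \in G} => w (val z)) p' S F' BG v1 v2 M MM0 BGM BCM cS ind.
  rewrite card_sub_set; apply=> // z; rewrite inE; first exact: w1.
  by move=> zB; apply: w2; have := valP z; rewrite inE (negbTE zB).
have -> : 2 ^+ (n - #|G|) * (Num.sqrt (ka / 2) * (2 ^+ #|G| / Num.sqrt M%:R)) =
    Num.sqrt (ka / 2) / Num.sqrt M%:R * 2 ^+ n :> R.
  by have gn : (#|G| <= n)%N := max_card (mem G); rewrite -[in RHS](subnK gn) exprD; ring.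
rewrite [leRHS]mulrC ler_wpM2r ?exprn_ge0 //.
have Mp : 0 < M%:R :> R by lra.
rewrite ler_pdivrMr ?sqrtr_gt0 // [leRHS]mulrC ler_pdivlMr // -sqrtrM ?divr_ge0 ?(ltW ka0) //.
by rewrite ler_wsqrtr //; lra.
Qed.

Local Open Scope classical_set_scope.

Lemma measure_bigsetU_le d (T : measurableType d) (R : realType)
    (mu : {measure set T -> \bar R}) (J : Type) (s : seq J) (Q : pred J) (A : J -> set T) :
  (forall i, measurable (A i)) ->
  (mu (\big[setU/set0]_(i <- s | Q i) A i) <= \sum_(i <- s | Q i) mu (A i))%E.
Proof.
move=> mA; elim: s => [|j s IH]; first by rewrite !big_nil measure0.
rewrite !big_cons; case: (Q j) => //.
apply: le_trans (measureU2 _ (mA j) _) _; last exact: leeD2l.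
by apply: bigsetU_measurable => i _; exact: mA.
Qed.

(** * From counting to probability *)

Section Rademacher.
Variables (R : realType) (d : measure_display) (T : measurableType d) (P : probability T R).
Variables (n : nat) (xi : 'I_n -> {RV P >-> R}).
Hypothesis rxi : forall i, rademacher (xi i).
Hypothesis ixi : mutually_independent xi.

Let sgn (X : {set 'I_n}) (i : 'I_n) : R := if i \in X then 1 else -1.

Lemma rademacher_pattern (X : {set 'I_n}) :
  P [set w | forall i, xi i w = sgn X i] = ((2 ^+ n)^-1)%:E.
Proof.
have := ixi [set: 'I_n]%SET (B := fun i => [set sgn X i]) (fun i => measurable_set1 _).
have -> : [set w | forall i, i \in [set: 'I_n]%SET -> [set sgn X i] (xi i w)] =
    [set w | forall i, xi i w = sgn X i].
  by apply/seteqP; split=> w /= H i; [apply: H; rewrite inE | move=> _; exact: H].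
move=> ->; rewrite (eq_bigr (fun=> (2^-1 : R)%:E)) => [|i _].
  by rewrite prodEFin prodr_const cardsT card_ord exprVn.
have [r1 r2] := rxi i; rewrite /sgn; case: ifP => _; first exact: r1.
exact: r2.
Qed.

Lemma rademacher_values i : P [set w | xi i w <> 1 /\ xi i w <> -1] = 0%E.
Proof.
have [r1 r2] := rxi i.
have m1 : measurable [set w | xi i w = 1].
  by have := measurable_funPTI (xi i) (measurable_set1 (1 : R)).
have m2 : measurable [set w | xi i w = -1].
  by have := measurable_funPTI (xi i) (measurable_set1 (-1 : R)).
have -> : [set w | xi i w <> 1 /\ xi i w <> -1] =
    ~` ([set w | xi i w = 1] `|` [set w | xi i w = -1]).
  by rewrite setCU; apply/seteqP; split=> w.
rewrite probability_setC; last exact: measurableU.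
rewrite measureU //; last first.
  apply/seteqP; split=> // w [] /= -> /eqP.
  by rewrite -subr_eq0 opprK (_ : 1 + 1 = 2%:R) // pnatr_eq0.
transitivity ((1 : R)%:E - ((2^-1 : R)%:E + (2^-1 : R)%:E))%E.
  by congr (_ - (_ + _))%E; [exact: r1 | exact: r2].
by rewrite -EFinD; congr (_%:E); lra.
Qed.

(** Up to the null set where some variable is neither 1 nor -1, the event is covered by the sign
    patterns that satisfy [g], each of probability [2 ^- n]. *)
Lemma rademacher_event_le (g : ('I_n -> R) -> Prop) :
  measurable [set w | g (fun i => xi i w)] ->
  (P [set w | g (fun i => xi i w)] <=
   (#|[set X : {set 'I_n} | `[< g (sgn X) >]]%SET|%:R / 2 ^+ n)%:E)%E.
Proof.
move=> mE; pose Fg := [set X : {set 'I_n} | `[< g (sgn X) >]]%SET.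
pose EX (X : {set 'I_n}) := [set w | forall i, xi i w = sgn X i].
pose Nl i := [set w | xi i w <> 1 /\ xi i w <> -1].
have mEX X : measurable (EX X).
  have -> : EX X = \bigcap_(i in [set: 'I_n]) [set w | xi i w = sgn X i].
    by apply/seteqP; split=> w /= H i => [_|]; exact: H.
  apply: fin_bigcap_measurable; first exact: finite_finset.
  by move=> i _; have := measurable_funPTI (xi i) (measurable_set1 (sgn X i)).
have mN i : measurable (Nl i).
  have -> : Nl i = ~` ([set w | xi i w = 1] `|` [set w | xi i w = -1]).
    by rewrite setCU; apply/seteqP; split=> w.
  apply: measurableC; apply: measurableU.
    by have := measurable_funPTI (xi i) (measurable_set1 (1 : R)).
  by have := measurable_funPTI (xi i) (measurable_set1 (-1 : R)).
pose U1 := \big[setU/set0]_(X in Fg) EX X.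
pose U2 := \big[setU/set0]_(i : 'I_n) Nl i.
have mU1 : measurable U1 by apply: bigsetU_measurable.
have mU2 : measurable U2 by apply: bigsetU_measurable.
have sub : [set w | g (fun i => xi i w)] `<=` U1 `|` U2.
  move=> w /= gw; have [[i Hi]|no] := pselect (exists i, Nl i w).
    by right; rewrite /U2 (bigD1 i) //=; left.
  left; pose X := [set i | xi i w == 1]%SET.
  have wX i : xi i w = sgn X i.
    rewrite /sgn inE; case: eqP => // x1; apply: contrapT => x2.
    by apply: no; exists i.
  rewrite /U1 (bigD1 X) /=; first by left.
  rewrite inE; apply/asboolP; rewrite (_ : sgn X = fun i => xi i w) //.
  by apply/funext => i; rewrite wX.
apply: le_trans (le_measure _ _ _ sub) _; rewrite ?inE //; first exact: measurableU.
apply: le_trans (measureU2 _ mU1 mU2) _.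
have P2 : (P U2 <= 0)%E.
  apply: le_trans (measure_bigsetU_le P _ _ mN) _.
  by rewrite big1 // => i _; exact: rademacher_values.
apply: (@le_trans _ _ (P U1 + 0)%E); first by apply: leeD2l; exact: P2.
rewrite adde0; apply: le_trans (measure_bigsetU_le P _ _ mEX) _.
rewrite (eq_bigr (fun=> ((2 ^+ n)^-1 : R)%:E)) => [|X _]; last exact: rademacher_pattern.
by rewrite sumEFin lee_fin sumr_const -[leLHS]mulr_natl.
Qed.

End Rademacher.

Theorem theorem1p6 (R : realType) (k : nat) :
  exists2 o : nat -> R, o n @[n --> \oo] --> (0 : R) &
  forall (n : nat) (S : set 'rV[R]_k) (a : 'I_n -> 'rV[R]_k)
    (d : measure_display) (T : measurableType d) (P : probability T R)
    (xi : 'I_n -> {RV P >-> R}),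
    (0 < n)%N ->
    convex_position S ->
    (forall i, a i != 0) ->
    (forall i, rademacher (xi i)) ->
    mutually_independent xi ->
    let E := [set w | S (\sum_(i < n) xi i w *: a i)] in
    measurable E ->
    (P E <= ((2 * Num.sqrt (2 / pi) + o n) * n%:R `^ (- 2^-1))%:E)%E.
Proof.
pose c : R := 2 * Num.sqrt (2 / pi).
have c0 : 0 <= c by rewrite mulr_ge0 // sqrtr_ge0.
(* Starting from all signs -1, each index of [X] adds [2 a i]; hence the doubled steps and the base
   point. *)
pose fam n (S : set 'rV[R]_k) (a : 'I_n -> 'rV[R]_k) : {set {set 'I_n}} :=
  [set X : {set 'I_n} | `[< S (subset_sum (fun i => 2 *: a i) (- \sum_i a i) X) >]]%SET.
pose dens n (S : set 'rV[R]_k) (a : 'I_n -> 'rV[R]_k) : R :=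
  #|fam n S a|%:R / 2 ^+ n * Num.sqrt n%:R - c.
(* The supremum over [S] and [a] makes the error term uniform, and it involves no probability space.
   Including 0 makes it nonnegative, so that an upper estimate gives convergence. *)
pose A n : set R := [set r | r = 0 \/ exists (S : set 'rV[R]_k) a,
  [/\ convex_position S, forall i, a i != 0 & r = dens n S a]].
have A0 n : A n !=set0 by exists 0; left.
(* There are at most [2 ^ n] sign patterns, so the supremum is finite for every [n]. *)
have Aub n : has_ubound (A n).
  exists (Num.sqrt n%:R) => r [->|[S [a [_ _ ->]]]]; first exact: sqrtr_ge0.
  rewrite /dens lerBlDr (@le_trans _ _ (Num.sqrt n%:R)) ?lerDl //.
  rewrite ler_piMl ?sqrtr_ge0 // ler_pdivrMr ?exprn_gt0 // mul1r -natrX ler_nat.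
  by rewrite (leq_trans (max_card _)) // -cardsT -powersetT card_powerset cardsT card_ord.
exists (fun n => sup (A n)).
  apply/cvgrPdist_le => eps e0.
  have [n0 Hn0] := @counting_bound R k eps e0.
  near=> n; rewrite sub0r normrN ger0_norm; last by apply: ub_le_sup => //; left.
  apply: ge_sup => // r [->|[S [a [cS a0 ->]]]]; first exact: ltW.
  have n1 : (0 < n)%N by near: n; exact: nbhs_infty_gt.
  have sn0 : 0 < Num.sqrt n%:R :> R by rewrite sqrtr_gt0 ltr0n.
  rewrite /dens lerBlDr addrC -ler_pdivlMr // ler_pdivrMr ?exprn_gt0 // mulrAC -mulrA.
  have := Hn0 _ (fun i : 'I_n => 2 *: a i) (- \sum_i a i) S (fam n S a).
  rewrite card_ord; apply=> //.
  - by near: n; exact: nbhs_infty_ge.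
  - by move=> i; rewrite scaler_eq0 negb_or a0 andbT pnatr_eq0.
  - by move=> X; rewrite inE => /asboolP.
move=> n S a d T P xi n0 cS a0 rxi ixi E mE.
have := @rademacher_event_le R d T P n xi rxi ixi (fun x => S (\sum_i x i *: a i)) mE.
move=> /le_trans; apply; rewrite lee_fin powRN powR12_sqrt //.
have sn0 : 0 < Num.sqrt n%:R :> R by rewrite sqrtr_gt0 ltr0n.
rewrite ler_pdivlMr // -lerBlDl.
apply: ub_le_sup => //; right; exists S, a; split=> //.
rewrite /dens; congr (#|pred_of_set _|%:R / _ * _ - _)%R.
apply/setP => X; rewrite !inE; congr (asbool (S _)); rewrite /subset_sum addrC.
rewrite [\sum_(i in X) _]big_mkcond /= -sumrN -big_split; apply: eq_bigr => i _ /=.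
by case: ifP => _; rewrite ?scale1r ?scaleN1r ?add0r // scaler_nat mulr2n addrK.
Unshelve. all: by end_near.
Qed.
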